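(* Let $W_1$ and $W_2$ be $J$-reflection groups. The following hold: (i) The center of $\mathcal{B}(W_1)$ is cyclic and is sent onto the center of $W_1$ under the natural quotient $\mathcal{B}(W_1)\to W_1$. (ii) If $W_1$ and $W_2$ are isomorphic in reflection, the groups $\mathcal{B}(W_1)$ and $\mathcal{B}(W_2)$ are isomorphic.
   Context: $\mathbb{N}^*$ is the set of positive integers; empty products equal $1$ (so $x_i\cdots x_j=1$ if $j=i-1$). $J$-reflection groups. For integers $k,n,m\ge 2$, $J(k,n,m)=\langle s,t,u\mid s^k=t^n=u^m=1,\ stu=tus=ust\rangle$. For $k,b,n,c,m\in\mathbb{N}^*$ with $k,bn,cm\ge2$ and $n,m$ coprime, the $J$-reflection group $W_b^c(k,bn,cm)$ is the normal closure of $\{s,t^n,u^m\}$ in $J(k,bn,cm)$. Braid groups. For coprime $n,m\in\mathbb{N}^*$ write $m=qn+r$ with $q\ge 0$, $0\le r\le n-1$. $\mathcal{B}_*^*(n,m)$ is the group with generators $x_1,\dots,x_n,y,z$ and relations (with $\delta:=x_1\cdots x_ny$): (1) $x_1\cdots x_nyz=zx_1\cdots x_ny$; (2) $x_{i+1}\cdots x_nyz\delta^{q-1}x_1\cdots x_{i+r}=x_i\cdots x_nyz\delta^{q-1}x_1\cdots x_{i+r-1}$ for all $1\le i\le n-r$; (3) $x_{i+1}\cdots x_nyz\delta^{q}x_1\cdots x_{i+r-n}=x_i\cdots x_nyz\delta^{q}x_1\cdots x_{i+r-n-1}$ for all $n-r+1\le i\le n$. If $m\ge2$, $\mathcal{B}_*(n,m)$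 is the quotient of $\mathcal{B}_*^*(n,m)$ by the normal closure of $z$; if $n\ge 2$, $\mathcal{B}^*(n,m)$ is the quotient by the normal closure of $y$; if $n,m\ge2$, $\mathcal{B}(n,m)$ is the quotient by the normal closure of $\{y,z\}$. The braid group $\mathcal{B}(W)$ associated to $W=W_b^c(k,bn,cm)$ is $\mathcal{B}_*^*(n,m)$ if $b,c\ge2$; $\mathcal{B}_*(n,m)$ if $b\ge2$, $c=1$; $\mathcal{B}^*(n,m)$ if $b=1$, $c\ge2$; $\mathcal{B}(n,m)$ if $b=c=1$. Natural quotient. It is known that $W_b^c(k,bn,cm)$ is presented by generators $x_1,\dots,x_n,y,z$, the relations (1)–(3), and $x_i^k=y^b=z^c=1$, where $x_i=t^{i-1}st^{1-i}$, $y=t^n$, $z=u^m$. The natural quotient $\mathcal{B}(W)\to W$ is the surjective homomorphism sending each generator $x_i$, $y$, $z$ (among those present in $\mathcal{B}(W)$) to the element of $W$ of the same name. Reflection isomorphism. For $H=W_b^c(k,bn,cm)$, $R(H)$ is the set of conjugates in $J(k,bn,cm)$ of non-trivial powers of $s$, $t^n$ or $u^m$. Two $J$-reflection groups $H_1,H_2$ are isomorphic in reflection if there is a group isomorphism $H_1\to H_2$ sending $R(H_1)$ onto $R(H_2)$. *)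

(* Defs.v *)
From HB Require Import structures.
From mathcomp Require Import all_boot generic_quotient ssralg ssrint zify.
From mathcomp Require Import boolp classical_sets.

Set Implicit Arguments.
Unset Strict Implicit.
Unset Printing Implicit Defensive.

Local Open Scope quotient_scope.
Local Open Scope classical_set_scope.
Local Open Scope group_scope.

Section GroupNotions.
Variable G : groupType.
Implicit Types (g h : G) (N S : set G).

Definition expgz g (i : int) : G :=
  match i with Posz n => g ^+ n | Negz n => g ^- n.+1 end.

Definition center : set G := [set z | forall g, commute z g].

Definition cyclic_subgroup (A : set G) : Prop :=
  exists g, A = [set expgz g i | i in [set: int]].

Definition normal_subgroup N : Prop :=
  [/\ N 1, forall g h, N g -> N h -> N (g * h),
      forall g, N g -> N g^-1 & forall g h, N g -> N (g ^ h)].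

Definition normal_closure S : set G :=
  \bigcap_(N in [set N | normal_subgroup N /\ S `<=` N]) N.

Lemma normal_closureP S : normal_subgroup (normal_closure S).
Proof.
split=> [N [[]//]|g h Sg Sh N NS|g Sg N NS|g h Sg N NS];
  have [[_ NM NV NJ] _] := NS.
- exact: NM (Sg _ NS) (Sh _ NS).
- exact: NV (Sg _ NS).
- exact: NJ (Sg _ NS).
Qed.

Lemma sub_normal_closure S : S `<=` normal_closure S.
Proof. by move=> g Sg N [_]; apply. Qed.

Lemma expgz_pred g (q : nat) : expgz g (q%:Z - 1)%R = g ^+ q * g^-1.
Proof.
case: q => [|q]; first by rewrite GRing.sub0r mul1g /= expg1.
by rewrite -addn1 PoszD GRing.addrK /= addn1 expgSr mulgK.
Qed.

End GroupNotions.
Arguments center : clear implicits.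

Definition isomorphic (G H : groupType) : Prop :=
  exists f : {multiplicative G -> H}, bijective f.

Lemma multiplicative1 (G H : groupType) (f : {multiplicative G -> H}) :
  f 1 = 1.
Proof. by apply: (@mulgI _ (f 1)); rewrite -gmulfM !mulg1. Qed.

Lemma multiplicativeV (G H : groupType) (f : {multiplicative G -> H}) g :
  f g^-1 = (f g)^-1.
Proof. by apply: (@mulgI _ (f g)); rewrite -gmulfM !mulgV multiplicative1. Qed.

(* The quotient of G by the normal closure of S. *)
Section Quotient.
Variables (G : groupType) (S : set G).

Definition quot_rel : rel G := fun g h => `[< normal_closure S (g^-1 * h) >].

Lemma quot_rel_refl : reflexive quot_rel.
Proof. by move=> g; apply/asboolP; rewrite mulVg; have [] := normal_closureP S. Qed.

Lemma quot_rel_sym : symmetric quot_rel.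
Proof.
have [_ _ NV _] := normal_closureP S.
by move=> g h; apply/asboolP/asboolP => /NV; rewrite invgM invgK.
Qed.

Lemma quot_rel_trans : transitive quot_rel.
Proof.
have [_ NM _ _] := normal_closureP S.
move=> h g l /asboolP gh /asboolP hl; apply/asboolP.
by have := NM _ _ gh hl; rewrite -mulgA mulVKg.
Qed.

Canonical quot_equiv :=
  EquivRel quot_rel quot_rel_refl quot_rel_sym quot_rel_trans.

Definition quot : Type := {eq_quot quot_equiv}.
HB.instance Definition _ := Choice.on quot.
HB.instance Definition _ := EqQuotient.on quot.


Lemma quot_eqP g h :
  reflect (normal_closure S (g^-1 * h)) (g == h %[mod quot]).
Proof. by rewrite [_ == _](eqmodE quot_equiv); exact: asboolP. Qed.

Definition quot_one : quot := \pi_quot 1.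
Definition quot_mul (a b : quot) : quot := \pi_quot (repr a * repr b).
Definition quot_inv (a : quot) : quot := \pi_quot (repr a)^-1.

Lemma pi_quot_mul g h : quot_mul (\pi_quot g) (\pi_quot h) = \pi_quot (g * h).
Proof.
have [_ NM _ NJ] := normal_closureP S.
apply/eqP; rewrite /quot_mul; case: piP => g' /eqP/quot_eqP gg'.
case: piP => h' /eqP/quot_eqP hh'; rewrite eq_sym; apply/quot_eqP.
have := NM _ _ (NJ _ h gg') hh'.
by rewrite conjgE invgM !mulgA mulgK.
Qed.

Lemma pi_quot_inv g : quot_inv (\pi_quot g) = \pi_quot g^-1.
Proof.
have [_ _ NV NJ] := normal_closureP S.
apply/eqP; rewrite /quot_inv; case: piP => g' /eqP/quot_eqP gg'.
apply/quot_eqP; rewrite invgK.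
by have := NJ _ g^-1 gg'; rewrite conjgE invgK !mulgA mulgV mul1g.
Qed.

Fact quot_mulA : associative quot_mul.
Proof. by move=> a b c; rewrite -[a]reprK -[b]reprK -[c]reprK;
  move: (repr a) (repr b) (repr c) => {}a {}b {}c; rewrite (pi_quot_mul b c) (pi_quot_mul a b) !pi_quot_mul mulgA. Qed.
Fact quot_mul1 : left_id quot_one quot_mul.
Proof. by move=> a; rewrite -[a]reprK; move: (repr a) => {}a; rewrite pi_quot_mul mul1g. Qed.
Fact quot_mulr1 : right_id quot_one quot_mul.
Proof. by move=> a; rewrite -[a]reprK; move: (repr a) => {}a; rewrite pi_quot_mul mulg1. Qed.
Fact quot_mulV : left_inverse quot_one quot_inv quot_mul.
Proof. by move=> a; rewrite -[a]reprK; move: (repr a) => {}a; rewrite pi_quot_inv pi_quot_mul mulVg. Qed.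
Fact quot_mulrV : right_inverse quot_one quot_inv quot_mul.
Proof. by move=> a; rewrite -[a]reprK; move: (repr a) => {}a; rewrite pi_quot_inv pi_quot_mul mulgV. Qed.

HB.instance Definition _ := isGroup.Build quot
  quot_mulA quot_mul1 quot_mulr1 quot_mulV quot_mulrV.

Definition quot_proj (g : G) : quot := \pi_quot g.

Lemma quot_projM : {morph quot_proj : g h / g * h}.
Proof. by move=> g h; rewrite -[RHS]/(quot_mul _ _) pi_quot_mul. Qed.

HB.instance Definition _ := isMultiplicative.Build G quot quot_proj quot_projM.

Section Lift.
Variables (H : groupType) (f : {multiplicative G -> H}).
Hypothesis f_S : forall g, S g -> f g = 1.

Definition quot_lift_fun (a : quot) : H := f (repr a).

Lemma quot_lift_proj g : quot_lift_fun (quot_proj g) = f g.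
Proof.
rewrite /quot_lift_fun /quot_proj; case: piP => g' /eqP/quot_eqP gg'.
have: f (g^-1 * g') = 1.
  apply: (gg' [set x | f x = 1]); split=> //; split=> /=.
  - exact: multiplicative1.
  - by move=> x y fx fy; rewrite gmulfM fx fy mulg1.
  - by move=> x fx; rewrite multiplicativeV fx invg1.
  - by move=> x y fx; rewrite conjgE !gmulfM fx mul1g -gmulfM mulVg multiplicative1.
by rewrite gmulfM multiplicativeV => /eqP; rewrite mulg_eq1 => /eqP/invg_inj.
Qed.

Lemma quot_lift_funM : {morph quot_lift_fun : a b / a * b}.
Proof.
move=> a b.
rewrite -[a]reprK -[b]reprK; move: (repr a) (repr b) => {}a {}b.
by rewrite -!/(quot_proj _) -quot_projM !quot_lift_proj gmulfM.
Qed.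

HB.instance Definition _ :=
  isMultiplicative.Build quot H quot_lift_fun quot_lift_funM.

Definition quot_lift : {multiplicative quot -> H} := quot_lift_fun.

End Lift.
End Quotient.

(* The free group on X: words in the letters (x, true) = x and
   (x, false) = x^-1, up to insertion and deletion of (x, e) (x, ~~ e). *)
Section FreeGroup.
Variable X : choiceType.
Definition word := seq (X * bool).

Inductive word_equiv : word -> word -> Prop :=
| word_equiv_refl w : word_equiv w w
| word_equiv_sym v w : word_equiv v w -> word_equiv w v
| word_equiv_trans u v w : word_equiv u v -> word_equiv v w -> word_equiv u w
| word_equiv_cancel v w x e :
    word_equiv (v ++ [:: (x, e); (x, ~~ e)] ++ w) (v ++ w).

Definition word_rel : rel word := fun v w => `[< word_equiv v w >].

Lemma word_rel_refl : reflexive word_rel.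
Proof. by move=> w; apply/asboolP; constructor. Qed.
Lemma word_rel_sym : symmetric word_rel.
Proof. by move=> v w; apply/asboolP/asboolP => /word_equiv_sym. Qed.
Lemma word_rel_trans : transitive word_rel.
Proof.
by move=> v u w /asboolP uv /asboolP vw; apply/asboolP/(word_equiv_trans uv).
Qed.

Canonical free_equiv :=
  EquivRel word_rel word_rel_refl word_rel_sym word_rel_trans.

Definition free : Type := {eq_quot free_equiv}.
HB.instance Definition _ := Choice.on free.
HB.instance Definition _ := EqQuotient.on free.


Lemma free_eqP v w : reflect (word_equiv v w) (v == w %[mod free]).
Proof. by rewrite [_ == _](eqmodE free_equiv); exact: asboolP. Qed.

Definition word_inv (w : word) : word :=
  rev [seq (a.1, ~~ a.2) | a <- w].

Lemma word_equiv_cat u1 v1 u2 v2 :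
  word_equiv u1 v1 -> word_equiv u2 v2 -> word_equiv (u1 ++ u2) (v1 ++ v2).
Proof.
move=> h1 h2; apply: (@word_equiv_trans _ (v1 ++ u2)).
  elim: h1 => {v1 u1 h2} [w|v w _ IH|u v w _ uv _ vw|v w x e].
  - exact: word_equiv_refl.
  - exact: word_equiv_sym.
  - exact: word_equiv_trans uv vw.
  - by rewrite -!catA; exact: word_equiv_cancel.
elim: h2 => {u2 v2 h1} [w|v w _ IH|u v w _ uv _ vw|v w x e].
- exact: word_equiv_refl.
- exact: word_equiv_sym.
- exact: word_equiv_trans uv vw.
- by rewrite !(catA v1); exact: word_equiv_cancel.
Qed.

Lemma word_equiv_inv v w :
  word_equiv v w -> word_equiv (word_inv v) (word_inv w).
Proof.
elim=> {v w} [w|v w _ IH|u v w _ uv _ vw|v w x e].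
- exact: word_equiv_refl.
- exact: word_equiv_sym.
- exact: word_equiv_trans uv vw.
- rewrite /word_inv !map_cat !rev_cat -catA /= negbK.
  exact: (word_equiv_cancel (rev _) (rev _)).
Qed.

Lemma word_invK : involutive word_inv.
Proof.
move=> w; rewrite /word_inv map_rev revK -map_comp.
by rewrite -[RHS]map_id; apply: eq_map => -[x e] /=; rewrite negbK.
Qed.

Lemma word_equivV w : word_equiv (word_inv w ++ w) [::].
Proof.
elim: w => [|[x e] w IH]; first exact: word_equiv_refl.
apply: word_equiv_trans IH.
rewrite /word_inv /= rev_cons cat_rcons -/(word_inv w).
by have := word_equiv_cancel (word_inv w) w x (~~ e); rewrite negbK.
Qed.

Definition free_one : free := \pi_free [::].
Definition free_mul (a b : free) : free := \pi_free (repr a ++ repr b).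
Definition free_inv (a : free) : free := \pi_free (word_inv (repr a)).

Lemma pi_free_mul v w : free_mul (\pi_free v) (\pi_free w) = \pi_free (v ++ w).
Proof.
apply/eqP; rewrite /free_mul; case: piP => v' /eqP/free_eqP vv'.
case: piP => w' /eqP/free_eqP ww'; rewrite eq_sym; apply/free_eqP.
exact: word_equiv_cat.
Qed.

Lemma pi_free_inv w : free_inv (\pi_free w) = \pi_free (word_inv w).
Proof.
apply/eqP; rewrite /free_inv; case: piP => w' /eqP/free_eqP ww'.
by rewrite eq_sym; apply/free_eqP/word_equiv_inv.
Qed.

Fact free_mulA : associative free_mul.
Proof. by move=> a b c; rewrite -[a]reprK -[b]reprK -[c]reprK;
  move: (repr a) (repr b) (repr c) => {}a {}b {}c; rewrite (pi_free_mul b c) (pi_free_mul a b) !pi_free_mul catA. Qed.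
Fact free_mul1 : left_id free_one free_mul.
Proof. by move=> a; rewrite -[a]reprK; move: (repr a) => {}a; rewrite pi_free_mul. Qed.
Fact free_mulr1 : right_id free_one free_mul.
Proof. by move=> a; rewrite -[a]reprK; move: (repr a) => {}a; rewrite pi_free_mul cats0. Qed.
Fact free_mulV : left_inverse free_one free_inv free_mul.
Proof.
move=> a; rewrite -[a]reprK; move: (repr a) => {}a; rewrite pi_free_inv pi_free_mul.
exact/eqP/free_eqP/word_equivV.
Qed.
Fact free_mulrV : right_inverse free_one free_inv free_mul.
Proof.
move=> a; rewrite -[a]reprK; move: (repr a) => {}a; rewrite pi_free_inv pi_free_mul; apply/eqP/free_eqP.
by rewrite -[X in X ++ _]word_invK; exact: word_equivV.
Qed.

HB.instance Definition _ := isGroup.Build free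
  free_mulA free_mul1 free_mulr1 free_mulV free_mulrV.

Definition gen (x : X) : free := \pi_free [:: (x, true)].

Section Lift.
Variables (H : groupType) (f : X -> H).

Definition word_eval (w : word) : H :=
  \prod_(a <- w) (if a.2 then f a.1 else (f a.1)^-1).

Lemma word_eval_cat v w : word_eval (v ++ w) = word_eval v * word_eval w.
Proof. exact: big_cat. Qed.

Lemma word_eval_equiv v w : word_equiv v w -> word_eval v = word_eval w.
Proof.
elim=> {v w} [//|//|u v w _ -> _ ->//|v w x e].
rewrite !word_eval_cat; congr (_ * _); rewrite /word_eval !big_cons big_nil.
by case: e; rewrite /= mulg1 ?mulgV ?mulVg mul1g.
Qed.

Definition free_lift_fun (a : free) : H := word_eval (repr a).

Lemma free_lift_pi w : free_lift_fun (\pi_free w) = word_eval w.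
Proof.
rewrite /free_lift_fun; case: piP => w' /eqP/free_eqP ww'.
exact/esym/word_eval_equiv.
Qed.

Lemma free_lift_funM : {morph free_lift_fun : a b / a * b}.
Proof.
move=> a b.
rewrite -[a]reprK -[b]reprK; move: (repr a) (repr b) => {}a {}b.
by rewrite -[_ * _]/(free_mul _ _) pi_free_mul !free_lift_pi word_eval_cat.
Qed.

HB.instance Definition _ :=
  isMultiplicative.Build free H free_lift_fun free_lift_funM.

Definition free_lift : {multiplicative free -> H} := free_lift_fun.

Lemma free_lift_gen x : free_lift (gen x) = f x.
Proof. by rewrite [LHS]free_lift_pi /word_eval big_seq1. Qed.

End Lift.
End FreeGroup.


(* The group presented by generators X and relations u = v for R u v. *)
Definition relators (G : groupType) (R : G -> G -> Prop) : set G :=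
  [set g | exists u v, R u v /\ g = u * v^-1].

Notation presented X R := (quot (relators (G := free X) R)).

(* The normal closure of S in G, as a group. *)
Section NormalClosureGroup.
Variables (G : groupType) (S : set G).

Definition nclosure : Type := {g : G | g \in normal_closure S}.
HB.instance Definition _ := SubChoice.on nclosure.

Fact nclosure_closed : group_closed (mem (normal_closure S)).
Proof.
have [N1 NM NV _] := normal_closureP S.
split=> [|g h]; rewrite !inE; first exact: N1.
by move=> Ng Nh; apply: NM => //; apply: NV.
Qed.

HB.instance Definition _ := SubChoice_isSubGroup.Build G
  (fun g => g \in normal_closure S) nclosure nclosure_closed.

End NormalClosureGroup.

Variant J_gen := Js | Jt | Ju.

Definition J_gen_code (g : J_gen) : option bool :=
  match g with Js => None | Jt => Some true | Ju => Some false end.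
Definition J_gen_decode (o : option bool) : J_gen :=
  match o with None => Js | Some true => Jt | Some false => Ju end.
Fact J_gen_codeK : cancel J_gen_code J_gen_decode. Proof. by case. Qed.
HB.instance Definition _ := Choice.copy J_gen (can_type J_gen_codeK).

Variant J_rel (G : groupType) (k n m : nat) (s t u : G) : G -> G -> Prop :=
| J_rel_s : J_rel k n m s t u (s ^+ k) 1
| J_rel_t : J_rel k n m s t u (t ^+ n) 1
| J_rel_u : J_rel k n m s t u (u ^+ m) 1
| J_rel_stu : J_rel k n m s t u (s * t * u) (t * u * s)
| J_rel_tus : J_rel k n m s t u (t * u * s) (u * s * t).

Definition J_group (k n m : nat) : groupType :=
  presented J_gen (J_rel k n m (gen Js) (gen Jt) (gen Ju)).

Definition J_s (k n m : nat) : J_group k n m := quot_proj _ (gen Js).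
Definition J_t (k n m : nat) : J_group k n m := quot_proj _ (gen Jt).
Definition J_u (k n m : nat) : J_group k n m := quot_proj _ (gen Ju).

(* The parameters of W_b^c(k,bn,cm). *)
Record J_reflection := JReflection {
  Jk : nat; Jb : nat; Jn : nat; Jc : nat; Jm : nat;
  Jb_gt0 : (0 < Jb)%N;
  Jn_gt0 : (0 < Jn)%N;
  Jc_gt0 : (0 < Jc)%N;
  Jm_gt0 : (0 < Jm)%N;
  Jk_ge2 : (2 <= Jk)%N;
  Jbn_ge2 : (2 <= Jb * Jn)%N;
  Jcm_ge2 : (2 <= Jc * Jm)%N;
  Jnm_coprime : coprime Jn Jm
}.

Section JReflectionGroup.
Variable D : J_reflection.
Local Notation n := (Jn D).
Local Notation m := (Jm D).

Definition ambient : groupType := J_group (Jk D) (Jb D * n) (Jc D * m).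
Definition amb_s : ambient := J_s _ _ _.
Definition amb_t : ambient := J_t _ _ _.
Definition amb_u : ambient := J_u _ _ _.

Definition W_gens : set ambient :=
  [set g | [\/ g = amb_s, g = amb_t ^+ n | g = amb_u ^+ m]].

Definition W : groupType := nclosure W_gens.

(* R(W), as a subset of W; the conjugation is by elements of J. *)
Definition reflections : set W :=
  [set w | exists g (i : int) (h : ambient),
     [/\ W_gens g, expgz g i <> 1 & val w = expgz g i ^ h]].

End JReflectionGroup.
Arguments reflections : clear implicits.

Definition isomorphic_in_reflection (D1 D2 : J_reflection) : Prop :=
  exists f : {multiplicative W D1 -> W D2},
    bijective f /\ f @` reflections D1 = reflections D2.

(* Bx i stands for x_(i+1). *)
Variant braid_gen (n : nat) := Bx of 'I_n | By | Bz.
Arguments By {n}.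
Arguments Bz {n}.

Section BraidGen.
Variable n : nat.
Definition braid_gen_code (g : braid_gen n) : 'I_n + bool :=
  match g with Bx i => inl i | By => inr true | Bz => inr false end.
Definition braid_gen_decode (o : 'I_n + bool) : braid_gen n :=
  match o with inl i => Bx i | inr true => By | inr false => Bz end.
Fact braid_gen_codeK : cancel braid_gen_code braid_gen_decode.
Proof. by case. Qed.
HB.instance Definition _ :=
  Choice.copy (braid_gen n) (can_type braid_gen_codeK).

(* x_l for 1 <= l <= n; the values at other l are not used. *)
Definition free_x (l : nat) : free (braid_gen n) :=
  if insub l.-1 is Some i then gen (Bx i) else 1.
End BraidGen.

(* x_i x_(i+1) ... x_j, which is 1 if j = i - 1. *)
Definition xprod (G : groupType) (x : nat -> G) (i j : nat) : G :=
  \prod_(i <= l < j.+1) x l.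

(* m = q n + r; the exponent q - 1 is an integer, equal to -1 if m < n. *)
Variant braid_rel (G : groupType) (n m : nat) (x : nat -> G) (y z : G) :
    G -> G -> Prop :=
| braid_rel1 :
    braid_rel n m x y z (xprod x 1 n * y * z) (z * xprod x 1 n * y)
| braid_rel2 (i : nat) :
    let q := m %/ n in let r := m %% n in let delta := xprod x 1 n * y in
    (1 <= i <= n - r)%N ->
    braid_rel n m x y z
      (xprod x i.+1 n * y * z * expgz delta (q%:Z - 1)%R * xprod x 1 (i + r))
      (xprod x i n * y * z * expgz delta (q%:Z - 1)%R * xprod x 1 (i + r - 1))
| braid_rel3 (i : nat) :
    let q := m %/ n in let r := m %% n in let delta := xprod x 1 n * y in
    (n - r + 1 <= i <= n)%N ->
    braid_rel n m x y z
      (xprod x i.+1 n * y * z * delta ^+ q * xprod x 1 (i + r - n))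
      (xprod x i n * y * z * delta ^+ q * xprod x 1 (i + r - n - 1)).

(* braid_yz, braid_y, braid_z and braid_0 are B_*^*(n,m), B_*(n,m), B^*(n,m)
   and B(n,m): the suffix lists the generators among y, z that are kept. *)
Section BraidGroups.
Variables n m : nat.

Definition braid_yz : groupType :=
  presented (braid_gen n) (braid_rel n m (@free_x n) (gen By) (gen Bz)).
Definition braid_x_elt (l : nat) : braid_yz := quot_proj _ (free_x n l).
Definition braid_y_elt : braid_yz := quot_proj _ (gen By).
Definition braid_z_elt : braid_yz := quot_proj _ (gen Bz).

Definition braid_y : groupType := quot [set braid_z_elt].
Definition braid_z : groupType := quot [set braid_y_elt].
Definition braid_0 : groupType := quot [set braid_y_elt; braid_z_elt].

Definition braid (y_present z_present : bool) : groupType :=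
  match y_present, z_present with
  | true, true => braid_yz
  | true, false => braid_y
  | false, true => braid_z
  | false, false => braid_0
  end.

Definition braid_proj (y_present z_present : bool) :
    {multiplicative braid_yz -> braid y_present z_present} :=
  match y_present, z_present with
  | true, true => idfun
  | true, false => @quot_proj _ [set braid_z_elt]
  | false, true => @quot_proj _ [set braid_y_elt]
  | false, false => @quot_proj _ [set braid_y_elt; braid_z_elt]
  end.
End BraidGroups.

Definition braid_group (D : J_reflection) : groupType :=
  braid (Jn D) (Jm D) (2 <= Jb D)%N (2 <= Jc D)%N.

Section Morphisms.
Variables (G H : groupType) (f : {multiplicative G -> H}).

Lemma multiplicativeX g i : f (g ^+ i) = f g ^+ i.
Proof.
elim: i => [|i IH]; first by rewrite !expg0 multiplicative1.
by rewrite !expgS gmulfM IH.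
Qed.

Lemma multiplicative_expgz g i : f (expgz g i) = expgz (f g) i.
Proof. by case: i => i /=; rewrite ?multiplicativeV multiplicativeX. Qed.

Lemma multiplicative_xprod x i j :
  f (xprod x i j) = xprod (fun l => f (x l)) i j.
Proof.
rewrite /xprod; elim: (index_iota _ _) => [|l s IH].
  by rewrite !big_nil multiplicative1.
by rewrite !big_cons gmulfM IH.
Qed.

Lemma braid_rel_morph n m x y z a b :
  braid_rel n m x y z a b ->
  braid_rel n m (fun l => f (x l)) (f y) (f z) (f a) (f b).
Proof.
have fE := (multiplicative_expgz, multiplicativeX, multiplicative_xprod,
            @gmulfM _ _ f).
case=> [|i q r d hi|i q r d hi]; [|rewrite {}/d|rewrite {}/d]; rewrite !fE.
- exact: braid_rel1.
- exact: braid_rel2.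
- exact: braid_rel3.
Qed.

Lemma relators_morph1 (R : G -> G -> Prop) :
  (forall u v, R u v -> f u = f v) -> forall g, relators R g -> f g = 1.
Proof.
by move=> fR _ [u [v [/fR fuv ->]]]; rewrite gmulfM multiplicativeV fuv mulgV.
Qed.

End Morphisms.

Lemma xprod_ext (G : groupType) (x x' : nat -> G) i j :
  (forall l, i <= l <= j -> x l = x' l)%N -> xprod x i j = xprod x' i j.
Proof. by move=> xx'; apply: eq_big_nat => l; rewrite ltnS; apply: xx'. Qed.

Lemma braid_rel_ext (G : groupType) n m (x x' : nat -> G) y z a b :
  (0 < n)%N ->
  (forall l, 1 <= l <= n -> x l = x' l)%N ->
  braid_rel n m x y z a b -> braid_rel n m x' y z a b.
Proof.
move=> n_gt0 xx'.
have X i j : (0 < i)%N -> (j <= n)%N -> xprod x i j = xprod x' i j.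
  move=> i0 jn; apply: xprod_ext => l /andP[il lj]; apply: xx'.
  by rewrite (leq_trans i0 il) (leq_trans lj jn).
have rn : (m %% n < n)%N by rewrite ltn_mod.
case=> [|i q r d hi|i q r d hi]; [|rewrite {}/d|rewrite {}/d].
- by rewrite X //; exact: braid_rel1.
- rewrite /r in hi *; rewrite !X //; try lia; exact: braid_rel2.
- rewrite /r in hi *; rewrite !X //; try lia; exact: braid_rel3.
Qed.

(* The relations of B_*^*(n,m) hold for x_i = t^(i-1) s t^(1-i), y = t^n and
   z = u^m as soon as stu = tus = ust. *)
Section BraidRelationsInJ.
Variables (G : groupType) (n m : nat) (s t u : G).
Hypotheses (n_gt0 : (0 < n)%N).
Hypotheses (stu : s * t * u = t * u * s) (tus : t * u * s = u * s * t).

Let x l : G := t ^+ l.-1 * s * t ^- l.-1.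
Let a := s * t.
Let D := a * u.

Let Dt : commute t D.
Proof. by rewrite /commute /D /a {1}stu tus !mulgA stu. Qed.

Let ua : commute u a.
Proof. by rewrite /commute /a mulgA -tus -stu. Qed.

Let aD : commute a D.
Proof. by apply: commuteM => //; exact: commute_sym. Qed.

Let uE : u = a^-1 * D. Proof. by rewrite mulKg. Qed.

Let umE : u ^+ m = a ^- m * D ^+ m.
Proof. by rewrite {1}uE expgMn ?expVgn //; exact/commute_sym/commuteV/commute_sym. Qed.

Let xprodE i j : (i <= j)%N ->
  xprod x i.+1 j = t ^+ i * a ^+ (j - i) * t ^- j.
Proof.
elim: j => [|j IH].
  by rewrite leqn0 => /eqP->; rewrite /xprod big_nil // !expg0 invg1 !mulg1.
rewrite leq_eqVlt ltnS => /orP[/eqP->|ij].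
  by rewrite subnn /xprod big_geq // expg0 mulg1 mulgV.
rewrite {1}/xprod big_nat_recr //= -/(xprod x i.+1 j) IH // subSn // expgSr.
by rewrite /x /= /a [t ^+ j.+1]expgSr invgM !mulgA mulgVK mulgK.
Qed.

Let power_sum A B C E : (A + B + E = m + C)%N ->
  a ^+ A * a ^- m * a ^+ B * a ^- C * a ^+ E = 1.
Proof.
move=> h.
have c i j : a ^- i * a ^+ j = a ^+ j * a ^- i.
  by apply/commute_sym/commuteV/commuteX2/commute_refl.
rewrite -!mulgA c (mulgA (a ^+ B)) -expgnDr (mulgA (a ^- m)) c.
by rewrite !mulgA -expgnDr addnA h addnC expgnDr mulgK mulgV.
Qed.

Let side A B C E i j : (A + B + E = m + C)%N ->
  t ^+ i * a ^+ A * t ^- n * t ^+ n * u ^+ m * (a ^+ B * a ^- C)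
    * (t ^+ 0 * a ^+ E * t ^- j) = t ^+ i * t ^- j * D ^+ m.
Proof.
move=> h; rewrite mul1g mulgVK umE.
pose K := a ^+ B * a ^- C * (a ^+ E * t ^- j).
have PK : D ^+ m * K = K * D ^+ m.
  apply: commuteM; apply: commuteM; apply/commute_sym;
    do ?[exact/commute_sym/commuteX2];
    exact/commute_sym/commuteV/commute_sym/commuteX2.
rewrite -[LHS]mulgA -/K -!(mulgA (t ^+ i)) -(mulgA (a ^+ A)) -(mulgA (a ^- m)).
rewrite PK /K; congr (_ * _).
by rewrite -[RHS]mul1g -(power_sum h) !mulgA.
Qed.

Lemma braid_rel_J g h :
  braid_rel n m x (t ^+ n) (u ^+ m) g h -> g = h.
Proof.
have dE : xprod x 1 n * t ^+ n = a ^+ n.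
  by rewrite xprodE // subn0 expg0 mul1g mulgVK.
have rn : (m %% n < n)%N by rewrite ltn_mod.
have mE := divn_eq m n.
case=> [|i q r d /andP[i0 hi]|i q r d /andP[i0 hi]].
- by rewrite dE -mulgA dE; apply/commute_sym/commuteX2.
- case: i i0 hi => // i _ hi; have -> : (i.+1 + r - 1 = i + r)%N by lia.
  rewrite {}/d dE expgz_pred -expgnA /r in hi *.
  rewrite !xprodE; try lia.
  rewrite !subn0 !side; try nia.
  by rewrite addSn ![_ ^+ _.+1]expgSr invgM !mulgA mulgK.
- case: i i0 hi => [|i] i0 hi; first by lia.
  have -> : (i.+1 + r - n = (i + r - n).+1)%N by lia.
  rewrite subn1 /= {}/d dE -expgnA /r in i0 hi *.
  have -> : a ^+ (n * q) = a ^+ (n * q) * a ^- 0.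
    by rewrite expg0 invg1 mulg1.
  rewrite !xprodE; try lia.
  rewrite !subn0 !side; try nia.
  by rewrite ![_ ^+ _.+1]expgSr invgM !mulgA mulgK.
Qed.
End BraidRelationsInJ.

Lemma quot_proj_eq1 (G : groupType) (S : set G) g : S g -> quot_proj S g = 1.
Proof.
move=> Sg; apply/eqP; rewrite eq_sym; apply/quot_eqP.
by rewrite invg1 mul1g; apply: sub_normal_closure.
Qed.

Lemma presented_rel (X : choiceType) (R : free X -> free X -> Prop) u v :
  R u v -> quot_proj (relators R) u = quot_proj (relators R) v.
Proof.
move=> Ruv; apply: (@mulIg _ (quot_proj (relators R) v^-1)).
rewrite -!quot_projM mulgV [LHS]quot_proj_eq1; last by exists u, v.
by rewrite multiplicative1.
Qed.

Section NaturalQuotient.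
Variable D : J_reflection.
Local Notation n := (Jn D).
Local Notation m := (Jm D).
Local Notation s := (amb_s D).
Local Notation t := (amb_t D).
Local Notation u := (amb_u D).

Lemma amb_stu : s * t * u = t * u * s.
Proof.
move: (presented_rel (J_rel_stu (Jk D) (Jb D * n) (Jc D * m)
  (gen Js) (gen Jt) (gen Ju))).
by rewrite !quot_projM.
Qed.

Lemma amb_tus : t * u * s = u * s * t.
Proof.
move: (presented_rel (J_rel_tus (Jk D) (Jb D * n) (Jc D * m)
  (gen Js) (gen Jt) (gen Ju))).
by rewrite !quot_projM.
Qed.

Lemma amb_tX : t ^+ (Jb D * n) = 1.
Proof.
move: (presented_rel (J_rel_t (Jk D) (Jb D * n) (Jc D * m)
  (gen Js) (gen Jt) (gen Ju))).
by rewrite multiplicativeX multiplicative1.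
Qed.

Lemma amb_uX : u ^+ (Jc D * m) = 1.
Proof.
move: (presented_rel (J_rel_u (Jk D) (Jb D * n) (Jc D * m)
  (gen Js) (gen Jt) (gen Ju))).
by rewrite multiplicativeX multiplicative1.
Qed.

Lemma amb_x_in (l : nat) :
  t ^+ l.-1 * s * t ^- l.-1 \in normal_closure (@W_gens D).
Proof.
apply: mem_set; have [_ _ _ NJ] := normal_closureP (@W_gens D).
have /(NJ _ (t ^- l.-1)) : normal_closure (@W_gens D) s.
  by apply: sub_normal_closure; constructor 1.
by rewrite conjgE invgK mulgA.
Qed.

Lemma amb_y_in : t ^+ n \in normal_closure (@W_gens D).
Proof. by apply: mem_set; apply: sub_normal_closure; constructor 2. Qed.

Lemma amb_z_in : u ^+ m \in normal_closure (@W_gens D).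
Proof. by apply: mem_set; apply: sub_normal_closure; constructor 3. Qed.

Definition W_x (l : nat) : W D := Sub (t ^+ l.-1 * s * t ^- l.-1) (amb_x_in l).
Definition W_y : W D := Sub (t ^+ n) amb_y_in.
Definition W_z : W D := Sub (u ^+ m) amb_z_in.

Definition natural_gen (g : braid_gen n) : W D :=
  match g with Bx i => W_x i.+1 | By => W_y | Bz => W_z end.

Lemma free_lift_x (l : nat) : (1 <= l <= n)%N ->
  free_lift natural_gen (free_x n l) = W_x l.
Proof.
case: l => // l /andP[_ ln]; rewrite /free_x /=; case: insubP => [i _ iE|].
  by rewrite free_lift_gen /= iE.
by rewrite ln.
Qed.

Lemma natural_yz_rel g :
  relators (braid_rel n m (free_x n) (gen By) (gen Bz)) g ->
  free_lift natural_gen g = 1.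
Proof.
apply: relators_morph1 => v w /(braid_rel_morph (free_lift natural_gen)).
move/(braid_rel_ext (Jn_gt0 D) free_lift_x); rewrite !free_lift_gen.
move=> /(braid_rel_morph (val : {multiplicative W D -> ambient D})) vw.
apply: val_inj; apply: (braid_rel_J (Jn_gt0 D) amb_stu amb_tus).
exact: vw.
Qed.

Definition natural_yz : {multiplicative braid_yz n m -> W D} :=
  quot_lift natural_yz_rel.

Lemma natural_yz_x (l : nat) :
  (1 <= l <= n)%N -> natural_yz (braid_x_elt n m l) = W_x l.
Proof.
by move=> ln; apply: etrans (quot_lift_proj natural_yz_rel _) (free_lift_x ln).
Qed.

Lemma natural_yz_y : natural_yz (braid_y_elt n m) = W_y.
Proof. exact: etrans (quot_lift_proj natural_yz_rel _) (free_lift_gen _ _). Qed.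

Lemma natural_yz_z : natural_yz (braid_z_elt n m) = W_z.
Proof. exact: etrans (quot_lift_proj natural_yz_rel _) (free_lift_gen _ _). Qed.

Lemma natural_y_rel : W_z = 1 ->
  forall g, [set braid_z_elt n m] g -> natural_yz g = 1.
Proof. by move=> Z _ ->; rewrite natural_yz_z. Qed.

Lemma natural_z_rel : W_y = 1 ->
  forall g, [set braid_y_elt n m] g -> natural_yz g = 1.
Proof. by move=> Y _ ->; rewrite natural_yz_y. Qed.

Lemma natural_0_rel : W_y = 1 -> W_z = 1 ->
  forall g, [set braid_y_elt n m; braid_z_elt n m] g -> natural_yz g = 1.
Proof. by move=> Y Z _ [] ->; rewrite ?natural_yz_y ?natural_yz_z. Qed.

Definition natural_case (y_present z_present : bool) :
    (~~ y_present -> W_y = 1) -> (~~ z_present -> W_z = 1) ->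
    {multiplicative braid n m y_present z_present -> W D} :=
  match y_present, z_present return
    (~~ y_present -> W_y = 1) -> (~~ z_present -> W_z = 1) ->
    {multiplicative braid n m y_present z_present -> W D}
  with
  | true, true => fun _ _ => natural_yz
  | true, false => fun _ Z => quot_lift (natural_y_rel (Z isT))
  | false, true => fun Y _ => quot_lift (natural_z_rel (Y isT))
  | false, false => fun Y Z => quot_lift (natural_0_rel (Y isT) (Z isT))
  end.

Lemma natural_case_proj y_present z_present Y Z g :
  @natural_case y_present z_present Y Z (braid_proj _ _ _ _ g) = natural_yz g.
Proof.
case: y_present z_present Y Z => -[] Y Z.
- by [].
- exact: (quot_lift_proj (natural_y_rel (Z isT))).
- exact: (quot_lift_proj (natural_z_rel (Y isT))).
- exact: (quot_lift_proj (natural_0_rel (Y isT) (Z isT))).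
Qed.

Lemma W_y_eq1 : ~~ (2 <= Jb D)%N -> W_y = 1.
Proof.
move=> b1; apply: val_inj; rewrite [LHS]/= -[RHS]amb_tX; congr (_ ^+ _).
by have := Jb_gt0 D; case: (Jb D) b1 => [|[|]]; rewrite ?mul1n.
Qed.

Lemma W_z_eq1 : ~~ (2 <= Jc D)%N -> W_z = 1.
Proof.
move=> c1; apply: val_inj; rewrite [LHS]/= -[RHS]amb_uX; congr (_ ^+ _).
by have := Jc_gt0 D; case: (Jc D) c1 => [|[|]]; rewrite ?mul1n.
Qed.

Definition natural_quotient : {multiplicative braid_group D -> W D} :=
  natural_case W_y_eq1 W_z_eq1.

(* The images in B(W) of x_l (for 1 <= l <= n), y and z. *)
Definition braid_x (l : nat) : braid_group D :=
  braid_proj _ _ _ _ (braid_x_elt n m l).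
Definition braid_Y : braid_group D := braid_proj _ _ _ _ (braid_y_elt n m).
Definition braid_Z : braid_group D := braid_proj _ _ _ _ (braid_z_elt n m).

Lemma natural_quotient_x (l : nat) :
  (1 <= l <= n)%N -> natural_quotient (braid_x l) = W_x l.
Proof. by move=> ln; rewrite [LHS]natural_case_proj natural_yz_x. Qed.

Lemma natural_quotient_y : natural_quotient braid_Y = W_y.
Proof. by rewrite [LHS]natural_case_proj natural_yz_y. Qed.

Lemma natural_quotient_z : natural_quotient braid_Z = W_z.
Proof. by rewrite [LHS]natural_case_proj natural_yz_z. Qed.

End NaturalQuotient.
Arguments natural_quotient : clear implicits.

(* Main.v *)
From HB Require Import structures.
Require Import Defs.
From mathcomp Require Import all_boot all_fingroup generic_quotient all_order all_algebra zify ring lra.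
From mathcomp Require Import boolp classical_sets Rstruct reals trigo.

(** Extend x_1, ..., x_n to a sequence indexed by the integers by conjugation by
    powers of y. The relations say that an element A shifts it by m, while y
    shifts it by -n; since n and m are coprime some T = A^i y^j shifts it by -1,
    and A^n y^m is central. It follows that B(W) is the torus knot group
    <v, w, d | d central, v^p = d, w^q = d>, where p = n if b = 1 and the relation
    v^p = d is absent otherwise, and likewise q = m or absent according to c.
    Its quotient by <d> is a von Dyck group
    T(N0, N1, N2) = <x_0, x_1, x_2 | x_i^Ni = x_0 x_1 x_2 = 1>; such a group has
    trivial center, unless two of the Ni are 2, by Tits' faithful representation
    of the triangle group containing it. The same fact (and an explicit
    representation when two of k, bn, cm are 2) gives that the center of J is
    generated by stu, and that W/Z(W) is T(k, bn, cm); the generator of the center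
    of B(W) maps to (stu)^(nm), which generates Z(W).

    For (ii) one has to recover the unordered pair {p, q}. A reflection
    isomorphism induces an isomorphism of the von Dyck groups preserving the
    images of the reflections. If these are infinite, the orders of the torsion
    elements that commute with no reflection are the divisors of p and q, because
    torsion elements are conjugate to powers of the x_i, whose centralizers are
    the <x_i>. If they are finite, 1/k + 1/(bn) + 1/(cm) > 1; the multisets
    {k, b, c} and {k, bn, cm} are invariants and determine {p, q} except in one
    case, where the existence of a reflection that is central modulo Z(W) decides. *)

Set Implicit Arguments.
Unset Strict Implicit.
Unset Printing Implicit Defensive.

Import Order.TTheory GRing.Theory Num.Theory.

(** * Presented groups and integer powers *)

Local Open Scope quotient_scope.
Local Open Scope group_scope.

(** The groups are known only through presentations, so every lower bound (orders, trivial centers,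
    non-conjugacy) has to come from a representation. Tits' argument is therefore run for an
    arbitrary group generated by involutions, with a sign, that satisfies the braid relations and
    acts by the right formulas. The triangle group is obtained as an extension of the von Dyck group
    by an involution, so that the von Dyck group embeds in it by construction. The label 0 for a
    missing relation is carried through the whole representation, because a torus knot group modulo
    [d] has the triple [(0, p, q)]: the angle becomes 0, the product of two reflections becomes
    unipotent, and the same formulas apply. In the infinite case Euclidean and hyperbolic triples
    are treated alike. As the invariant form may degenerate, fixed points are sought in the dual
    space, where the finiteness of inversion sets replaces any metric argument. *)

Definition subgroup_pred (G : groupType) (P : G -> Prop) :=
  [/\ P 1, forall g h, P g -> P h -> P (g * h) & forall g, P g -> P g^-1].

Section SubgroupPredicates.
Variables (G H : groupType) (f g : {multiplicative G -> H}).

Lemma subgroup_preim (P : H -> Prop) : subgroup_pred P -> subgroup_pred (fun x => P (f x)).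
Proof.
move=> [P1 PM PV]; split=> [|x y Px Py|x Px]; first by rewrite multiplicative1.
  by rewrite gmulfM; apply: PM.
by rewrite multiplicativeV; apply: PV.
Qed.

Lemma subgroup_image : subgroup_pred (fun y => exists x, y = f x).
Proof.
split=> [|_ _ [x ->] [y ->]|_ [x ->]]; first by exists 1; rewrite multiplicative1.
  by exists (x * y); rewrite gmulfM.
by exists x^-1; rewrite multiplicativeV.
Qed.

Lemma subgroup_eq : subgroup_pred (fun x => f x = g x).
Proof.
split=> [|x y fx fy|x fx]; rewrite ?multiplicative1 //; first by rewrite !gmulfM fx fy.
by rewrite !multiplicativeV fx.
Qed.

End SubgroupPredicates.

Lemma quot_proj_surj (G : groupType) (S : set G) (a : quot S) :
  exists g, a = quot_proj S g.
Proof. by exists (repr a); rewrite /quot_proj reprK. Qed.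

Lemma quot_proj_eq1P (G : groupType) (S : set G) g :
  quot_proj S g = 1 -> normal_closure S g.
Proof.
by move=> /eqP; rewrite eq_sym => /quot_eqP; rewrite invg1 mul1g.
Qed.

Lemma free_ind (X : choiceType) (P : Defs.free X -> Prop) :
  subgroup_pred P -> (forall x, P (gen x)) -> forall g, P g.
Proof.
move=> [P1 PM PV] Pgen g; rewrite -[g]reprK.
elim: (repr g) => [|[x e] w IH]; first exact: P1.
have -> : \pi_(Defs.free X) ((x, e) :: w) =
  (if e then gen x else (gen x)^-1) * \pi_(Defs.free X) w.
  rewrite -[_ * _]/(free_mul _ _).
  case: e; first by rewrite pi_free_mul.
  by rewrite -[(gen x)^-1]/(free_inv _) pi_free_inv pi_free_mul.
by apply: PM => //; case: e => //; apply: PV.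
Qed.

Section Presented.
Variables (X : choiceType) (R : Defs.free X -> Defs.free X -> Prop).

Definition pgen (x : X) : presented X R := quot_proj _ (gen x).

Lemma presented_ind (P : presented X R -> Prop) :
  subgroup_pred P -> (forall x, P (pgen x)) -> forall g, P g.
Proof.
move=> sP Pgen g; have [w ->] := quot_proj_surj g.
by elim/free_ind: w => //; apply: (subgroup_preim _ sP).
Qed.

Lemma presented_homE (H : groupType) (f g : {multiplicative presented X R -> H}) :
  (forall x, f (pgen x) = g (pgen x)) -> f =1 g.
Proof. by move=> fg; apply: presented_ind => //; apply: subgroup_eq. Qed.

Lemma presented_lift (H : groupType) (f : X -> H) :
  (forall u v, R u v -> free_lift f u = free_lift f v) ->
  exists F : {multiplicative presented X R -> H}, forall x, F (pgen x) = f x.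
Proof.
move=> fR; have fR1 := relators_morph1 fR.
exists (quot_lift fR1) => x.
exact: etrans (quot_lift_proj fR1 _) (free_lift_gen f x).
Qed.

End Presented.

Section Generic.
Variable G : groupType.
Implicit Types g h x y z : G.

Lemma commute_subgroup x : subgroup_pred (commute x).
Proof.
by split; [exact: commute1|move=> g h; exact: commuteM|move=> g; exact: commuteV].
Qed.

Lemma expgz1 g : expgz g 1 = g. Proof. by []. Qed.

Lemma expgzN g (i : int) : expgz g (- i)%R = (expgz g i)^-1.
Proof. by case: i => [[|n]|n] //=; rewrite ?invg1 ?invgK. Qed.

Lemma expgz_succ g (i : int) : expgz g (i + 1)%R = expgz g i * g.
Proof.
case: i => [n|[|n]].
- by rewrite -PoszD addn1 /= expgSr.
- by rewrite /= expg1 mulVg.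
- have -> : (Negz n.+1 + 1 = Negz n)%R by lia.
  by rewrite /= [g ^+ n.+2]expgS invgM mulgVK.
Qed.

Lemma expgzD g (i j : int) : expgz g (i + j)%R = expgz g i * expgz g j.
Proof.
case: j => j; last first.
  rewrite NegzE; elim: j => [|j IH].
    rewrite -[i in RHS](GRing.subrK 1%R) expgz_succ expgzN expgz1 mulgK.
    by congr (expgz _ _); lia.
  have -> : (- Posz j.+2 = - Posz j.+1 - 1)%R by lia.
  rewrite GRing.addrA; set a := (i - _)%R in IH *.
  apply: (@mulIg _ g); rewrite -expgz_succ GRing.subrK IH -mulgA -expgz_succ.
  by rewrite GRing.subrK.
elim: j => [|j IH]; first by rewrite GRing.addr0 mulg1.
by rewrite -addn1 PoszD GRing.addrA !expgz_succ IH mulgA.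
Qed.

Lemma expgz_nat g (n : nat) : expgz g (Posz n) = g ^+ n. Proof. by []. Qed.

Lemma expgzM g (i j : int) : expgz g (i * j)%R = expgz (expgz g i) j.
Proof.
have pos (n : nat) : expgz g (i * Posz n)%R = expgz (expgz g i) (Posz n).
  elim: n => [|n IH]; first by rewrite GRing.mulr0.
  have -> : (i * Posz n.+1 = i * Posz n + i)%R by lia.
  by rewrite expgzD IH /= expgSr.
by case: j => j //; rewrite NegzE GRing.mulrN !expgzN pos.
Qed.

Lemma commute_expgz x y (i : int) : commute x y -> commute x (expgz y i).
Proof. by case: i => i c /=; [|apply: commuteV]; apply: commuteX. Qed.

Lemma commute_expgz2 x y (i j : int) :
  commute x y -> commute (expgz x i) (expgz y j).
Proof. by move=> c; apply/commute_expgz/commute_sym/commute_expgz/commute_sym. Qed.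

Lemma expgz_mulC x (i j : int) : expgz x i * expgz x j = expgz x j * expgz x i.
Proof. by rewrite -!expgzD GRing.addrC. Qed.

Lemma expgzMc x y (i : int) :
  commute x y -> expgz (x * y) i = expgz x i * expgz y i.
Proof.
move=> c; case: i => i /=; rewrite expgMn //.
by rewrite invgM; apply/commute_sym/commuteV/commute_sym/commuteV/commute_sym/commuteX2.
Qed.

Lemma expgz_conj x y (i : int) : expgz (x ^ y) i = expgz x i ^ y.
Proof. by case: i => i /=; rewrite ?conjVg conjXg. Qed.

Lemma expgz1n (i : int) : expgz (1 : G) i = 1.
Proof. by case: i => i /=; rewrite expg1n ?invg1. Qed.

Lemma expgz_subgroup x : subgroup_pred (fun g => exists i : int, g = expgz x i).
Proof.
split; first by exists 0%R.
- by move=> _ _ [i ->] [j ->]; exists (i + j)%R; rewrite expgzD.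
- by move=> _ [i ->]; exists (- i)%R; rewrite expgzN.
Qed.

Lemma conj_commute x y : commute x y -> x ^ y = x.
Proof. by move=> c; rewrite conjgE c mulKg. Qed.

(* [n = 0] stands for infinite order. *)
Definition has_order x (n : nat) := forall i : int, expgz x i = 1 <-> (n %| `|i|)%N.

Lemma has_order_expg x n (i : nat) : has_order x n -> x ^+ i = 1 <-> (n %| i)%N.
Proof. by move=> xn; have := xn (Posz i). Qed.

(** The powers of a central element already form a normal subgroup. This computes the kernel of a
    quotient by a central element given as a relation. *)
Lemma central_normal_closure x : center G x ->
  forall g, normal_closure [set x]%classic g -> exists i : int, g = expgz x i.
Proof.
move=> cx g /(_ [set g | exists i : int, g = expgz x i]%classic); apply.
split; last by move=> _ ->; exists 1%R.
have [S1 SM SV] := expgz_subgroup x; split=> // {}g h [i ->].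
by exists i; rewrite conj_commute //; apply/commute_sym/commute_expgz/commute_sym/cx.
Qed.

End Generic.

Lemma expg_has_order (G : groupType) (x : G) n :
  x ^+ n = 1 -> (forall i : nat, x ^+ i = 1 -> (n %| i)%N) -> has_order x n.
Proof.
move=> xn xd i; split.
  by case: i => i /=; [|move=> /eqP; rewrite invg_eq1 => /eqP]; apply: xd.
move=> /dvdnP[j jE].
have xi : x ^+ `|i| = 1 by rewrite jE mulnC expgnA xn expg1n.
case: i {jE} xi => i //= ->; exact: invg1.
Qed.

(** * The Tits representation *)

Local Close Scope quotient_scope.
Local Close Scope group_scope.
Local Open Scope ring_scope.

(* [cheb (cos t) n = sin (n t) / sin t] *)
Fixpoint cheb (R : nzRingType) (c : R) (n : nat) : R :=
  match n with
  | 0 => 0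
  | m.+1 => match m with 0 => 1 | p.+1 => c *+ 2 * cheb c m - cheb c p end
  end.

Lemma chebSS (R : nzRingType) (c : R) n :
  cheb c n.+2 = c *+ 2 * cheb c n.+1 - cheb c n.
Proof. by []. Qed.

(** * Words and length in a group generated by involutions *)

Section AlternatingWords.
Variables (I : Type) (i j : I).
(** The parity test fixes the last letter to be [j] for every length: the last letter is the one
    that acts first on column vectors. *)
Fixpoint altw (i j : I) (l : nat) : seq I :=
  if l is l'.+1 then (if odd l' then i else j) :: altw i j l' else [::].
Lemma size_altw l : size (altw i j l) = l.
Proof. by elim: l => //= l ->. Qed.
End AlternatingWords.

Lemma rcons_altw I (i j : I) l : rcons (altw j i l) j = altw i j l.+1.
Proof. by elim: l => //= l ->; case: (odd l). Qed.

Section Words.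
Variables (G : groupType) (d : nat) (r : 'I_d -> G).
Implicit Types g h : G.
Hypothesis rr : forall i, (r i * r i = 1)%g.

Definition ev (w : seq 'I_d) : G := (\prod_(i <- w) r i)%g.

Lemma ev_cat v w : ev (v ++ w) = (ev v * ev w)%g.
Proof. exact: big_cat. Qed.
Lemma ev_cons i w : ev (i :: w) = (r i * ev w)%g.
Proof. exact: big_cons. Qed.
Lemma ev_nil : ev [::] = 1%g.
Proof. exact: big_nil. Qed.
Lemma ev_rcons w i : ev (rcons w i) = (ev w * r i)%g.
Proof. by rewrite -cats1 ev_cat ev_cons ev_nil mulg1. Qed.

Lemma rV i : ((r i)^-1 = r i)%g.
Proof. exact: mulg1_eq (rr i). Qed.

Lemma mulgrr g i : (g * r i * r i = g)%g.
Proof. by rewrite -mulgA rr mulg1. Qed.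

Lemma ev_rev w : ev (rev w) = (ev w)^-1%g.
Proof.
elim: w => [|i w IH]; first by rewrite ev_nil invg1.
by rewrite rev_cons ev_rcons IH ev_cons invgM rV.
Qed.

Lemma ev_altw_even i j k : ev (altw i j k.*2) = ((r i * r j) ^+ k)%g.
Proof.
elim: k => [|k IH]; first exact: ev_nil.
by rewrite doubleS /= odd_double /= !ev_cons IH expgS mulgA.
Qed.

Lemma ev_altw_odd i j k : ev (altw i j k.*2.+1) = (r j * (r i * r j) ^+ k)%g.
Proof. by rewrite /= odd_double ev_cons ev_altw_even. Qed.

Lemma ev_altw_swap i j n :
  ((r i * r j) ^+ n = 1)%g -> ev (altw i j n) = ev (altw j i n).
Proof.
have inv k : ((r j * r i) ^+ k = (r i * r j) ^- k)%g.
  by rewrite -expVgn invgM !rV.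
rewrite -(odd_double_half n); case: (odd n); rewrite ?add1n ?add0n => h.
  rewrite !ev_altw_odd inv; apply: (@mulIg _ ((r i * r j) ^+ n./2)%g).
  rewrite mulgVK; apply: (@mulgI _ (r i)); rewrite rr -h.
  by rewrite -addnn -addSn expgnDr expgS !mulgA.
rewrite !ev_altw_even inv; apply: (@mulIg _ ((r i * r j) ^+ n./2)%g).
by rewrite mulVg -expgnDr addnn.
Qed.

Definition over (i j : 'I_d) (w : seq 'I_d) := all (fun x => (x == i) || (x == j)) w.

Lemma over_altw i j l : over i j (altw i j l).
Proof. by elim: l => //= l ->; rewrite andbT; case: (odd l); rewrite eqxx ?orbT. Qed.

Lemma over_sym i j w : over i j w = over j i w.
Proof. by apply: eq_all => x; rewrite orbC. Qed.

(** A letter appended to an alternating word either continues the alternation or creates a square,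
    which cancels. *)
Lemma word_reduce i j w : over i j w ->
  [\/ w = altw i j (size w), w = altw j i (size w) |
      exists w', [/\ over i j w', (size w' < size w)%N & ev w' = ev w]].
Proof.
elim/last_ind: w => [|w x IH]; first by constructor 1.
rewrite /over all_rcons => /andP[xij wij]; rewrite size_rcons.
have red a b : over i j (altw a b (size w)) -> w = altw a b (size w) -> x = b ->
    (0 < size w)%N ->
    exists w', [/\ over i j w', (size w' < (size w).+1)%N & ev w' = ev (rcons w x)].
  move=> ov wE ->; case: (size w) wE ov => // l wE ov _.
  move: ov; rewrite wE -rcons_altw /over all_rcons => /andP[_ ov].
  exists (altw b a l); split=> //; first by rewrite size_altw; lia.
  by rewrite !ev_rcons mulgrr.
have [wE|wE|[w' [w'ij sw' evw']]] := IH wij.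
- have ov := over_altw i j (size w).
  case/orP: xij => /eqP xE.
    by constructor 2; rewrite xE {1}wE rcons_altw.
  have [w0|w0] := posnP (size w).
    by constructor 1; rewrite xE (size0nil w0).
  by constructor 3; apply: (red i j).
- have ov : over i j (altw j i (size w)) by rewrite over_sym over_altw.
  case/orP: xij => /eqP xE; last first.
    by constructor 1; rewrite xE {1}wE rcons_altw.
  have [w0|w0] := posnP (size w).
    by constructor 2; rewrite xE (size0nil w0).
  by constructor 3; apply: (red j i).
- constructor 3; exists (rcons w' x); split; last by rewrite !ev_rcons evw'.
    by rewrite /over all_rcons xij.
  by rewrite size_rcons; lia.
Qed.

Hypothesis gen : forall g, exists w, ev w = g.

Lemma len_ex g : exists n, `[< exists w, size w = n /\ ev w = g >].
Proof. by have [w wg] := gen g; exists (size w); apply/asboolP; exists w. Qed.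

Definition len g := ex_minn (len_ex g).

Lemma lenP g : exists w, size w = len g /\ ev w = g.
Proof. by rewrite /len; case: ex_minnP => n /asboolP. Qed.

Lemma len_le w g : ev w = g -> (len g <= size w)%N.
Proof.
by move=> wg; rewrite /len; case: ex_minnP => n _; apply; apply/asboolP; exists w.
Qed.

Lemma lenM g h : (len (g * h)%g <= len g + len h)%N.
Proof.
have [[v [<- vg]] [w [<- wh]]] := (lenP g, lenP h).
by rewrite -size_cat; apply: len_le; rewrite ev_cat vg wh.
Qed.

Lemma len_ev w : (len (ev w) <= size w)%N. Proof. exact: len_le. Qed.

Lemma len_r g i : (len (g * r i)%g <= (len g).+1)%N.
Proof.
apply: leq_trans (lenM _ _) _; rewrite -addn1 leq_add2l.
by apply: (@len_le [:: i]); rewrite ev_cons ev_nil mulg1.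
Qed.

Lemma len_descent g : g <> 1%g -> exists i, (len (g * r i)%g < len g)%N.
Proof.
have [w [sw wg]] := lenP g; case/lastP: w sw wg => [|w i] sw wg g1.
  by case: g1; rewrite -wg ev_nil.
exists i; rewrite -sw size_rcons ltnS; apply: len_le.
by rewrite -wg ev_rcons mulgrr.
Qed.

Variable par : G -> bool.
Hypotheses (parM : forall g h, par (g * h)%g = par g (+) par h)
  (par_r : forall i, par (r i)).

Lemma len_par g : odd (len g) = par g.
Proof.
have [w [<- <-]] := lenP g; elim: w => [|i w IH] /=.
  by rewrite ev_nil; have := parM 1%g 1%g; rewrite mulg1; case: (par _).
by rewrite ev_cons parM par_r IH.
Qed.

(** Multiplication by a generator changes the parity of the length, so equality cannot occur. *)
Lemma len_r_ltgt g i : (len (g * r i)%g < len g)%N = ~~ (len g < len (g * r i)%g)%N.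
Proof.
have := len_par (g * r i)%g; rewrite parM par_r -len_par.
by case: (ltngtP (len (g * r i)%g) (len g)) => // ->; case: (odd _).
Qed.

End Words.

(** * Positivity of roots and faithfulness *)

Section Tits.
Variables (R : realFieldType) (G : groupType) (d : nat) (r : 'I_d -> G).
Implicit Types g h : G.
Hypothesis rr : forall i, (r i * r i = 1)%g.
Hypothesis gen : forall g, exists w, ev r w = g.
Variable par : G -> bool.
Hypotheses (parM : forall g h, par (g * h)%g = par g (+) par h)
  (par_r : forall i, par (r i)).
Variables (N : 'I_d -> 'I_d -> nat) (C : 'I_d -> 'I_d -> R).
Hypothesis braid : forall i j, i != j -> ((r i * r j) ^+ N i j = 1)%g.
Hypothesis Csym : forall i j, C i j = C j i.
Hypothesis cheb_ge0 : forall i j l, i != j ->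
  (N i j = 0)%N \/ (l <= N i j)%N -> 0 <= cheb (C i j) l.
Variable rho : G -> 'M[R]_d.
Hypothesis rhoM : forall g h, rho (g * h)%g = rho g *m rho h.

Definition al (i : 'I_d) : 'cV[R]_d := delta_mx i 0.

Hypothesis rho_al : forall i j,
  rho (r i) *m al j = if i == j then - al i else al j + (C i j *+ 2) *: al i.

(** [rho] is only assumed multiplicative; [rho 1] fixes each vector [rho (r i) *m al i = - al i],
    and these form a basis. *)
Lemma rho1 : rho 1%g = 1%:M.
Proof.
have e i : rho 1%g *m al i = al i.
  have h := rho_al i i; rewrite eqxx in h.
  have := rho_al i i; rewrite -[r i]mul1g rhoM -mulmxA h eqxx mulmxN.
  by move/oppr_inj.
apply/matrixP => a b; have /matrixP/(_ a 0) := e b.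
rewrite !mxE (bigD1 b) //= big1 => [|k kb]; last first.
  by rewrite mxE eqxx andbT (negbTE kb) mulr0.
by rewrite mxE !eqxx mulr1 addr0 andbT => ->.
Qed.

Definition nonneg (v : 'cV[R]_d) := forall k, 0 <= v k 0.

Lemma nonneg_comb (v w : 'cV[R]_d) (a b : R) :
  0 <= a -> 0 <= b -> nonneg v -> nonneg w -> nonneg (a *: v + b *: w).
Proof. by move=> a0 b0 v0 w0 k; rewrite !mxE addr_ge0 // mulr_ge0. Qed.

(** The recursion [chebSS] is exactly what one more reflection imposes on the coefficients. *)
Lemma rho_altw i j l : i != j -> let c := cheb (C i j) in
  rho (ev r (altw i j l)) *m al i =
    c (if odd l then l else l.+1) *: al i + c (if odd l then l.+1 else l) *: al j.
Proof.
move=> ij c; elim: l => [|l IH].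
  by rewrite /= ev_nil rho1 mul1mx scale1r scale0r addr0.
have ji : (j == i) = false by rewrite eq_sym (negbTE ij).
rewrite [altw _ _ _]/= ev_cons rhoM -mulmxA IH.
case ol: (odd l); rewrite [odd _]/= ol mulmxDr -!scalemxAr !rho_al eqxx ?ji ?(negbTE ij).
- rewrite /c chebSS; apply/matrixP => x y; rewrite !mxE Csym; ring.
- rewrite /c chebSS; apply/matrixP => x y; rewrite !mxE Csym; ring.
Qed.

Local Notation len := (len gen).

(** Strong induction on the length. Let [j] be a right descent of [g], and split [g = v e] with [e]
    the longest possible word in [i], [j] that keeps lengths additive. Then [v] has no descent at
    [i] or [j], so induction makes [v] send both simple roots to nonnegative vectors, while [e]
    sends [al i] to a nonnegative combination of the two. *)
Theorem tits_pos g i : (len g < len (g * r i)%g)%N -> nonneg (rho g *m al i).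
Proof.
have [n] := ubnP (len g); elim: n g i => // n IH g i lgn lgi.
have [->|/eqP g1] := eqVneq g 1%g.
  by rewrite rho1 mul1mx => k; rewrite mxE; case: (_ && _).
have [j lj] := len_descent rr gen g1.
have ij : i != j by apply/eqP => E; move: lj; rewrite -E => /(ltn_trans lgi); rewrite ltnn.
pose Q (v : G) (e : seq 'I_d) :=
  [/\ over i j e, (v * ev r e)%g = g & (len v + size e = len g)%N].
have Qbase : exists v e, Q v e /\ size e = 1%N.
  exists (g * r j)%g, [:: j]; split=> //; split; rewrite /over /= ?eqxx ?orbT //.
    by rewrite ev_cons ev_nil mulg1 mulgrr.
  by have := len_r gen (g * r j)%g j; rewrite mulgrr //; lia.
pose P m := `[< exists v e, Q v e /\ size e = m >].
have exP : exists m, P m by exists 1%N; apply/asboolP.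
have Pub m : P m -> (m <= len g)%N by move=> /asboolP[v [e [[_ _ h] <-]]]; lia.
case: (ex_maxnP exP Pub) => m /asboolP[v [e [[eij vg lv] em]]] max.
have m1 : (1 <= m)%N by apply: max; apply/asboolP.
(* Were [v * r x] shorter than [v], the letter [x] could be moved into [e], against the maximality
   of [m]. *)
have lgt x : (x == i) || (x == j) -> (len v < len (v * r x)%g)%N.
  move=> xij; rewrite -[X in is_true X]negbK -(len_r_ltgt gen parM par_r); apply/negP => lx.
  suff : P m.+1 by move=> /max; lia.
  apply/asboolP; exists (v * r x)%g, (x :: e); split; last by rewrite /= em.
  have gE : (v * r x * ev r (x :: e))%g = g.
    by rewrite ev_cons mulgA mulgrr.
  split; rewrite ?gE //=; first by rewrite /over /= xij.
  have := lenM gen (v * r x)%g (ev r (x :: e)); rewrite gE.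
  by have := len_ev gen (x :: e); rewrite /=; lia.
have vpos x : (x == i) || (x == j) -> nonneg (rho v *m al x).
  by move=> /lgt; apply: IH; lia.
(* A word for [e] of the same length ending in [i] would make [g * r i] shorter than [g]. *)
have nend e' : size e' = m -> ev r e' = ev r e -> forall e'', e' <> rcons e'' i.
  move=> se' ee' e'' e'E.
  have : (len (g * r i)%g <= len v + size e'')%N.
    rewrite -vg -ee' e'E ev_rcons mulgA mulgrr //.
    by apply: leq_trans (lenM _ _ _) _; rewrite leq_add2l; apply: len_ev.
  by move: se'; rewrite e'E size_rcons; lia.
have eE : e = altw i j m.
  case: (word_reduce rr eij) => [|eE|[e' [_ se' evE]]]; first by rewrite em.
    case: m {max Pub} m1 em nend => // m _ em nend.
    by have /(_ (altw i j m)) := nend _ em erefl; rewrite rcons_altw -em -eE.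
  have := lenM gen v (ev r e'); rewrite evE vg.
  by have := len_ev gen e'; rewrite evE; lia.
(* If [e] had [N i j] letters or more, the braid relation would rewrite its end so that it finishes
   with [i]. The strict bound matters, as the coefficients go up to [cheb (C i j) m.+1]. *)
have mN : (N i j = 0)%N \/ (m < N i j)%N.
  case: (posnP (N i j)) => [->|N0]; [by left|right].
  rewrite ltnNge; apply/negP => Nm.
  have [p pE] : exists p, e = p ++ altw i j (N i j).
    rewrite eE -{1}(subnK Nm).
    elim: (m - N i j)%N => [|q [p IHp]]; first by exists [::].
    by exists ((if odd (q + N i j) then i else j) :: p); rewrite addSn /= IHp.
  have := nend (p ++ altw j i (N i j)); rewrite !size_cat !size_altw.
  rewrite -em {1}pE size_cat size_altw => /(_ erefl).
  rewrite pE !ev_cat (ev_altw_swap rr (braid ij)) => /(_ erefl).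
  case: (N i j) N0 => // q _ /(_ (p ++ altw i j q)).
  by rewrite -rcons_altw rcons_cat.
rewrite -vg rhoM -mulmxA eE rho_altw // mulmxDr -!scalemxAr.
have c0 l : (l <= m.+1)%N -> 0 <= cheb (C i j) l.
  by move=> lm; apply: cheb_ge0 => //; case: mN; [left|right; lia].
by apply: nonneg_comb; [apply: c0; case: ifP; lia..|apply: vpos; rewrite eqxx ?orbT|apply: vpos; rewrite eqxx ?orbT].
Qed.

Lemma tits_neg g i : (len (g * r i)%g < len g)%N -> nonneg (- (rho g *m al i)).
Proof.
move=> l; have := @tits_pos (g * r i)%g i; rewrite mulgrr // => /(_ l).
by rewrite rhoM -mulmxA rho_al eqxx mulmxN.
Qed.

Theorem tits_faithful g : (forall i, rho g *m al i = al i) -> g = 1%g.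
Proof.
move=> ge; apply/eqP; have [//|/eqP/(len_descent rr gen)[i]] := eqVneq g 1%g.
move=> /tits_neg; rewrite ge => /(_ i); rewrite !mxE !eqxx /=.
by rewrite oppr_ge0 lern0.
Qed.

End Tits.

(** * Von Dyck groups *)

Definition i0 : 'I_3 := @Ordinal 3 0 isT.
Definition i1 : 'I_3 := @Ordinal 3 1 isT.
Definition i2 : 'I_3 := @Ordinal 3 2 isT.

Lemma I3_ind (P : 'I_3 -> Prop) : P i0 -> P i1 -> P i2 -> forall i, P i.
Proof.
move=> P0 P1 P2 [[|[|[|//]]] p].
- by rewrite (_ : Ordinal p = i0) //; apply: val_inj.
- by rewrite (_ : Ordinal p = i1) //; apply: val_inj.
- by rewrite (_ : Ordinal p = i2) //; apply: val_inj.
Qed.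

Lemma ordS3 : (ordS i0 = i1) * (ordS i1 = i2) * (ordS i2 = i0).
Proof. by split; [split|]; apply: val_inj. Qed.

(** * Extension of a group by an involution, and invertible matrices *)

Section SemidirectInvolution.
Variables (T : groupType) (s : {multiplicative T -> T}).
Hypothesis ss : involutive s.

(** The proof that [s] is an involution is a parameter of the type, so that the group structure,
    whose laws need it, can be attached to it. *)
Definition sdinv (_ : involutive s) : Type := (T * bool)%type.
HB.instance Definition _ := Choice.on (sdinv ss).

Definition tw (e : bool) (x : T) := if e then s x else x.
Lemma twM e : {morph tw e : x y / (x * y)%g}.
Proof. by case: e => // x y; apply: gmulfM. Qed.
Lemma tw_tw e f x : tw e (tw f x) = tw (e (+) f) x.
Proof. by case: e; case: f => /=. Qed.

Definition sd_mul (a b : sdinv ss) : sdinv ss :=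
  ((a.1 * tw a.2 b.1)%g, a.2 (+) b.2).
Definition sd_one : sdinv ss := (1%g, false).
Definition sd_inv (a : sdinv ss) : sdinv ss := (tw a.2 a.1^-1, a.2).

Fact sd_mulA : associative sd_mul.
Proof. by move=> [x e] [y f] [z h]; rewrite /sd_mul /= twM tw_tw mulgA addbA. Qed.
Fact sd_mul1g : left_id sd_one sd_mul.
Proof. by case=> x e; rewrite /sd_mul /= mul1g. Qed.
Fact sd_mulg1 : right_id sd_one sd_mul.
Proof.
by case=> x e; rewrite /sd_mul /= addbF; case: e; rewrite /= ?multiplicative1 mulg1.
Qed.
Fact sd_mulVg : left_inverse sd_one sd_inv sd_mul.
Proof.
case=> x e; rewrite /sd_mul /sd_one /= addbb -twM mulVg; congr (_, _).
by case: e; rewrite /= ?multiplicative1.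
Qed.
Fact sd_mulgV : right_inverse sd_one sd_inv sd_mul.
Proof. by case=> x e; rewrite /sd_mul /sd_one /= tw_tw addbb mulgV. Qed.

HB.instance Definition _ := isGroup.Build (sdinv ss)
  sd_mulA sd_mul1g sd_mulg1 sd_mulVg sd_mulgV.

Lemma sd_mulE (a b : sdinv ss) : (a * b)%g = ((a.1 * tw a.2 b.1)%g, a.2 (+) b.2).
Proof. by []. Qed.

End SemidirectInvolution.

Section GeneralLinear.
Variables (R : comUnitRingType) (n : nat).
Definition glmx : Type := {A : 'M[R]_n | A \in unitmx}.
HB.instance Definition _ := SubChoice.on glmx.
Definition gl_one : glmx := exist _ 1%:M (unitmx1 R n).
Definition gl_mul (A B : glmx) : glmx :=
  exist _ (val A *m val B)
    (etrans (unitmx_mul _ _) (introT andP (conj (valP A) (valP B)))).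
Definition gl_inv (A : glmx) : glmx :=
  exist _ (invmx (val A)) (etrans (unitmx_inv (val A)) (valP A)).
Fact gl_mulA : associative gl_mul.
Proof. by move=> A B C; apply: val_inj; rewrite /= mulmxA. Qed.
Fact gl_mul1g : left_id gl_one gl_mul.
Proof. by move=> A; apply: val_inj; rewrite /= mul1mx. Qed.
Fact gl_mulg1 : right_id gl_one gl_mul.
Proof. by move=> A; apply: val_inj; rewrite /= mulmx1. Qed.
Fact gl_mulVg : left_inverse gl_one gl_inv gl_mul.
Proof. by move=> A; apply: val_inj; rewrite /= mulVmx ?(valP A). Qed.
Fact gl_mulgV : right_inverse gl_one gl_inv gl_mul.
Proof. by move=> A; apply: val_inj; rewrite /= mulmxV ?(valP A). Qed.
HB.instance Definition _ := isGroup.Build glmx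
  gl_mulA gl_mul1g gl_mulg1 gl_mulVg gl_mulgV.
Lemma gl_mulE (A B : glmx) : val (A * B)%g = val A *m val B.
Proof. by []. Qed.
End GeneralLinear.

(* [N i = 0] imposes no relation on [x i]. *)
Variant vd_rel (G : groupType) (N : 'I_3 -> nat) (x : 'I_3 -> G) : G -> G -> Prop :=
| vd_pow i : vd_rel N x (x i ^+ N i)%g 1%g
| vd_prod : vd_rel N x (x i0 * x i1 * x i2)%g 1%g.

(** * Von Dyck groups inside triangle groups *)

Section VonDyck.
Variable N : 'I_3 -> nat.
Local Open Scope group_scope.

Definition vonDyck : groupType := presented 'I_3 (vd_rel N (fun i => gen i)).
Definition vx (i : 'I_3) : vonDyck := pgen _ i.

Lemma vx_pow i : vx i ^+ N i = 1.
Proof.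
have := presented_rel (vd_pow N (fun i => gen i) i).
by rewrite multiplicativeX multiplicative1.
Qed.

Lemma vx_prod012 : vx i0 * vx i1 * vx i2 = 1.
Proof.
have := presented_rel (vd_prod N (fun i => gen i)).
by rewrite !quot_projM multiplicative1.
Qed.

Lemma vx_prod i : vx i * vx (ordS i) * vx (ordS (ordS i)) = 1.
Proof.
have h := vx_prod012; have h' : vx i1 * vx i2 * vx i0 = 1.
  by apply: (@mulgI _ (vx i0)); rewrite !mulgA h mul1g mulg1.
elim/I3_ind: i; rewrite !ordS3 //.
by apply: (@mulgI _ (vx i1)); rewrite !mulgA h' mul1g mulg1.
Qed.

Lemma vx_ind (P : vonDyck -> Prop) :
  subgroup_pred P -> (forall i, P (vx i)) -> forall g, P g.
Proof. exact: presented_ind. Qed.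

Lemma vonDyck_lift (H : groupType) (f : 'I_3 -> H) :
  (forall i, f i ^+ N i = 1) -> f i0 * f i1 * f i2 = 1 ->
  exists F : {multiplicative vonDyck -> H}, forall i, F (vx i) = f i.
Proof.
move=> fN f1; apply: presented_lift => u v [i|].
  by rewrite multiplicativeX free_lift_gen fN multiplicative1.
by rewrite !gmulfM !free_lift_gen f1 multiplicative1.
Qed.

Lemma vx_homE (H : groupType) (f g : {multiplicative vonDyck -> H}) :
  (forall i, f (vx i) = g (vx i)) -> f =1 g.
Proof. exact: presented_homE. Qed.

(* [flip] becomes conjugation by the reflection [cr i1] below. *)
Definition flip_gen (i : 'I_3) : vonDyck :=
  if i == i2 then vx i1 * vx i0 else (vx i)^-1.

Lemma flip_ex :
  exists F : {multiplicative vonDyck -> vonDyck}, forall i, F (vx i) = flip_gen i.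
Proof.
apply: vonDyck_lift; last by rewrite /flip_gen /= !mulgA mulgVK mulVg.
apply: I3_ind; rewrite /flip_gen /= ?expVgn ?vx_pow ?invg1 //.
have -> : vx i1 * vx i0 = (vx i2)^-1 ^ vx i0.
  have /mulg1_eq <- := vx_prod012.
  by rewrite invgK conjgE mulgA mulgA mulVg mul1g.
by rewrite -conjXg expVgn vx_pow invg1 conj1g.
Qed.

Definition flip : {multiplicative vonDyck -> vonDyck} := sval (cid flip_ex).
Lemma flip_vx i : flip (vx i) = flip_gen i.
Proof. exact: (svalP (cid flip_ex)). Qed.

Lemma flipK : involutive flip.
Proof.
move=> g; apply: (@vx_homE _ (flip \o flip : {multiplicative _ -> _})
  (idfun : {multiplicative _ -> _})) => i /=.
rewrite flip_vx /flip_gen; elim/I3_ind: i => /=;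
  rewrite ?gmulfM ?multiplicativeV !flip_vx /flip_gen /= ?invgK //.
by rewrite -invgM; apply: mulg1_eq; exact: vx_prod012.
Qed.

Definition cox : groupType := sdinv flipK.

Definition cx (g : vonDyck) : cox := (g, false).
Lemma cxM : {morph cx : g h / g * h}. Proof. by []. Qed.
HB.instance Definition _ := isMultiplicative.Build vonDyck cox cx cxM.

(** These values are forced by [cr i1 = (1, true)] and by the requirement that [cr i * cr (ordS i)]
    be [vx i]. *)
Definition cr (i : 'I_3) : cox :=
  if i == i0 then (vx i0, true) else if i == i1 then (1, true)
  else ((vx i1)^-1, true).

Lemma cr_cr i : cr i * cr i = 1.
Proof.
elim/I3_ind: i; rewrite sd_mulE /= ?multiplicativeV ?multiplicative1 ?flip_vx /flip_gen /=.
- by rewrite mulgV.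
- by rewrite mulg1.
- by rewrite invgK mulVg.
Qed.

Lemma cr_crS i : cr i * cr (ordS i) = cx (vx i).
Proof.
elim/I3_ind: i; rewrite ordS3 sd_mulE /= ?multiplicativeV ?multiplicative1 ?flip_vx /flip_gen /=.
- by rewrite mulg1.
- by rewrite mul1g invgK.
- by rewrite -invgM; congr (_, _); apply: mulg1_eq; exact: vx_prod012.
Qed.

Lemma cox_gen (g : cox) : exists w, ev cr w = g.
Proof.
have even h : exists w, ev cr w = cx h.
  elim/vx_ind: h => [|i]; last first.
    by exists [:: i; ordS i]; rewrite !ev_cons ev_nil mulg1 cr_crS.
  split=> [|x y [v vE] [w wE]|x [v vE]]; first by exists [::]; rewrite ev_nil.
    by exists (v ++ w); rewrite ev_cat vE wE.
  by exists (rev v); rewrite (ev_rev cr_cr) vE.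
case: g => x [].
  have [w wE] := even x; exists (rcons w i1); rewrite ev_rcons wE sd_mulE /=.
  by rewrite mulg1.
by have [w wE] := even x; exists w.
Qed.

Definition cpar (g : cox) : bool := g.2.
Lemma cparM (g h : cox) : cpar (g * h) = cpar g (+) cpar h. Proof. by []. Qed.
Lemma cpar_r i : cpar (cr i). Proof. by elim/I3_ind: i. Qed.

(** The Coxeter matrix: the label [N i] belongs to the edge joining [i] and [ordS i]. Diagonal
    values are meaningless. *)
Definition ordm (i j : 'I_3) : nat := if j == ordS i then N i else N j.

Lemma ordSP (i j : 'I_3) : i != j -> j = ordS i \/ i = ordS j.
Proof.
by elim/I3_ind: i; elim/I3_ind: j => // _; rewrite !ordS3; [left|right|right|left|left|right].
Qed.

Lemma ordmS i : ordm i (ordS i) = N i. Proof. by rewrite /ordm eqxx. Qed.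
Lemma ordm_sym (i j : 'I_3) : i != j -> ordm i j = ordm j i.
Proof. by elim/I3_ind: i; elim/I3_ind: j. Qed.

Lemma cr_braid i j : i != j -> (cr i * cr j) ^+ ordm i j = 1.
Proof.
have b k : (cr k * cr (ordS k)) ^+ N k = 1.
  by rewrite cr_crS -(multiplicativeX cx) vx_pow.
move=> ij; have [->|iE] := ordSP ij; first by rewrite ordmS b.
rewrite ordm_sym // iE ordmS; have := b j.
have -> : cr (ordS j) * cr j = (cr j * cr (ordS j))^-1.
  by rewrite invgM !(rV cr_cr).
by rewrite expVgn => ->; rewrite invg1.
Qed.

End VonDyck.

(** * Angles and signs of Chebyshev values *)

Section Chebyshev.
Variable R : realType.
Implicit Types (n l : nat) (t : R).

(* The junk value [pi / 0 = 0] makes [0] behave as an infinite order. *)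
Definition ang n : R := pi / n%:R.

Lemma ang0 : ang 0 = 0. Proof. by rewrite /ang invr0 mulr0. Qed.

Lemma ang_mul n : (0 < n)%N -> n%:R * ang n = pi.
Proof. by move=> n0; rewrite /ang mulrCA divff ?mulr1 // pnatr_eq0 -lt0n. Qed.

Lemma ang_gt0 n : (0 < n)%N -> 0 < ang n.
Proof. by move=> n0; rewrite divr_gt0 ?pi_gt0 // ltr0n. Qed.

Lemma ang_ge0 n : 0 <= ang n.
Proof. by rewrite divr_ge0 ?pi_ge0. Qed.

Lemma ang_le_pihalf n : n != 1%N -> ang n <= pi / 2.
Proof.
case: n => [|[//|n]] _; first by rewrite ang0 divr_ge0 ?pi_ge0.
rewrite /ang ler_pM2l ?pi_gt0 // lef_pV2 ?posrE ?ltr0n // ler_nat; lia.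
Qed.

Lemma cos_ang_ge0 n : n != 1%N -> 0 <= cos (ang n).
Proof.
move=> n1; apply: cos_ge0_pihalf; rewrite ang_le_pihalf // andbT.
by rewrite (le_trans _ (ang_ge0 n)) // oppr_le0 divr_ge0 ?pi_ge0.
Qed.

Lemma sin_ang_gt0 n : (1 < n)%N -> 0 < sin (ang n).
Proof.
move=> n1; apply: sin_gt0_pi; rewrite ang_gt0 ?(ltnW n1) //=.
apply: le_lt_trans (ang_le_pihalf _) _; first by case: n n1 => [|[|]].
by rewrite ltr_pdivrMr // mulr_natr mulr2n ltrDl pi_gt0.
Qed.

Lemma cheb_sin t l : sin t * cheb (cos t) l = sin (l%:R * t).
Proof.
suff : sin t * cheb (cos t) l = sin (l%:R * t) /\
       sin t * cheb (cos t) l.+1 = sin (l.+1%:R * t) by case.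
elim: l => [|l [IH1 IH2]]; first by rewrite mul0r sin0 !mulr0 mul1r mulr1.
split=> //; rewrite chebSS mulrBr IH1 mulrCA IH2.
have -> : l.+2%:R * t = l.+1%:R * t + t by rewrite -[in LHS]addn1 natrD mulrDl mul1r.
have -> : l%:R * t = l.+1%:R * t - t by rewrite -[in RHS]addn1 natrD mulrDl mul1r addrK.
rewrite sinB sinD; ring.
Qed.

Lemma cheb1 l : cheb (1 : R) l = l%:R.
Proof.
suff : cheb (1 : R) l = l%:R /\ cheb (1 : R) l.+1 = l.+1%:R by case.
elim: l => [//|l [IH1 IH2]]; split=> //.
by rewrite chebSS IH1 IH2 -!natr1; ring.
Qed.

Lemma cheb_ang_ge0 n l : n != 1%N -> n = 0%N \/ (l <= n)%N ->
  0 <= cheb (cos (ang n)) l.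
Proof.
have [->|n0] := posnP n; first by rewrite ang0 cos0 cheb1.
move=> n1 [nE|ln]; first by rewrite nE in n0.
have n2 : (1 < n)%N by lia.
rewrite -(pmulr_rge0 _ (sin_ang_gt0 n2)) cheb_sin; apply: sin_ge0_pi.
rewrite mulr_ge0 ?ler0n ?ang_ge0 //= -[leRHS](ang_mul n0).
by rewrite ler_pM2r ?ang_gt0 // ler_nat.
Qed.

(** With these two coefficients the longest element of a dihedral subgroup sends each of its simple
    roots to the opposite of a simple root. *)
Lemma cheb_ang_n n : (1 < n)%N ->
  cheb (cos (ang n)) n = 0 /\ cheb (cos (ang n)) n.+1 = -1.
Proof.
move=> n1; have s0 := sin_ang_gt0 n1; have n0 : (0 < n)%N by lia.
have s1 : sin (ang n) != 0 by rewrite gt_eqF.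
split; apply: (mulfI s1); rewrite cheb_sin; first by rewrite ang_mul // sinpi mulr0.
by rewrite -[n.+1]addn1 natrD mulrDl mul1r ang_mul // addrC sinDpi mulrN1.
Qed.

End Chebyshev.

(** * The geometric representation of a triangle group *)

Section Representation.
Variables (R : realType) (N : 'I_3 -> nat).
Hypothesis N1 : forall i, N i != 1%N.

Lemma ordm1 i j : ordm N i j != 1%N.
Proof. by rewrite /ordm; case: ifP. Qed.

Definition Cg (i j : 'I_3) : R := cos (ang R (ordm N i j)).
Lemma CgE i j : Cg i j = cos (ang R (ordm N i j)). Proof. by []. Qed.

(** The Gram matrix of the simple roots; [Sm i] is the reflection in [al i] for this form, which may
    be degenerate. *)
Definition Gr : 'M[R]_3 := \matrix_(i, j) (if i == j then 1 else - Cg i j).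
Definition Sm (i : 'I_3) : 'M[R]_3 :=
  \matrix_(a, b) ((a == b)%:R - (a == i)%:R * (Gr i b *+ 2)).

Local Notation al := (al R (d := 3)).

Lemma Cg_sym (i j : 'I_3) : Cg i j = Cg j i.
Proof.
have [->//|/ordm_sym E] := eqVneq i j.
by rewrite /Cg E.
Qed.

Lemma Gr_sym : Gr^T = Gr.
Proof. by apply/matrixP => a b; rewrite !mxE eq_sym Cg_sym. Qed.

Lemma mul_al (A : 'M[R]_3) j k : (A *m al j) k 0 = A k j.
Proof.
rewrite !mxE (bigD1 j) //= big1 => [|l lj]; last by rewrite mxE (negbTE lj) mulr0.
by rewrite mxE !eqxx mulr1 addr0.
Qed.

Lemma eq_al (A B : 'M[R]_3) : (forall j, A *m al j = B *m al j) -> A = B.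
Proof. by move=> h; apply/matrixP => k j; rewrite -!mul_al h. Qed.

Lemma Sm_al i j :
  Sm i *m al j = if i == j then - al i else al j + (Cg i j *+ 2) *: al i.
Proof.
apply/colP => k; rewrite mul_al !mxE; case: (eqVneq i j) => [->|ij].
  by rewrite !mxE andbT; case: (k == j); rewrite /= ?mulr0n ?mulr1n; ring.
by rewrite !mxE !andbT; case: (k == j); case: (k == i) => /=; rewrite ?mulr0n ?mulr1n; ring.
Qed.

Lemma Sm_vE i v : Sm i *m v = v - ((Gr *m v) i 0 *+ 2) *: al i.
Proof.
have -> : Sm i = 1%:M - al i *m (2%:R *: row i Gr).
  apply/matrixP => a b; rewrite [LHS]mxE [RHS]mxE [X in _ = X + _]mxE.
  rewrite [X in _ = _ + X]mxE [X in _ = _ - X]mxE big_ord1 !mxE andbT.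
  by rewrite [2%:R * _]mulr_natl.
rewrite mulmxBl mul1mx; congr (_ - _); rewrite -mulmxA.
have -> : (2%:R *: row i Gr) *m v = ((Gr *m v) i 0 *+ 2)%:M.
  apply/rowP => k; rewrite (ord1 k) -scalemxAl -row_mul [LHS]mxE [RHS]mxE.
  by rewrite [X in _ * X]mxE [2%:R * _]mulr_natl mulr1n.
by rewrite mul_mx_scalar.
Qed.

Lemma Sm_Sm i : Sm i *m Sm i = 1%:M.
Proof.
apply: eq_al => j; rewrite mul1mx -mulmxA !Sm_al; case: (eqVneq i j) => [->|ij].
  by rewrite mulmxN Sm_al eqxx opprK.
rewrite mulmxDr -scalemxAr !Sm_al eqxx (negbTE ij).
by rewrite scalerN addrK.
Qed.

Lemma Sm_unit i : Sm i \in unitmx.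
Proof. by case/mulmx1_unit: (Sm_Sm i). Qed.

Definition Sg (i : 'I_3) : glmx R 3 := exist _ (Sm i) (Sm_unit i).

Lemma Sg_Sg i : (Sg i * Sg i = 1)%g.
Proof. by apply: val_inj; rewrite /= Sm_Sm. Qed.

Section Rotation.
Variables i j : 'I_3.
Hypothesis ij : i != j.
Let g := ang R (ordm N i j).

(* [rvec t] runs through the plane spanned by the two simple roots, and
   [Sm i *m Sm j] shifts its parameter by [2 g]. *)
Definition rvec (t : R) : 'cV[R]_3 := sin t *: al i + sin (t - g) *: al j.

Lemma rotE (t : R) : Sm i *m Sm j *m rvec t = rvec (t + g *+ 2).
Proof.
have ji : (j == i) = false by rewrite eq_sym (negbTE ij).
have e (x : R) : sin x + sin (x + g *+ 2) = Cg i j *+ 2 * sin (x + g).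
  rewrite mulr2n addrA -{1}(addrK g x); move: (x + g) => y.
  by rewrite /Cg -/g sinB sinD; ring.
have e1 := e t; have e2 := e (t - g); rewrite addrNK in e2.
have tg : t - g + g *+ 2 = t + g by rewrite mulr2n addrA addrNK.
have tg2 : t + g *+ 2 - g = t + g by rewrite mulr2n addrA addrK.
rewrite tg in e2.
have sj : Sm j *m rvec t = sin t *: al i + sin (t + g) *: al j.
  have -> : sin (t + g) = Cg i j *+ 2 * sin t - sin (t - g) by rewrite -e2; ring.
  rewrite /rvec mulmxDr -!scalemxAr !Sm_al eqxx ji Cg_sym.
  by apply/matrixP => a b; rewrite !mxE; ring.
rewrite -mulmxA sj mulmxDr -!scalemxAr !Sm_al eqxx (negbTE ij) /rvec tg2.
have -> : sin (t + g *+ 2) = Cg i j *+ 2 * sin (t + g) - sin t by rewrite -e1; ring.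
by apply/matrixP => a b; rewrite !mxE; ring.
Qed.

Lemma rot_powE n t :
  val ((Sg i * Sg j) ^+ n)%g *m rvec t = rvec (t + (g *+ 2) *+ n).
Proof.
elim: n t => [|n IH] t; first by rewrite mul1mx addr0.
rewrite expgS gl_mulE -mulmxA IH gl_mulE /= rotE; congr rvec.
by rewrite -addrA -mulrSr.
Qed.

Hypothesis n2 : (1 < ordm N i j)%N.
Let sg : sin g != 0. Proof. by rewrite gt_eqF // sin_ang_gt0. Qed.

Lemma al_rvec_i : al i = (sin g)^-1 *: rvec g.
Proof. by rewrite /rvec subrr sin0 scale0r addr0 scalerA mulVf // scale1r. Qed.

Lemma al_rvec_j : al j = - (sin g)^-1 *: rvec 0.
Proof.
by rewrite /rvec sub0r sin0 scale0r add0r sinN scalerA mulrNN mulVf // scale1r.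
Qed.

(** On the plane of the two simple roots the product is a rotation by [2 g], whose relevant power is
    a full turn. The form is nondegenerate on this plane since [sin g] is nonzero, so the third
    simple root can be corrected by the plane into a vector fixed by both reflections. *)
Lemma Sg_braid : ((Sg i * Sg j) ^+ ordm N i j = 1)%g.
Proof.
have nn2 := n2; move: nn2; set n := ordm N i j => nn2; pose M := val ((Sg i * Sg j) ^+ n)%g.
have per t : rvec (t + (g *+ 2) *+ n) = rvec t.
  have -> : (g *+ 2) *+ n = pi *+ 2.
    by rewrite -mulrnA mulnC mulrnA -[g *+ n]mulr_natl ang_mul //; lia.
  by rewrite /rvec addrAC !sinD2pi.
have Mi : M *m al i = al i.
  by rewrite /M al_rvec_i -scalemxAr rot_powE // per.
have Mj : M *m al j = al j.
  by rewrite /M al_rvec_j -scalemxAr rot_powE // per.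
apply: val_inj; apply: eq_al => k; rewrite mul1mx -/M.
have [->//|ki] := eqVneq k i; have [->//|kj] := eqVneq k j.
(* The projection of [al k] to the orthogonal of [al i] and [al j] is fixed. *)
pose c := Cg i j; have c1 : 1 - c ^+ 2 != 0.
  by rewrite /c /Cg -sin2cos2 expf_neq0.
pose x := - (Cg i k + c * Cg j k) / (1 - c ^+ 2).
pose y := - (Cg j k + c * Cg i k) / (1 - c ^+ 2).
pose w := al k - x *: al i - y *: al j.
have ikE : Cg i k = - (x - c * y) by rewrite /x /y; field.
have jkE : Cg j k = - (y - c * x) by rewrite /x /y; field.
move: x y ikE jkE @w => x y ikE jkE w.
have [ik jk] : (i == k) = false /\ (j == k) = false.
  by rewrite ![_ == k]eq_sym (negbTE ki) (negbTE kj).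
have ji : (j == i) = false by rewrite eq_sym (negbTE ij).
have wi : Sm i *m w = w.
  rewrite /w !mulmxBr -!scalemxAr !Sm_al eqxx ik (negbTE ij) -/c.
  apply/matrixP => a b; rewrite !mxE.
  by rewrite ikE; ring.
have wj : Sm j *m w = w.
  rewrite /w !mulmxBr -!scalemxAr !Sm_al eqxx jk ji [Cg j i]Cg_sym -/c.
  apply/matrixP => a b; rewrite !mxE.
  by rewrite jkE; ring.
have Mw : M *m w = w.
  rewrite /M; elim: (n) => [|m IH]; first by rewrite mul1mx.
  by rewrite expgS gl_mulE -mulmxA IH gl_mulE -mulmxA wj wi.
have -> : al k = w + x *: al i + y *: al j by rewrite /w addrAC addrNK addrNK.
by move: (w) Mw => w' Mw'; rewrite !mulmxDr -!scalemxAr Mw' Mi Mj.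
Qed.

End Rotation.

Lemma ordm_neq0 i : (N i <> 0)%N -> (1 < N i)%N.
Proof. by have := N1 i; case: (N i) => [|[|]]. Qed.

Lemma phi_ex : exists F : {multiplicative vonDyck N -> glmx R 3},
  forall i, F (vx N i) = (Sg i * Sg (ordS i))%g.
Proof.
apply: vonDyck_lift => [i|].
  have iS : i != ordS i by elim/I3_ind: i.
  have [->//|/eqP/ordm_neq0 Ni] := eqVneq (N i) 0%N.
  by have := Sg_braid iS; rewrite ordmS; apply.
by rewrite !ordS3 !mulgA -(mulgA (Sg i0)) Sg_Sg mulg1 -(mulgA (Sg i0)) Sg_Sg mulg1 Sg_Sg.
Qed.

Definition phi : {multiplicative vonDyck N -> glmx R 3} := sval (cid phi_ex).
Lemma phi_vx i : phi (vx N i) = (Sg i * Sg (ordS i))%g.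
Proof. exact: (svalP (cid phi_ex)). Qed.

(** The compatibility that lets [phi] extend to the triangle group, the adjoined involution acting
    as [Sg i1]. *)
Lemma phi_flip g : (Sg i1 * phi g * Sg i1 = phi (flip N g))%g.
Proof.
have SV i : ((Sg i)^-1 = Sg i)%g by apply: mulg1_eq (Sg_Sg i).
elim/vx_ind: g => [|i].
  split=> [|g h IHg IHh|g IHg].
  - by rewrite !multiplicative1 mulg1 Sg_Sg.
  - by rewrite !gmulfM -IHg -IHh !mulgA (mulgrr Sg_Sg).
  - by rewrite !multiplicativeV -IHg !invgM SV mulgA.
rewrite phi_vx flip_vx /flip_gen; elim/I3_ind: i => /=; rewrite ?gmulfM ?multiplicativeV !phi_vx !ordS3 ?invgM ?SV.
- by rewrite !mulgA (mulgrr Sg_Sg).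
- by rewrite !mulgA Sg_Sg mul1g.
- by rewrite !mulgA.
Qed.

Definition rho (g : cox N) : 'M[R]_3 := val (phi g.1 * if g.2 then Sg i1 else 1)%g.

Lemma rhoM (g h : cox N) : rho (g * h)%g = rho g *m rho h.
Proof.
rewrite /rho -gl_mulE; congr val; case: g h => [x e] [y f]; rewrite sd_mulE /= gmulfM.
case: e; case: f => /=; rewrite ?mulg1 -?phi_flip ?mulgA ?(mulgrr Sg_Sg) //.
Qed.

Lemma rho_r i : rho (cr N i) = Sm i.
Proof.
have SV j : ((Sg j)^-1 = Sg j)%g by apply: mulg1_eq (Sg_Sg j).
rewrite /rho -[Sm i]/(val (Sg i)); congr val.
elim/I3_ind: i; rewrite [X in phi X]/= [X in (_ * X)%g]/=.
- by rewrite phi_vx ordS3 (mulgrr Sg_Sg).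
- by rewrite multiplicative1 mul1g.
- by rewrite multiplicativeV phi_vx ordS3 invgM !SV (mulgrr Sg_Sg).
Qed.

Lemma rho_al i j :
  rho (cr N i) *m al j = if i == j then - al i else al j + (Cg i j *+ 2) *: al i.
Proof. by rewrite rho_r Sm_al. Qed.

Lemma Cg_cheb_ge0 (i j : 'I_3) l : i != j ->
  (ordm N i j = 0)%N \/ (l <= ordm N i j)%N -> 0 <= cheb (Cg i j) l.
Proof. by move=> _; apply: cheb_ang_ge0 (ordm1 _ _). Qed.

Local Notation len := (len (@cox_gen N)).

Lemma rho_pos (g : cox N) i :
  (len g < len (g * cr N i)%g)%N -> nonneg (rho g *m al i).
Proof.
exact: (tits_pos (@cr_cr N) (@cparM N) (@cpar_r N) (@cr_braid N) Cg_sym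
  Cg_cheb_ge0 rhoM rho_al).
Qed.

Lemma rho_neg (g : cox N) i :
  (len (g * cr N i)%g < len g)%N -> nonneg (- (rho g *m al i)).
Proof.
exact: (tits_neg (@cr_cr N) (@cparM N) (@cpar_r N) (@cr_braid N) Cg_sym
  Cg_cheb_ge0 rhoM rho_al).
Qed.

Lemma rho_faithful (g : cox N) : rho g = 1%:M -> g = 1%g.
Proof.
move=> g1; apply: (tits_faithful (@cr_cr N) (@cox_gen N) (@cparM N) (@cpar_r N)
  (@cr_braid N) Cg_sym Cg_cheb_ge0 rhoM rho_al) => i.
by rewrite g1 mul1mx.
Qed.

Lemma rho_cx_vxX i n : rho (cx (vx N i ^+ n)%g) =
  val ((Sg i * Sg (ordS i)) ^+ n)%g.
Proof. by rewrite /rho mulg1 /= multiplicativeX phi_vx. Qed.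

Lemma rho_one : rho 1%g = 1%:M.
Proof. exact: rho1 rhoM rho_al. Qed.

(** [Sm i] is [1 - 2 P] for a projection [P] that is self-adjoint for [Gr]. *)
Lemma Gr_Sm i : (Sm i)^T *m Gr *m Sm i = Gr.
Proof.
pose P := al i *m (al i)^T *m Gr.
have PE a b : P a b = (a == i)%:R * Gr i b.
  rewrite /P -mulmxA mxE big_ord1 mxE eqxx andbT; congr (_ * _).
  rewrite mxE (bigD1 i) //= big1 => [|k ki].
    by rewrite !mxE !eqxx mul1r addr0.
  by rewrite !mxE (negbTE ki) mul0r.
have SE : Sm i = 1%:M - P *+ 2.
  apply/matrixP => a b; rewrite [LHS]mxE [RHS]mxE [X in _ = X + _]mxE.
  by rewrite [X in _ = _ + X]mxE mulmxnE PE mulrnAr.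
have PP : P *m P = P.
  apply/matrixP => a b; rewrite mxE PE (bigD1 i) //= big1 => [|k ki].
    by rewrite !PE eqxx mul1r addr0 mxE eqxx mulr1.
  by rewrite [P k b]PE (negbTE ki) mul0r mulr0.
have PT : P^T *m Gr = Gr *m P by rewrite /P !trmx_mul trmxK Gr_sym !mulmxA.
have ST : (Sm i)^T = 1%:M - P^T *+ 2.
  by apply/matrixP => a b; rewrite SE 2!mxE ![in LHS]mxE ![in RHS]mxE [b == a]eq_sym.
rewrite ST SE !mulmxBl !mulmxBr !mul1mx !mulmx1.
rewrite -!scaler_nat -!scalemxAl -!scalemxAr PT -mulmxA PP.
by apply/matrixP => a b; rewrite !mxE; ring.
Qed.

Lemma Gr_inv g : (rho g)^T *m Gr *m rho g = Gr.
Proof.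
have [w <-] := cox_gen g; elim: w => [|i w IH].
  by rewrite ev_nil rho_one trmx1 mul1mx mulmx1.
rewrite ev_cons rhoM trmx_mul -[RHS]IH rho_r -[in RHS](Gr_Sm i).
by rewrite !mulmxA.
Qed.

End Representation.

(** * Orders and center of von Dyck groups *)

Section Center.
Variables (R : realType) (N : 'I_3 -> nat).
Hypothesis N1 : forall i, N i != 1%N.
Local Notation rho := (rho R N1).
Local Notation al := (al R (d := 3)).
Local Notation Gr := (Gr R N).
Local Notation Cg := (Cg R N).

Lemma ordS_neq (i : 'I_3) : i != ordS i. Proof. by elim/I3_ind: i. Qed.

Lemma rho_inj (g h : cox N) : rho g = rho h -> g = h.
Proof.
move=> gh; apply/eqP; rewrite -divg_eq1; apply/eqP; apply: (rho_faithful (R := R) (N1 := N1)).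
by rewrite rhoM gh -rhoM mulgV rho_one.
Qed.

Lemma rvec_inj_i (i j : 'I_3) (ij : i != j) (s t : R) :
  rvec N i j s = rvec N i j t -> sin s = sin t.
Proof.
move=> /matrixP/(_ i 0); rewrite !mxE !eqxx eq_sym eq_sym (negbTE ij) /=.
by rewrite !mulr1 !mulr0 !addr0.
Qed.

Lemma vx_pow_eq1 i n : (0 < n)%N -> (N i = 0)%N \/ (n < N i)%N -> (vx N i ^+ n)%g != 1%g.
Proof.
move=> n0 Nn; apply/eqP => xn; have ij := ordS_neq i.
have E : rho (cx (vx N i ^+ n)%g) = 1%:M by rewrite xn rho_one.
have [N0|Npos] := posnP (N i).
  (* For the label 0 the product is unipotent: its [n]-th power gives [al i] the coefficient [2 n]
     on the other simple root. *)
  have := rho_altw (Cg_sym R N) (rhoM R N1) (rho_al R N1) n.*2 ij.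
  rewrite /=.
  rewrite (ev_altw_even (cr N)) cr_crS.
  rewrite -(multiplicativeX (@cx N)) E mul1mx odd_double CgE ordmS N0 ang0 cos0 !cheb1.
  move=> /matrixP/(_ (ordS i) 0); rewrite !mxE !eqxx eq_sym (negbTE ij) /=.
  by rewrite mulr0 add0r mulr1 => /esym/eqP; rewrite pnatr_eq0 double_eq0; lia.
have {}Nn : (n < N i)%N by case: Nn => // N0; rewrite N0 in Npos.
have N2 : (1 < N i)%N by have := N1 i; lia.
pose g : R := ang R (ordm N i (ordS i)).
have gE : g = ang R (N i) by rewrite /g ordmS.
have h (t : R) : rvec N i (ordS i) (t + (g *+ 2) *+ n) = rvec N i (ordS i) t.
  by rewrite -(rot_powE N ij) -rho_cx_vxX E mul1mx.
(* At the parameter [pi / 2] the invariance reads [cos (2 n g) = 1], which is impossible because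
   [0 < n g < pi]. *)
have h0 := rvec_inj_i ij (h (pi / 2)).
move: h0; rewrite -mulrnA mulnC mulrnA sinD cos_pihalf sin_pihalf mul0r addr0 mul1r.
rewrite cos_mulr2n cos2sin2 => /eqP; rewrite -subr_eq0.
have -> : (1 - sin (g *+ n) ^+ 2) *+ 2 - 1 - 1 = - (sin (g *+ n) ^+ 2 *+ 2).
  by ring.
rewrite oppr_eq0 mulrn_eq0 /= expf_eq0 /= gt_eqF //.
apply: sin_gt0_pi; rewrite pmulrn_lgt0 // gE ang_gt0 //=.
rewrite -[X in X < _]mulr_natl -[X in _ < X](ang_mul R Npos) ltr_pM2r ?ang_gt0 //.
by rewrite ltr_nat.
Qed.

Lemma vx_order i : has_order (vx N i) (N i).
Proof.
apply: expg_has_order; first exact: vx_pow.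
move=> n xn; have [N0|Npos] := posnP (N i).
  have [->|n0] := posnP n; first by rewrite dvdn0.
  by have := vx_pow_eq1 (i := i) n0 (or_introl N0); rewrite xn eqxx.
rewrite /dvdn; have [//|r0] := posnP (n %% N i).
have := vx_pow_eq1 (i := i) r0 (or_intror (ltn_pmod n Npos)).
have := xn; rewrite {1}(divn_eq n (N i)) mulnC expgnDr expgnA vx_pow expg1n mul1g => ->.
by rewrite eqxx.
Qed.

Lemma det_Sm i : \det (Sm R N i) = -1.
Proof.
rewrite (expand_det_col _ i) (bigD1 i) //= big1 => [|k ki]; last first.
  by rewrite mxE (negbTE ki) mul0r subr0 mul0r.
have -> : Sm R N i i i = -1 by rewrite !mxE !eqxx /=; ring.
rewrite addr0 /cofactor -signr_odd oddD addbb expr0 mul1r.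
have -> : row' i (col' i (Sm R N i)) = 1%:M.
  apply/matrixP => a b; rewrite 3!mxE (inj_eq (@lift_inj _ i)).
  by rewrite [lift i a == i]eq_sym (negbTE (neq_lift _ _)) mul0r subr0 mxE.
by rewrite det1 mulr1.
Qed.

Lemma det_rho g : \det (rho g) = (-1) ^+ cpar g.
Proof.
have [w <-] := cox_gen g; elim: w => [|i w IH]; first by rewrite ev_nil rho_one det1.
by rewrite ev_cons rhoM det_mulmx IH rho_r det_Sm cparM cpar_r; case: (cpar _); rewrite ?mulrNN ?mulr1.
Qed.

Lemma cos_ang_gt0 n : n != 1%N -> n != 2%N -> 0 < cos (ang R n).
Proof.
case: n => [|[//|[//|n]]] _ _; first by rewrite ang0 cos0.
apply: cos_gt0_pihalf; apply/andP; split.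
  by rewrite (@lt_trans _ _ 0) ?ang_gt0 // oppr_lt0 divr_gt0 ?pi_gt0.
by rewrite /ang ltr_pM2l ?pi_gt0 // ltf_pV2 ?posrE ?ltr0n // ltr_nat.
Qed.

Lemma cos_ang_lt1 n : (1 < n)%N -> cos (ang R n) ^+ 2 != 1.
Proof.
move=> n1; rewrite cos2sin2 -subr_eq0 addrC addKr oppr_eq0 expf_neq0 //.
by rewrite gt_eqF // sin_ang_gt0.
Qed.

Hypothesis N2 : forall i j, i != j -> N i = 2%N -> N j <> 2%N.

(** This makes the image of [Sm i *m Sm (ordS i) - 1] the whole plane of the two simple roots, even
    for a degenerate form. If [N i] is nonzero, the minor [1 - c ^ 2] on that plane is invertible.
    If [N i = 0], the third root is used instead of the second; the determinant is then, up to sign,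
    the sum of the two other cosines, positive because their labels are not both 2. *)
Lemma Gr_onto i (p q : R) : exists v : 'cV[R]_3,
  (Gr *m v) i 0 = p /\ (Gr *m v) (ordS i) 0 = q.
Proof.
set j := ordS i; set k := ordS j.
have ij : i != j := ordS_neq i.
have jk : j != k := ordS_neq j.
have ki : k != i by rewrite /k /j; elim/I3_ind: (i).
have GrE a b : Gr a b = if a == b then 1 else - Cg a b by rewrite mxE.
have GG : (Gr i i = 1) * (Gr j j = 1) * (Gr i j = - Cg i j) * (Gr j i = - Cg i j) *
   (Gr i k = - Cg i k) * (Gr j k = - Cg j k).
  by rewrite !GrE !eqxx [j == i]eq_sym [i == k]eq_sym (negbTE ij) (negbTE jk) (negbTE ki) (Cg_sym _ _ j i).
have mulE (x y : R) a b c : (Gr *m (x *: al a + y *: al b)) c 0 = x * Gr c a + y * Gr c b.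
  by rewrite mulmxDr -!scalemxAr mxE [X in X + _]mxE [X in _ + X]mxE !mul_al.
have [N0|Npos] := posnP (N i); last first.
  have c1 : 1 - Cg i j ^+ 2 != 0.
    rewrite subr_eq0 eq_sym CgE ordmS; apply: cos_ang_lt1.
    by have := N1 i; lia.
  exists ((p + Cg i j * q) / (1 - Cg i j ^+ 2) *: al i
          + (q + Cg i j * p) / (1 - Cg i j ^+ 2) *: al j).
  by rewrite !mulE !GG; split; field.
have c1 : Cg i j = 1 by rewrite CgE ordmS N0 ang0 cos0.
have ski : ordS k = i by rewrite /k /j; elim/I3_ind: (i); rewrite !ordS3.
have CikE : Cg i k = cos (ang R (N k)) by rewrite Cg_sym -{1}ski CgE ordmS.
have CjkE : Cg j k = cos (ang R (N j)) by rewrite CgE ordmS.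
have s0 : Cg i k + Cg j k != 0.
  rewrite CikE CjkE gt_eqF //.
  have [/(N2 jk)/eqP Nk|Nj] := eqVneq (N j) 2%N.
    by rewrite ltr_wpDr ?cos_ang_ge0 // cos_ang_gt0.
  by rewrite ltr_wpDl ?cos_ang_ge0 // cos_ang_gt0.
exists ((p - (p + q) / (Cg i k + Cg j k) * Cg i k) *: al i
        + (- (p + q) / (Cg i k + Cg j k)) *: al k).
by rewrite !mulE !GG c1; split; field.
Qed.

(* [A] preserves the image of [Sm i *m Sm (ordS i) - 1], which is the plane
   spanned by [al i] and [al (ordS i)]. *)
Lemma commute_plane i (A : 'M[R]_3) :
  A *m (Sm R N i *m Sm R N (ordS i)) = Sm R N i *m Sm R N (ordS i) *m A ->
  (A *m al i) (ordS (ordS i)) 0 = 0 /\ (A *m al (ordS i)) (ordS (ordS i)) 0 = 0.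
Proof.
set j := ordS i; set k := ordS j => cA.
have ij : i != j := ordS_neq i.
have jk : j != k := ordS_neq j.
have ki : k != i by rewrite /k /j; elim/I3_ind: (i).
have XE v : Sm R N i *m Sm R N j *m v - v =
    - ((Gr *m v) i 0 *+ 2 + Cg i j *+ 4 * (Gr *m v) j 0) *: al i
    - ((Gr *m v) j 0 *+ 2) *: al j.
  rewrite -mulmxA (Sm_vE N j v) mulmxBr (Sm_vE N i v) -scalemxAr Sm_al (negbTE ij).
  by apply/colP => a; rewrite !mxE; ring.
have Xk (v : 'cV[R]_3) : (Sm R N i *m Sm R N j *m v - v) k 0 = 0.
  by rewrite XE !mxE (negbTE ki) eq_sym (negbTE jk) /=; ring.
have im (w : 'cV[R]_3) : (exists v, w = Sm R N i *m Sm R N j *m v - v) -> (A *m w) k 0 = 0.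
  by move=> [v ->]; rewrite mulmxBr mulmxA cA -[_ *m A *m v]mulmxA Xk.
split; apply: im.
  have [v [p q]] := Gr_onto i (- (2^-1)) 0; exists v.
  by rewrite XE p q; apply/colP => a; rewrite !mxE; field.
have [v [p q]] := Gr_onto i (Cg i j) (- (2^-1)); exists v.
by rewrite XE p q; apply/colP => a; rewrite !mxE; field.
Qed.

(** The matrix of [g] preserves the three planes of [commute_plane], hence the lines where two of
    them meet, which are those of the simple roots. Invariance of [Gr] makes the eigenvalues signs,
    equal along an edge whose label is not 2; at most one edge is excluded, so the other two connect
    all vertices and the matrix is 1 or -1. The dimension is odd and even elements have determinant
    1, which leaves 1. *)
Lemma vonDyck_center g : center (vonDyck N) g -> g = 1%g.
Proof.
move=> cg; have [A AE0] : exists A, A = rho (cx g) by eexists.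
have cA i : A *m (Sm R N i *m Sm R N (ordS i)) = Sm R N i *m Sm R N (ordS i) *m A.
  by rewrite -!(rho_r R N1) -rhoM cr_crS AE0 -!rhoM -!cxM cg.
pose l i := A i i.
have off i j : i != j -> A i j = 0.
  move=> ij; have := commute_plane (cA i); rewrite !mul_al.
  have := commute_plane (cA j); rewrite !mul_al.
  have := commute_plane (cA (ordS i)); rewrite !mul_al.
  by move: ij; elim/I3_ind: i; elim/I3_ind: j; rewrite ?ordS3 // => _ [? ?] [? ?] [? ?].
have Al i : A *m al i = l i *: al i.
  apply/colP => k; rewrite mul_al !mxE andbT; have [->|ki] := eqVneq k i.
    by rewrite mulr1.
  by rewrite off // mulr0.
have inv i j : l i * l j * Gr i j = Gr i j.
  have /matrixP/(_ i j) := Gr_inv R N1 (cx g); rewrite -AE0.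
  have -> : A^T *m Gr *m A = \matrix_(a, b) (l a * l b * Gr a b).
    apply/matrixP => a b; rewrite [LHS]mxE (bigD1 b) //= big1 ?addr0 => [|k kb]; last first.
      by rewrite off // mulr0.
    rewrite [(A^T *m _) _ _]mxE (bigD1 a) //= big1 ?addr0 => [|k ka]; last first.
      by rewrite [_^T _ _]mxE off // mul0r.
    by rewrite [_^T _ _]mxE [RHS]mxE /l; ring.
  by rewrite mxE.
have l2 i : l i * l i = 1 by have := inv i i; rewrite mxE eqxx mulr1.
have lS i : N i != 2%N -> l i = l (ordS i).
  move=> Ni; have := inv i (ordS i); rewrite mxE (negbTE (ordS_neq i)) CgE ordmS.
  have c0 : - cos (ang R (N i)) != 0 by rewrite oppr_eq0 gt_eqF // cos_ang_gt0.
  move=> /(canRL (mulfK c0)); rewrite divff // => h.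
  by rewrite -[LHS]mulr1 -(l2 (ordS i)) mulrA h mul1r.
have lc i : l i = l i0.
  have c01 := lS i0; have c12 := lS i1; have c20 := lS i2; rewrite !ordS3 in c01 c12 c20.
  have n01 := @N2 i0 i1 isT; have n12 := @N2 i1 i2 isT; have n20 := @N2 i2 i0 isT.
  elim/I3_ind: i => //.
    have [E|/c01 //] := eqVneq (N i0) 2%N.
    have /eqP h := n01 E; rewrite (c12 h) c20 //.
    by apply/eqP => /n20; rewrite E.
  have [E|/c20 //] := eqVneq (N i2) 2%N.
  have /eqP h := n20 E; rewrite (c01 h) c12 //.
  by apply/eqP => /n12; rewrite E.
have AE : A = (l i0)%:M.
  apply: eq_al => j; rewrite Al lc mul_scalar_mx; congr (_ *: _).
have dA := det_rho (cx g); rewrite -AE0 AE det_scalar /= expr0 in dA.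
have l1 : l i0 = 1 by move: dA; rewrite exprS expr2 l2 mulr1.
have : cx g = 1%g by apply: (rho_faithful (R := R) (N1 := N1)); rewrite -AE0 AE l1.
by case.
Qed.

End Center.

(** * The Tits cone *)

Definition fin (T : Type) := exists s : seq T, forall x, List.In x s.

Lemma fin_inj (T : Type) (F : finType) (f : T -> F) : injective f -> fin T.
Proof.
move=> fi; pose pre (y : F) : seq T :=
  if pselect (exists x, f x = y) is left h then [:: sval (cid h)] else [::].
exists (flatten (map pre (enum F))) => x.
have : f x \in enum F by rewrite mem_enum.
elim: (enum F) => // y s IH; rewrite inE => /orP[/eqP <-|/IH h]; last first.
  by rewrite /=; apply/List.in_or_app; right.
rewrite /= /pre; case: pselect => [h|[]]; last by exists x.
by left; apply: fi; apply: (svalP (cid h)).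
Qed.

Section Cone.
Variables (R : realType) (N : 'I_3 -> nat).
Hypothesis Nge2 : forall i, (2 <= N i)%N.

Lemma Nneq1 i : N i != 1%N. Proof. by have := Nge2 i; case: (N i) => [|[|]]. Qed.

Local Notation rho := (rho R Nneq1).
Local Notation al := (al R (d := 3)).
Local Notation Gr := (Gr R N).
Local Notation len := (len (@cox_gen N)).

(** Row vectors form the dual representation, with the group acting on the right. The entry [y 0 k]
    is the value of [y] on [al k], so this is the closed fundamental chamber. *)
Definition nonnegr (y : 'rV[R]_3) := forall k, 0 <= y 0 k.

Lemma rhoV_mul g v : rho g^-1%g *m (rho g *m v) = v :> 'cV[R]_3.
Proof. by rewrite mulmxA -rhoM mulVg rho_one mul1mx. Qed.

Lemma pair_al (y : 'rV[R]_3) i : (y *m al i) 0 0 = y 0 i.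
Proof.
rewrite mxE (bigD1 i) //= big1 => [|k ki]; last by rewrite mxE (negbTE ki) mulr0.
by rewrite mxE !eqxx mulr1 addr0.
Qed.

Lemma pair_rho_al (y : 'rV[R]_3) g i : (y *m (rho g *m al i)) 0 0 = (y *m rho g) 0 i.
Proof. by rewrite mulmxA pair_al. Qed.

Lemma pair_ge0 y (v : 'cV[R]_3) : nonnegr y -> nonneg v -> 0 <= (y *m v) 0 0.
Proof. by move=> y0 v0; rewrite mxE sumr_ge0 // => k _; rewrite mulr_ge0. Qed.

Lemma row_Sm_fix (y : 'rV[R]_3) i : y 0 i = 0 -> y *m Sm R N i = y.
Proof.
move=> yi; apply/rowP => k; rewrite mxE.
have E a : y 0 a * Sm R N i a k = y 0 a * (a == k)%:R.
  rewrite mxE mulrBr; have [->|ai] := eqVneq a i; last by rewrite mul0r mulr0 subr0.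
  by rewrite yi !mul0r subr0.
under eq_bigr do rewrite E.
rewrite (bigD1 k) //= big1 => [|a ak]; last by rewrite (negbTE ak) mulr0.
by rewrite eqxx mulr1 addr0.
Qed.

Lemma len_step g i : (len (g * cr N i)%g < len g)%N \/ (len g < len (g * cr N i)%g)%N.
Proof.
rewrite (len_r_ltgt (@cox_gen N) (@cparM N) (@cpar_r N)).
by case: (_ < _)%N; [right|left].
Qed.

Lemma cr_mulrr g i : (g * cr N i * cr N i = g)%g.
Proof. exact: mulgrr (@cr_cr N) g i. Qed.

(** At a right descent [i] of [w] the root [rho w *m al i] is negative, so [y] is both nonpositive
    and nonnegative on it. Hence [y *m rho w] lies on the wall [i] and [w] can be replaced by the
    shorter [w * cr N i]. *)
Lemma chamber_stab w (y : 'rV[R]_3) : nonnegr y -> nonnegr (y *m rho w) ->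
  y *m rho w = y /\ exists e, all (fun i => y 0 i == 0) e /\ ev (cr N) e = w.
Proof.
move=> y0; have [n] := ubnP (len w); elim: n w => // n IH w ln yw0.
have [->|/eqP w1] := eqVneq w 1%g.
  by rewrite rho_one mulmx1; split=> //; exists [::]; rewrite ev_nil.
have [i li] := len_descent (@cr_cr N) (@cox_gen N) w1.
have yi : (y *m rho w) 0 i = 0.
  apply/le_anti; rewrite yw0 andbT -pair_rho_al.
  by have := pair_ge0 y0 (rho_neg R Nneq1 li); rewrite mulmxN mxE oppr_ge0.
have E : y *m rho (w * cr N i)%g = y *m rho w.
  by rewrite rhoM mulmxA rho_r row_Sm_fix.
have [] := IH (w * cr N i)%g; [exact: leq_trans li ln|by rewrite E|].
rewrite E => yw [e [e0 eE]]; split=> //; exists (rcons e i).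
by rewrite all_rcons -{1}yw yi eqxx e0 ev_rcons eE cr_mulrr.
Qed.

Definition is_root (b : 'cV[R]_3) := exists g i, b = rho g *m al i.

Lemma root_mul g b : is_root b -> is_root (rho g *m b).
Proof. by move=> [h [i ->]]; exists (g * h)%g, i; rewrite rhoM mulmxA. Qed.

Lemma root_dich b : is_root b -> nonneg b \/ nonneg (- b).
Proof.
by move=> [g [i ->]]; case: (len_step g i) => [/(rho_neg R Nneq1)|/(rho_pos R Nneq1)]; [right|left].
Qed.

Lemma root_norm b : is_root b -> b^T *m Gr *m b = 1%:M.
Proof.
move=> [g [i ->]]; rewrite trmx_mul mulmxA -(mulmxA _ _ Gr) -(mulmxA _ _ (rho g)) Gr_inv.
by apply/matrixP => x y; rewrite !ord1 pair_al trmx_delta -rowE !mxE eqxx.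
Qed.

Lemma root_neq0 b : is_root b -> b != 0.
Proof.
move=> /root_norm; apply: contra_eq_neq => ->; rewrite mulmx0.
by apply/eqP => /matrixP/(_ 0 0); rewrite !mxE => /eqP; rewrite eq_sym oner_eq0.
Qed.

Lemma root_pos_neg b : is_root b -> nonneg b -> ~ nonneg (- b).
Proof.
move=> rb b0 nb; have /eqP := root_neq0 rb; apply; apply/colP => k.
by apply/le_anti; rewrite mxE b0 andbT; have := nb k; rewrite mxE oppr_ge0.
Qed.

(** The reflection changes only the coordinate [i]. If it made [b] negative, all other coordinates
    would vanish, and a positive multiple of [al i] of norm 1 is [al i]. *)
Lemma reflect_pos b i : is_root b -> nonneg b -> b != al i -> nonneg (rho (cr N i) *m b).
Proof.
move=> rb b0 bi; case: (root_dich (root_mul (cr N i) rb)) => // nb; case/eqP: bi.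
have bk k : k != i -> b k 0 = 0.
  move=> ki; apply/le_anti; rewrite b0 andbT.
  have := nb k; rewrite rho_r Sm_vE !mxE (negbTE ki) /= mulr0 subr0.
  by rewrite oppr_ge0.
have bE : b = b i 0 *: al i.
  apply/colP => k; rewrite !mxE andbT; have [->|/bk->] := eqVneq k i.
    by rewrite mulr1.
  by rewrite mulr0.
have trZ (c : R) : (c *: al i)^T = c *: (al i)^T.
  by apply/matrixP => x y; rewrite !mxE.
have ra : is_root (al i) by exists 1%g, i; rewrite rho_one mul1mx.
have := root_norm rb; rewrite bE trZ -!scalemxAl -scalemxAr (root_norm ra) scalerA => /matrixP/(_ 0 0); rewrite !mxE mulr1 -expr2 => /eqP.
rewrite sqrf_eq1 => /orP[/eqP->|/eqP b1]; first by rewrite scale1r.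
by have := b0 i; rewrite b1 oppr_ge0 ler10.
Qed.

(** Prefixing a letter [i] to a word can turn only one more root negative, the one that the rest of
    the word sends to [al i]. *)
Lemma inversions_fin g : exists s : seq 'cV[R]_3,
  forall b, is_root b -> nonneg b -> ~ nonneg (rho g *m b) -> b \in s.
Proof.
have [w <-] := cox_gen g; elim: w => [|i w [s IH]].
  by exists [::] => b _ b0; rewrite ev_nil rho_one mul1mx.
exists (rho (ev (cr N) w)^-1%g *m al i :: s) => b rb b0.
rewrite ev_cons rhoM -mulmxA inE => nb.
have [E|bi] := eqVneq (rho (ev (cr N) w) *m b) (al i).
  by rewrite -E rhoV_mul eqxx.
case: (root_dich (root_mul (ev (cr N) w) rb)) => wb.
  by case: nb; apply: reflect_pos => //; apply: root_mul.
by rewrite IH ?orbT // => /(root_pos_neg (root_mul _ rb)).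
Qed.

(** By faithfulness an element is determined by the images of the three simple roots, which lie in a
    finite list. *)
Lemma fin_of_roots (s : seq 'cV[R]_3) :
  (forall b, is_root b -> nonneg b -> b \in s) -> fin (vonDyck N).
Proof.
move=> h; pose s' := s ++ [seq - b | b <- s].
have h' b : is_root b -> b \in s'.
  move=> rb; rewrite mem_cat; case: (root_dich rb) => b0; first by rewrite h.
  have rb' : is_root (- b).
    case: rb => [g [i ->]]; exists (g * cr N i)%g, i.
    by rewrite rhoM -mulmxA rho_al eqxx mulmxN.
  by rewrite -[b]opprK map_f ?orbT ?h.
pose f (g : vonDyck N) : {ffun 'I_3 -> 'I_(size s').+1} :=
  [ffun k => inord (index (rho (cx g) *m al k) s')].
apply: (@fin_inj _ _ f) => g g' /ffunP E.
suff : cx g = cx g' by case.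
apply: (rho_inj (R := R) (N1 := Nneq1)); apply: eq_al => k.
have := E k; rewrite !ffunE => /(congr1 val) /=.
have rt a : is_root (rho (cx a) *m al k) by exists (cx a), k.
have lt a : (index (rho (cx a) *m al k) s' < (size s').+1)%N.
  by rewrite ltnS index_size.
rewrite !inordK // => /(congr1 (nth 0 s')).
by rewrite !nth_index ?h'.
Qed.

(** A point negative on finitely many positive roots lies in the Tits cone: if it is negative on
    [al i], reflecting by [i] removes [al i] from the list and permutes the other positive roots. *)
Lemma cone_chamber (s : seq 'cV[R]_3) (y : 'rV[R]_3) :
  (forall b, is_root b -> nonneg b -> (y *m b) 0 0 < 0 -> b \in s) ->
  exists g, nonnegr (y *m rho g).
Proof.
have [n] := ubnP (size s); elim: n s y => // n IH s y sn h.
have [y0|] := pselect (nonnegr y); first by exists 1%g; rewrite rho_one mulmx1.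
move=> /existsNP[i /negP]; rewrite -ltNge => yi.
have ri : is_root (al i) by exists 1%g, i; rewrite rho_one mul1mx.
have ip : nonneg (al i) by move=> k; rewrite mxE; case: (_ && _).
have is' : al i \in s by apply: h; rewrite ?pair_al.
pose s' := [seq rho (cr N i) *m b | b <- rem (al i) s].
have [||g yg] := IH s' (y *m rho (cr N i)); last by exists (cr N i * g)%g; rewrite rhoM mulmxA.
  rewrite size_map size_rem //; have : (0 < size s)%N by case: (s) is'.
  by move: sn; case: (size s) => // m _; rewrite /= ltnS.
move=> b rb b0; rewrite -mulmxA => yb.
have ss (v : 'cV[R]_3) : rho (cr N i) *m (rho (cr N i) *m v) = v.
  by rewrite mulmxA -rhoM cr_cr rho_one mul1mx.
have bi : b != al i.
  apply/eqP => E; move: yb; rewrite E rho_al eqxx mulmxN mxE pair_al oppr_lt0.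
  by move/(lt_trans yi); rewrite ltxx.
have sb : rho (cr N i) *m b \in s.
  by apply: h => //; [apply: root_mul|apply: reflect_pos].
rewrite -[b]ss map_f //; apply: rem_mem => //.
apply/eqP => E; have := ss b; rewrite E rho_al eqxx => bE.
by have := b0 i; rewrite -bE !mxE !eqxx oppr_ge0 ler10.
Qed.

End Cone.

(** * Torsion in infinite von Dyck groups *)

Section Infinite.
Variables (R : realType) (N : 'I_3 -> nat).
Hypothesis Nge2 : forall i, (2 <= N i)%N.
Hypothesis Tinf : ~ fin (vonDyck N).

Local Notation rho := (rho R (Nneq1 Nge2)).
Local Notation al := (al R (d := 3)).
Local Notation Cg := (Cg R N).
Local Notation is_root := (is_root (R := R) Nge2).

(** The dual basis; these are the vertices of the fundamental chamber. *)
Definition om (i : 'I_3) : 'rV[R]_3 := delta_mx 0 i.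

Lemma om_ge0 i : nonnegr (om i).
Proof. by move=> k; rewrite mxE ler0n. Qed.

Lemma root_avoid (s : seq 'cV[R]_3) : exists b, [/\ is_root b, nonneg b & b \notin s].
Proof.
apply: contrapT => h; apply: Tinf; apply: (@fin_of_roots R N Nge2 s) => b rb b0.
by apply/negPn/negP => bs; apply: h; exists b.
Qed.

Lemma longest_ex i : exists w, nonneg (- (rho w *m al i)) /\ nonneg (- (rho w *m al (ordS i))).
Proof.
set j := ordS i; have ij : i != j := ordS_neq i.
have ji : j != i by rewrite eq_sym.
have alp k : nonneg (- - al k) by move=> a; rewrite opprK mxE ler0n.
have c (a b : 'I_3) : ordm N a b = N i ->
    cheb (Cg a b) (N i) = 0 /\ cheb (Cg a b) (N i).+1 = -1.
  by move=> E; rewrite CgE E; apply: cheb_ang_n.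
have [c0 c1] := c i j (ordmS N i).
have [d0 d1] := c j i (etrans (ordm_sym N ji) (ordmS N i)).
exists (ev (cr N) (altw i j (N i))); split; last first.
  have -> : ev (cr N) (altw i j (N i)) = ev (cr N) (altw j i (N i)).
    by apply: (ev_altw_swap (@cr_cr N)); rewrite -(ordmS N i) cr_braid.
  rewrite (rho_altw (Cg_sym R N) (rhoM R _) (rho_al R _) _ ji).
  by case: ifP => _; rewrite d0 d1 scale0r scaleN1r ?addr0 ?add0r; apply: alp.
rewrite (rho_altw (Cg_sym R N) (rhoM R _) (rho_al R _) _ ij).
by case: ifP => _; rewrite c0 c1 scale0r scaleN1r ?addr0 ?add0r; apply: alp.
Qed.

(** Infiniteness is essential here: the longest element of a finite group sends every vertex to a
    negative multiple of a vertex. For nonnegative [l] the claim is the description of stabilizers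
    in the chamber. *)
Lemma weight_conj o o' g (l : R) : om o' *m rho g = l *: om o ->
  o' = o /\ exists e, all (fun i => i != o) e /\ ev (cr N) e = g.
Proof.
move=> E; have l0 : 0 <= l.
  rewrite leNgt; apply/negP => l0.
  (* Otherwise almost all positive roots would lie in the plane spanned by
     [al i] and [al j], and the longest element of <r_i, r_j> negates them. *)
  pose i := ordS o; pose j := ordS i.
  have [w [wi wj]] := longest_ex i; rewrite -/j in wj.
  have [s1 h1] := inversions_fin R Nge2 g.
  have [s2 h2] := inversions_fin R Nge2 w.
  have [b [rb b0]] := root_avoid (s1 ++ s2).
  rewrite mem_cat negb_or => /andP[bs1 bs2].
  have gb : nonneg (rho g *m b) by apply: contrapT => h; rewrite h1 in bs1.
  have wb : nonneg (rho w *m b) by apply: contrapT => h; rewrite h2 in bs2.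
  have bo : b o 0 = 0.
    have := pair_ge0 (om_ge0 o') gb; rewrite mulmxA E -scalemxAl -rowE !mxE => h.
    by apply/le_anti; rewrite b0 andbT -(nmulr_rge0 _ l0).
  have bE : b = b i 0 *: al i + b j 0 *: al j.
    apply/colP => k; rewrite !mxE !andbT.
    move: bo; rewrite /j /i; elim/I3_ind: (o); elim/I3_ind: k; rewrite !ordS3 //= => bo;
      rewrite ?bo; ring.
  case: (root_pos_neg (root_mul w rb) wb).
  rewrite bE mulmxDr -!scalemxAr => k; rewrite mxE mxE [X in X + _]mxE [X in _ + X]mxE.
  have := wi k; have := wj k; rewrite !mxE => hj hi.
  by rewrite opprD -!mulrN addr_ge0 // mulr_ge0.
have [] := @chamber_stab R N Nge2 g (om o') (om_ge0 _).
  by rewrite E => k; rewrite mxE mulr_ge0 //; apply: om_ge0.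
rewrite E => El [e [e0 eE]].
have oo : o' = o.
  apply/eqP/negP => /negP oo; have /rowP/(_ o') := El.
  by rewrite !mxE eqxx (negbTE oo) mulr0 eqxx => /eqP; rewrite eq_sym oner_eq0.
split=> //; exists e; split=> //; apply: sub_all e0 => i; rewrite mxE eqxx oo /=.
by case: (eqVneq i o) => //=; rewrite oner_eq0.
Qed.

Lemma cr_cx_vx i (n : int) :
  (cr N i * cx (expgz (vx N i) n) = cx (expgz (vx N i) (- n)%R) * cr N i)%g.
Proof.
have cxX g m : cx (expgz g m) = expgz (cx g) m := multiplicative_expgz (@cx N) g m.
set x := vx N i.
have ix : (cr N i * cx x * cr N i = (cx x)^-1)%g.
  by rewrite -cr_crS mulgA cr_cr mul1g invgM !(rV (@cr_cr N)).
rewrite !cxX expgzN; have -> : ((expgz (cx x) n)^-1 = expgz (cx x)^-1 n)%g.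
  by rewrite -expgzN -[in RHS](expgz1 (cx x)) -expgzN -expgzM mulN1r.
have -> : ((cx x)^-1 = cx x ^ cr N i)%g.
  by rewrite -ix conjgE (rV (@cr_cr N)) mulgA.
by rewrite expgz_conj conjgE (rV (@cr_cr N)) !mulgA cr_mulrr.
Qed.

(** Normal form in the dihedral group of the two reflections whose product is [vx N i]; its even
    elements are the powers of [vx N i]. *)
Lemma even_word i e : all (fun k => k != ordS (ordS i)) e ->
  exists n : int, ev (cr N) e = (cx (expgz (vx N i) n) * if odd (size e) then cr N i else 1)%g.
Proof.
set x := vx N i; set j := ordS i.
have ixn : forall n, (cr N i * cx (expgz x n) = cx (expgz x (- n)%R) * cr N i)%g := cr_cx_vx i.
have jE : (cr N j = cx (expgz x (-1)%R) * cr N i)%g.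
  by rewrite -[1%R]/(Posz 1) -ixn expgz1 -cr_crS mulgA cr_cr mul1g.
elim: e => [|k e IH] /=; first by exists 0%R; rewrite ev_nil mulg1.
move=> /andP[kij /IH[n E]]; rewrite ev_cons E mulgA.
have fin_ m (b : bool) : (cx (expgz x m) * cr N i * (if b then cr N i else 1) =
    cx (expgz x m) * (if ~~ b then cr N i else 1))%g.
  by case: b => /=; rewrite ?cr_mulrr ?mulg1.
have [kE|ki] := eqVneq k i.
  by exists (- n)%R; rewrite kE ixn fin_.
have -> : k = j.
  by move: kij ki; rewrite /j; elim/I3_ind: (i); elim/I3_ind: (k); rewrite !ordS3.
exists (-1 - n)%R; rewrite -fin_ expgzD cxM jE -(mulgA (cx _)) ixn.
by rewrite !mulgA.
Qed.

Lemma even_word_cx i e g : all (fun k => k != ordS (ordS i)) e -> ev (cr N) e = cx g ->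
  exists n : int, g = expgz (vx N i) n.
Proof.
move=> /even_word[n ->] E; exists n.
have := congr1 (@cpar N) E; rewrite cparM /=; move: E.
by case: ifP => _; rewrite ?cpar_r // mulg1 => -[].
Qed.

Lemma om_vx i (n : int) : om (ordS (ordS i)) *m rho (cx (expgz (vx N i) n)) = om (ordS (ordS i)).
Proof.
have b k : k != ordS (ordS i) -> om (ordS (ordS i)) *m Sm R N k = om (ordS (ordS i)).
  by move=> h; rewrite row_Sm_fix // mxE (negbTE h).
have h1 : om (ordS (ordS i)) *m rho (cx (vx N i)) = om (ordS (ordS i)).
  by rewrite -cr_crS rhoM mulmxA !rho_r !b //; elim/I3_ind: (i).
have hn m : om (ordS (ordS i)) *m rho (cx (vx N i ^+ m)%g) = om (ordS (ordS i)).
  elim: m => [|m IH]; first by rewrite rho_one mulmx1.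
  by rewrite expgS cxM rhoM mulmxA h1.
case: n => n //=; rewrite -{1}(hn n.+1) -mulmxA -rhoM -cxM mulgV.
by rewrite rho_one mulmx1.
Qed.

(** A nontrivial rotation leaves no nonzero linear form on its plane invariant, so [y] vanishes on
    the two simple roots of that plane. *)
Lemma fixed_row i (n : int) (y : 'rV[R]_3) : expgz (vx N i) n <> 1%g ->
  y *m rho (cx (expgz (vx N i) n)) = y ->
  y = y 0 (ordS (ordS i)) *: om (ordS (ordS i)).
Proof.
set j := ordS i; have ij : i != j := ordS_neq i.
wlog [m [m0 mN nE]] : n / exists m : nat, [/\ (0 < m)%N, (m < N i)%N & n = Posz m].
  move=> W xn yE.
  have Npos : (0 < N i)%N by apply: leq_trans (Nge2 i).
  pose m := `|(n %% N i)%Z|%N.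
  have nm : expgz (vx N i) n = expgz (vx N i) (Posz m).
    rewrite {1}(divz_eq n (N i)) expgzD mulrC expgzM expgz_nat vx_pow expgz1n mul1g.
    by rewrite /m gez0_abs // modz_ge0 // eqz_nat -lt0n.
  apply: (W (Posz m)); rewrite -?nm //; exists m; split=> //.
    by rewrite lt0n; apply/eqP => m0; apply: xn; rewrite nm m0.
  by rewrite -ltz_nat /m gez0_abs ?modz_ge0 ?ltz_pmod // eqz_nat -lt0n.
rewrite nE => _; rewrite expgz_nat rho_cx_vxX => yE.
pose g : R := ang R (ordm N i j); have gE : g = ang R (N i) by rewrite /g ordmS.
pose f t := (y *m rvec N i j t) 0 0.
have per t : f (t + (g *+ 2) *+ m) = f t.
  by rewrite /f -(rot_powE N ij) mulmxA yE.
have fE t : f t = sin t * y 0 i + sin (t - g) * y 0 j.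
  by rewrite /f /rvec mulmxDr -!scalemxAr mxE [X in X + _]mxE [X in _ + X]mxE !pair_al.
pose a := (g *+ 2) *+ m.
have ca : cos a != 1.
  have sgm : sin (g *+ m) != 0.
    rewrite gt_eqF //; apply: sin_gt0_pi; rewrite pmulrn_lgt0 // gE ang_gt0 //; last exact: leq_trans (Nge2 i).
    rewrite -[X in X < _]mulr_natl -[X in _ < X](ang_mul R (n := N i)) ?ltr_pM2r ?ang_gt0 ?ltr_nat //; exact: leq_trans (Nge2 i).
  rewrite /a -mulrnA mulnC mulrnA cos_mulr2n cos2sin2 -subr_eq0.
  have -> : (1 - sin (g *+ m) ^+ 2) *+ 2 - 1 - 1 = - (sin (g *+ m) ^+ 2 *+ 2) by ring.
  by rewrite oppr_eq0 mulrn_eq0 /= expf_neq0.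
(* A combination of sines satisfies [f (t + a) + f (t - a) = 2 cos a f t]; together with the period
   [a] and [cos a] different from 1 this forces [f = 0]. *)
have f0 t : f t = 0.
  have e1 : f (t + a) + f (t - a) = 2 * cos a * f t.
    rewrite !fE (_ : t + a - g = t - g + a); last by ring.
    rewrite (_ : t - a - g = t - g - a); last by ring.
    by rewrite !(sinB _ a) !(sinD _ a); ring.
  have e2 : f (t - a) = f t by rewrite -(per (t - a)) subrK.
  have : (cos a - 1) * f t *+ 2 = 0.
    have := e1; rewrite e2 per => e3; rewrite mulrBl mulrnBl mul1r.
    by rewrite [f t *+ 2]mulr2n e3 -mulrA mulr_natl subrr.
  by move/eqP; rewrite mulrn_eq0 /= mulf_eq0 subr_eq0 (negbTE ca) /= => /eqP.
have sg : sin g != 0 by rewrite gE gt_eqF // sin_ang_gt0.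
have yi : y 0 i = 0.
  have := f0 g; rewrite fE subrr sin0 mul0r addr0 => /eqP.
  by rewrite mulf_eq0 (negbTE sg) => /eqP.
have yj : y 0 j = 0.
  have := f0 0; rewrite fE sin0 mul0r add0r sub0r sinN => /eqP.
  by rewrite mulf_eq0 oppr_eq0 (negbTE sg) => /eqP.
apply/rowP => k; rewrite !mxE eqxx /=.
by move: yi yj; rewrite /j; elim/I3_ind: (i); elim/I3_ind: k; rewrite !ordS3 //= => yi yj; rewrite ?yi ?yj; ring.
Qed.

(** The vertex fixed by [vx N i'] is carried by [a] to a row fixed by a nontrivial power of
    [vx N i], hence to a multiple of the vertex of [i]. With equal powers on both sides this gives
    centralizers. *)
Lemma conj_vx i i' (n n' : int) a :
  expgz (vx N i) n <> 1%g -> expgz (vx N i) n = (expgz (vx N i') n' ^ a)%g ->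
  i = i' /\ exists m : int, a = expgz (vx N i) m.
Proof.
move=> xn E; set o := ordS (ordS i); set o' := ordS (ordS i').
have yE : om o' *m rho (cx a) *m rho (cx (expgz (vx N i) n)) = om o' *m rho (cx a).
  rewrite E -mulmxA -rhoM -cxM conjgE mulgA mulgA mulgV mul1g cxM rhoM mulmxA.
  by rewrite om_vx.
have [oo [e [eo eE]]] := weight_conj (fixed_row xn yE).
have ii : i = i' by move: oo; rewrite /o'; elim/I3_ind: (i); elim/I3_ind: (i'); rewrite !ordS3.
by split=> //; apply: even_word_cx eo eE.
Qed.

(** A torsion element fixes a nonzero point of the Tits cone. After a conjugation the point lies in
    the closed chamber and off some wall [o], so its stabilizer is contained in the dihedral group
    of the two other reflections, whose even elements are the powers of one generator. *)
Lemma torsion_conj (h : vonDyck N) d : (0 < d)%N -> (h ^+ d = 1)%g ->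
  exists i (n : int) a, h = (expgz (vx N i) n ^ a)%g.
Proof.
move=> d0 hd.
(* [y], the sum of an [h]-orbit in the Tits cone, is fixed by [h]. *)
pose x : 'rV[R]_3 := const_mx 1.
pose y := \sum_(k < d) x *m rho (cx (h ^+ k)%g).
have yh : y *m rho (cx h) = y.
  rewrite /y mulmx_suml.
  under eq_bigr => k _ do rewrite -mulmxA -rhoM -cxM -expgSr.
  case: d d0 hd @y => // d _ hd y.
  rewrite big_ord_recr [RHS]big_ord_recl /= hd expg0 addrC; congr (_ + _).
(* The finitely many positive roots that some power of [h] makes negative; [y] is nonnegative on all
   others. *)
have inv : exists s : seq 'cV[R]_3, forall k b, (k < d)%N -> is_root b -> nonneg b ->
    ~ nonneg (rho (cx (h ^+ k)%g) *m b) -> b \in s.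
  elim: (d) => [|m [s IH]]; first by exists [::].
  have [s' h'] := inversions_fin R Nge2 (cx (h ^+ m)%g).
  exists (s ++ s') => k b; rewrite ltnS leq_eqVlt mem_cat => /orP[/eqP-> rb b0 nb|km rb b0 nb].
    by rewrite h' ?orbT.
  by rewrite (IH k).
have [s hs] := inv.
have x0 : nonnegr x by move=> k; rewrite mxE.
have yb (b : 'cV[R]_3) : (y *m b) 0 0 = \sum_(k < d) (x *m (rho (cx (h ^+ k)%g) *m b)) 0 0.
  by rewrite /y mulmx_suml summxE; apply: eq_bigr => k _; rewrite mulmxA.
have yge0 b : is_root b -> nonneg b -> b \notin s -> 0 <= (y *m b) 0 0.
  move=> rb b0 bs; rewrite yb sumr_ge0 // => k _; apply: pair_ge0 => //.
  by apply: contrapT => nb; move: bs; rewrite (hs k).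
have y_neq0 : y != 0.
  have [b [rb b0 bs]] := root_avoid s.
  have : 0 < (y *m b) 0 0.
    rewrite lt_def yge0 // andbT; apply/eqP; rewrite yb => /eqP.
    rewrite psumr_eq0 => [|k _]; last first.
      by apply: pair_ge0 => //; apply: contrapT => nb; move: bs; rewrite (hs k).
    move=> /allP/(_ (Ordinal d0)); rewrite mem_index_enum => /(_ isT) /=.
    rewrite expg0 rho_one mul1mx mxE => /eqP/psumr_eq0P => h0.
    case/eqP: (root_neq0 rb); apply/colP => k; rewrite mxE.
    have := h0; rewrite /= => /(_ _)/(_ k isT); rewrite mxE mul1r; apply.
    by move=> a _; rewrite mxE mul1r b0.
  by apply: contraTneq => ->; rewrite mul0mx mxE ltxx.
have [g gy] : exists g, nonnegr (y *m rho g).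
  apply: (@cone_chamber R N Nge2 s) => b rb b0 ylt; apply/negPn/negP => bs.
  by have := lt_le_trans ylt (yge0 b rb b0 bs); rewrite ltxx.
pose z := y *m rho g.
have zE : z *m rho (cx h ^ g)%g = z.
  by rewrite /z conjgE rhoM mulmxA -[_ *m rho g *m _]mulmxA -rhoM mulgV rho_one mulmx1 rhoM mulmxA yh.
have gz : nonnegr (z *m rho (cx h ^ g)%g) by rewrite zE.
have [_ [e [ez eE]]] := chamber_stab gy gz.
have [o zo] : exists o, z 0 o != 0.
  apply: contrapT => ze; case/eqP: y_neq0.
  have z0 : z = 0.
    by apply/rowP => k; rewrite [RHS]mxE; apply: contrapT => zk; apply: ze; exists k; apply/eqP.
  by rewrite -[y]mulmx1 -(rho_one R (Nneq1 Nge2)) -(mulgV g) rhoM mulmxA -/z z0 mul0mx.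
pose i := ordS o; have io : ordS (ordS i) = o by rewrite /i; elim/I3_ind: (o); rewrite !ordS3.
have [|n nE] := @even_word i e.
  by apply: sub_all ez => k zk; rewrite io; apply: contraTneq zk => ->; exact: zo.
have hg : (cx h ^ g = cx (expgz (vx N i) n))%g.
  have : cpar (cx h ^ g)%g = false.
    have gV : cpar g^-1%g = cpar g by case: (g).
    by rewrite conjgE !cparM gV /= addbb.
  rewrite -eE nE cparM /=.
  by case: ifP => _; rewrite ?cpar_r // mulg1.
exists i.
case: g @z gy zE gz eE ez io zo nE hg => a [] z gy zE gz eE ez io zo nE hg; last first.
  exists n, a^-1%g; have : cx (h ^ a)%g = cx (expgz (vx N i) n) by rewrite -hg.
  by case=> <-; rewrite conjgK.
(* An odd conjugator is replaced by its product with [cr N i], which only inverts [vx N i]. *)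
pose g := ((a, true) : cox N); have [a' aE] : exists a', (g * cr N i)%g = cx a'.
  exists (g * cr N i)%g.1; rewrite [LHS]surjective_pairing; congr (_, _).
  by rewrite -[LHS]/(cpar _) cparM cpar_r.
exists (- n)%R, a'^-1%g.
have : cx (h ^ a')%g = cx (expgz (vx N i) (- n)%R).
  rewrite -[LHS]/(cx h ^ cx a')%g -aE conjgM hg conjgE (rV (@cr_cr N)).
  by rewrite mulgA cr_cx_vx cr_mulrr.
by case=> <-; rewrite conjgK.
Qed.

End Infinite.

(** * Finite von Dyck groups *)

Section Spherical.
Variables (R : realType) (N : 'I_3 -> nat).
Hypothesis Nge2 : forall i, (2 <= N i)%N.
Hypothesis Tfin : fin (vonDyck N).

Local Notation rho := (rho R (Nneq1 Nge2)).
Local Notation al := (al R (d := 3)).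
Local Notation Gr := (Gr R N).
Local Notation Cg := (Cg R N).
Local Notation len := (len (@cox_gen N)).

Lemma longest_cox : exists g, forall i, (len (g * cr N i)%g < len g)%N.
Proof.
have [s hs] := Tfin.
pose P n := `[< exists g, len g = n >].
have ub n : P n -> (n <= \sum_(a <- s) (len (a, true) + len (a, false)))%N.
  move=> /asboolP[[a e] <-]; have := hs a; elim: (s) => //= b s' IH.
  rewrite big_cons => -[->|/IH h]; last by rewrite (leq_trans h) // leq_addl.
  by move: {IH} e => []; rewrite -?addnA ?leq_addr // addnCA leq_addr.
have ex : exists n, P n by exists (len 1%g); apply/asboolP; exists 1%g.
case: (ex_maxnP ex ub) => m /asboolP[g gm] max; exists g => i.
case: (len_step g i) => // h; have Pi : P (len (g * cr N i)%g) by apply/asboolP; exists (g * cr N i)%g.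
by have := max _ Pi; rewrite -gm leqNgt h.
Qed.

(** Along a reduced word each reflection subtracts a nonpositive multiple of a positive root. *)
Lemma antidominant_grow (v : 'cV[R]_3) g : (forall i, (Gr *m v) i 0 <= 0) ->
  nonneg (rho g *m v - v).
Proof.
move=> Gv; have [n] := ubnP (len g); elim: n g => // n IH g gn.
have [->|/eqP g1] := eqVneq g 1%g.
  by rewrite rho_one mul1mx subrr => k; rewrite mxE.
have [i li] := len_descent (@cr_cr N) (@cox_gen N) g1.
have h := IH _ (leq_trans li gn).
have -> : rho g *m v - v =
  (rho (g * cr N i)%g *m v - v) - ((Gr *m v) i 0 *+ 2) *: (rho (g * cr N i)%g *m al i).
  rewrite -{1}(cr_mulrr g i) rhoM -mulmxA rho_r Sm_vE mulmxBr -scalemxAr.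
  by rewrite addrAC.
have pos : nonneg (rho (g * cr N i)%g *m al i).
  have l' : (len (g * cr N i)%g < len (g * cr N i * cr N i)%g)%N by rewrite cr_mulrr.
  exact: (rho_pos R (Nneq1 Nge2) l').
move=> k; rewrite mxE addr_ge0 ?h // mxE [X in - X]mxE -mulNr mulr_ge0 //.
by rewrite oppr_ge0 pmulrn_lle0.
Qed.

(** The longest element of a finite group sends every simple root to a negative vector, hence the
    positive [v] to a nonpositive one, whereas [antidominant_grow] says that [v] can only grow. *)
Lemma no_antidominant (v : 'cV[R]_3) : (forall i, 0 < v i 0) ->
  (forall i, (Gr *m v) i 0 <= 0) -> False.
Proof.
move=> v0 Gv; have [g gl] := longest_cox.
have vE : v = \sum_i v i 0 *: al i.
  apply/colP => k; rewrite summxE (bigD1 k) //= big1 => [|j jk].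
    by rewrite !mxE !eqxx mulr1 addr0.
  by rewrite !mxE andbT eq_sym (negbTE jk) mulr0.
have : (rho g *m v) i0 0 <= 0.
  rewrite {1}vE mulmx_sumr summxE sumr_le0 // => i _.
  rewrite -scalemxAr mxE mulr_ge0_le0 ?(ltW (v0 i)) //.
  by have := rho_neg R (Nneq1 Nge2) (gl i) i0; rewrite mxE oppr_ge0.
have := antidominant_grow g Gv i0; rewrite mxE [X in _ + X]mxE subr_ge0 => h.
by move/(le_trans h)/(lt_le_trans (v0 i0)); rewrite ltxx.
Qed.

(** The side lengths of a Euclidean triangle are in the kernel of the matrix with 1 on the diagonal
    and minus the cosines of its angles elsewhere. If the sum of the angles is at most [pi],
    enlarging the last one to [B] gives such a triangle, and going back to the smaller angle lowers
    entries of the matrix, so its sides contradict [no_antidominant]. *)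
Lemma ang_sum_gt_pi : pi < ang R (N i0) + ang R (N i1) + ang R (N i2).
Proof.
rewrite ltNge; apply/negP; set A0 := ang R _; set A1 := ang R _; set A2 := ang R _ => Sle.
pose B := pi - A0 - A1.
have pos n : (0 < N n)%N by apply: leq_trans (Nge2 n).
have a0 n : 0 < ang R (N n) by rewrite ang_gt0.
have lepi n : ang R (N n) <= pi / 2 by apply: ang_le_pihalf; apply: Nneq1.
have [p0 p1 p2] := And3 (a0 i0) (a0 i1) (a0 i2).
have [q0 q1 q2] := And3 (lepi i0) (lepi i1) (lepi i2).
rewrite -/A0 -/A1 -/A2 in p0 p1 p2 q0 q1 q2.
have pi0 := @pi_gt0 R.
have BA2 : A2 <= B by rewrite /B; lra.
have cB : cos B <= cos A2.
  have mono := @ltr_cos R; rewrite leNgt; apply/negP.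
  by rewrite mono ?in_itv /= ?ltNge ?BA2 //; rewrite /B; lra.
have s0 (n : 'I_3) : 0 < sin (ang R (N n)) by rewrite sin_ang_gt0.
have sB : 0 < sin B by apply: sin_gt0_pi; rewrite /B; lra.
have sinpiB x : sin (pi - x) = sin x.
  by rewrite sinB sinpi cospi; ring.
have sinDE (x y z : R) : z = pi - (x + y) -> sin z = sin x * cos y + cos x * sin y.
  by move=> ->; rewrite sinpiB sinD.
(* The sides of a triangle with angles [A0], [A1], [B]. *)
pose v : 'cV[R]_3 := \col_i (if i == i0 then sin A1 else if i == i1 then sin B else sin A0).
have [s00 s01] := (s0 i0, s0 i1); rewrite -/A0 -/A1 in s00 s01.
apply: (@no_antidominant v).
  by apply: I3_ind; rewrite mxE //=.
have Cv : (Cg i0 i1 = cos A0) * (Cg i1 i2 = cos A1) * (Cg i2 i0 = cos A2) *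
          (Cg i1 i0 = cos A0) * (Cg i2 i1 = cos A1) * (Cg i0 i2 = cos A2) by [].
have expand i : (Gr *m v) i 0 = Gr i i0 * sin A1 + Gr i i1 * sin B + Gr i i2 * sin A0.
  rewrite mxE !big_ord_recl big_ord0 addr0 addrA.
  have -> : lift ord0 ord0 = i1 :> 'I_3 by apply: val_inj.
  have -> : lift ord0 (lift ord0 ord0) = i2 :> 'I_3 by apply: val_inj.
  have vE j : v j 0 = if j == i0 then sin A1 else if j == i1 then sin B else sin A0.
    by rewrite mxE.
  have -> : ord0 = i0 :> 'I_3 by apply: val_inj.
  by rewrite !vE.
have e0 : sin A1 = sin A0 * cos B + cos A0 * sin B by apply: sinDE; rewrite /B; ring.
have e1 : sin B = sin A0 * cos A1 + cos A0 * sin A1 by apply: sinDE; rewrite /B; ring.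
have e2 : sin A0 = sin A1 * cos B + cos A1 * sin B by apply: sinDE; rewrite /B; ring.
apply: I3_ind; rewrite expand !mxE /= !Cv.
- have : sin A0 * cos B <= sin A0 * cos A2 by rewrite ler_pM2l.
  move: e0; lra.
- move: e1; lra.
- have : sin A1 * cos B <= sin A1 * cos A2 by rewrite ler_pM2l.
  move: e2; lra.
Qed.

Lemma spherical_of_fin :
  (N i0 * N i1 * N i2 < N i1 * N i2 + N i0 * N i2 + N i0 * N i1)%N.
Proof.
have pos n : (N n)%:R != 0 :> R.
  by rewrite pnatr_eq0 -lt0n; apply: leq_trans (Nge2 n).
have := ang_sum_gt_pi; rewrite /ang -!mulrDr -ltr_pdivrMl ?pi_gt0 // mulVf ?gt_eqF ?pi_gt0 //.
move=> h; rewrite -(ltr_nat R) !natrD !natrM.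
have p : 0 < (N i0)%:R * (N i1)%:R * (N i2)%:R :> R.
  by rewrite !mulr_gt0 // ltr0n; apply: leq_trans (Nge2 _).
rewrite -(ltr_pM2l p) mulr1 in h; apply: lt_le_trans h _.
rewrite le_eqVlt; apply/orP; left; apply/eqP; field.
by rewrite !pos.
Qed.

End Spherical.

(** * The relations of the braid groups *)

Local Close Scope ring_scope.
Local Open Scope group_scope.

Lemma side_eq2 (G : groupType) (p w z D : G) q : z * D = D * z ->
  p * D * z * (D ^+ q * D^-1) * w = p * (z * D ^+ q) * w.
Proof.
move=> cz; congr (_ * _); rewrite -!mulgA; congr (_ * _).
rewrite mulgA -cz -!mulgA; congr (_ * _).
by rewrite mulgA -expgS expgSr mulgK.
Qed.

Lemma side_eq3 (G : groupType) (p w z D : G) q : z * D = D * z ->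
  p * D * z * D ^+ q * w = p * (z * D ^+ q) * D * w.
Proof.
move=> cz; congr (_ * _); rewrite -!mulgA; congr (_ * _).
by rewrite mulgA -cz -mulgA -expgS expgSr.
Qed.

Section XProd.
Variables (G : groupType) (x : nat -> G).

Lemma xprod0 : xprod x 1 0 = 1.
Proof. by rewrite /xprod big_geq. Qed.

Lemma xprodS i : xprod x 1 i.+1 = xprod x 1 i * x i.+1.
Proof. by rewrite /xprod big_nat_recr. Qed.

Lemma xprod_tail i n : (i <= n)%N -> xprod x i.+1 n = (xprod x 1 i)^-1 * xprod x 1 n.
Proof.
elim: n => [|n IH].
  by rewrite leqn0 => /eqP->; rewrite xprod0 invg1 mul1g.
rewrite leq_eqVlt => /orP[/eqP->|]; first by rewrite mulVg /xprod big_geq.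
by rewrite ltnS => ij; rewrite xprodS mulgA -IH // /xprod big_nat_recr.
Qed.

Variables (n m : nat) (y z : G).
Hypothesis n_gt0 : (0 < n)%N.
Let q := m %/ n.
Let r := m %% n.
Local Notation P i := (xprod x 1 i).
Let dl := P n * y.
Let Z := z * dl ^+ q.

Definition braid_sat := forall a b, braid_rel n m x y z a b -> a = b.

Let rn : (r < n)%N. Proof. by rewrite ltn_mod. Qed.

Lemma telescope (T : Type) (f : nat -> T) a b : (a <= b)%N ->
  (forall i, (a < i <= b)%N -> f i = f i.-1) -> forall i, (a <= i <= b)%N -> f i = f a.
Proof.
move=> ab h; elim=> [|i IH]; first by case: a {ab h}.
have [-> //|ai] := eqVneq a i.+1.
by move=> ib; rewrite h ?IH //; move/eqP: ai ib; lia.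
Qed.

(* In the notation of the paper, with [Z = z d^q] and [E = Z x_1 ... x_r],
   both sides of (2) are equal to [E] and both sides of (3) to [E y]. *)
Lemma braid_satP : let E := Z * P r in braid_sat <->
  [/\ z * dl = dl * z,
      forall i, (i <= n - r)%N -> (P i)^-1 * Z * P (i + r) = E &
      forall i, (n - r <= i <= n)%N -> (P i)^-1 * Z * dl * P (i + r - n) = E * y].
Proof.
move=> E; have side2 i j : (i <= n)%N -> z * dl = dl * z ->
    xprod x i.+1 n * y * z * expgz dl (q%:Z - 1)%R * P j = (P i)^-1 * Z * P j.
  by move=> i_n cz; rewrite expgz_pred xprod_tail // -(mulgA _ _ y); apply: side_eq2.
have side3 i j : (i <= n)%N -> z * dl = dl * z ->
    xprod x i.+1 n * y * z * dl ^+ q * P j = (P i)^-1 * Z * dl * P j.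
  by move=> i_n cz; rewrite xprod_tail // -(mulgA _ _ y); apply: side_eq3.
split=> [sat|[cz e2 e3] a b].
  have cz : z * dl = dl * z by rewrite /dl (sat _ _ (braid_rel1 n m x y z)) mulgA.
  have e2 i : (i <= n - r)%N -> (P i)^-1 * Z * P (i + r) = E.
    move=> ir; pose f i := (P i)^-1 * Z * P (i + r).
    have -> : E = f 0%N by rewrite /f xprod0 invg1 mul1g.
    apply: (@telescope _ f 0 (n - r)) => //; case=> // j /andP[_ jr].
    have := sat _ _ (braid_rel2 (i := j.+1) x y z _); rewrite -/q -/r -/dl.
    move=> /(_ jr); rewrite side2 //; last by lia.
    by rewrite side2 //; last lia; rewrite addSn subn1.
  split=> // i ir; pose f i := (P i)^-1 * Z * dl * P (i + r - n).
  have -> : E * y = f (n - r)%N.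
    rewrite /f (_ : n - r + r - n = 0)%N ?xprod0 ?mulg1; last by lia.
    by rewrite -(e2 (n - r)%N) // subnK ?(ltnW rn) // -mulgA.
  apply: (@telescope _ f (n - r) n) => //; first by lia.
  case=> // j /andP[jr jn].
  have := sat _ _ (braid_rel3 (i := j.+1) x y z _); rewrite -/q -/r -/dl.
  have jr' : (n - r + 1 <= j.+1 <= n)%N by lia.
  move=> /(_ jr'); rewrite side3 // side3 ?(ltnW jn) // /f => ->.
  by congr (_ * P _); lia.
case=> [|{a b} i Q Q' d ir|{a b} i Q Q' d ir].
- by rewrite -/dl -cz mulgA.
- case: i ir => [|i ir]; first by lia.
  rewrite side2 // ?side2 //; try by rewrite /Q' in ir; lia.
  rewrite e2 ?addSn ?subn1 /= ?e2 //; rewrite /Q' -/r in ir *; lia.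
- case: i ir => [|i ir]; first by lia.
  rewrite side3 // ?side3 //; try by rewrite /Q' in ir; lia.
  rewrite e3; last by rewrite /Q' -/r in ir; lia.
  have -> : (i.+1 + Q' - n - 1 = i + r - n)%N by rewrite /Q' -/r; lia.
  by rewrite e3 //; rewrite /Q' -/r in ir *; lia.
Qed.

End XProd.

(** * Solving the relations by commuting monomials *)

Section Monomials.
Variable G : groupType.
Implicit Types a d : G.

Definition mon a d (i j : int) := expgz a i * expgz d j.

Lemma monM a d i j k l : commute a d ->
  mon a d i j * mon a d k l = mon a d (i + k)%R (j + l)%R.
Proof.
move=> c; rewrite /mon !expgzD !mulgA; congr (_ * _).
by rewrite -!mulgA; congr (_ * _); apply/commute_sym/commute_expgz2.
Qed.

Lemma monX a d i j k : commute a d ->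
  expgz (mon a d i j) k = mon a d (i * k)%R (j * k)%R.
Proof.
by move=> c; rewrite /mon expgzMc ?expgzM //; apply: commute_expgz2.
Qed.

Lemma mon_comm a d b i j : commute b a -> commute b d -> commute b (mon a d i j).
Proof. by move=> ba bd; apply: commuteM; apply: commute_expgz. Qed.

End Monomials.

Section Model.
Variables (G : groupType) (n m : nat) (al be : int) (t a d : G).
Hypothesis n_gt0 : (0 < n)%N.
Hypothesis bezout : (al * m%:Z + be * n%:Z = 1)%R.
Hypotheses (td : commute t d) (ad : commute a d).

(* [x], [y], [z] expressed through [t = bT], [a = x 1 * bT] and [d = bD]. *)
Definition mod_x (l : nat) : G := t ^+ l.-1 * (a * t^-1) * t ^- l.-1.
Definition mod_y : G := mon t d n al.
Definition mod_z : G := mon a d (- m%:Z)%R be.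

Lemma mod_P i : xprod mod_x 1 i = a ^+ i * t ^- i.
Proof.
elim: i => [|i IH]; first by rewrite xprod0 mul1g invg1.
by rewrite xprodS IH /mod_x /= !mulgA mulgVK [a ^+ i.+1]expgSr [t ^+ i.+1]expgSr invgM !mulgA.
Qed.

Lemma mod_dl : xprod mod_x 1 n * mod_y = mon a d n al.
Proof. by rewrite mod_P /mod_y /mon /= mulgA mulgVK. Qed.

Lemma mod_Z : mod_z * (xprod mod_x 1 n * mod_y) ^+ (m %/ n) =
  mon a d (- (m %% n)%N%:Z)%R (be + al * (m %/ n)%N%:Z)%R.
Proof.
rewrite mod_dl -expgz_nat monX // monM //; congr mon.
by rewrite {1}(divn_eq m n) PoszD PoszM; ring.
Qed.

Lemma mod_PV i : (xprod mod_x 1 i)^-1 = t ^+ i * a ^- i.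
Proof. by rewrite mod_P invgM invgK. Qed.

Lemma mod_side (A D : int) i j : (A - i%:Z + j%:Z = 0)%R ->
  (xprod mod_x 1 i)^-1 * mon a d A D * xprod mod_x 1 j = mon t d (i%:Z - j%:Z)%R D.
Proof.
move=> h; rewrite mod_PV mod_P /mon.
have -> : a ^- i = expgz a (- i%:Z)%R by rewrite expgzN.
have -> : t ^- j = expgz t (- j%:Z)%R by rewrite expgzN.
rewrite expgzD -!expgz_nat -!mulgA; congr (_ * _).
rewrite !mulgA -expgzD -(mulgA _ (expgz d D)).
have -> : expgz d D * expgz a j%:Z = expgz a j%:Z * expgz d D.
  exact/commute_sym/commute_expgz2.
rewrite mulgA -expgzD (_ : (- i%:Z + A + j%:Z = 0)%R) ?mul1g; last by rewrite -h; ring.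
exact/commute_sym/commute_expgz2.
Qed.

(** Products of the [mod_x] telescope, so in each relation the powers of [a] cancel and both sides
    reduce to the same monomial in [t] and [d]. *)
Lemma mod_sat : braid_sat mod_x n m mod_y mod_z.
Proof.
have P0 : xprod mod_x 1 0 = 1 by rewrite xprod0.
set q := m %/ n; set r := m %% n.
have rn : (r < n)%N by rewrite ltn_mod.
have EE : mod_z * (xprod mod_x 1 n * mod_y) ^+ q * xprod mod_x 1 r =
    mon t d (- r%:Z)%R (be + al * q%:Z)%R.
  rewrite mod_Z; have := @mod_side (- r%:Z)%R (be + al * q%:Z)%R 0 r.
  by rewrite P0 invg1 mul1g => ->; [congr mon|]; lia.
apply/braid_satP => //; rewrite -/q -/r EE mod_Z; split.
- by rewrite mod_dl !monM //; congr mon; lia.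
- by move=> i ir; rewrite mod_side; [congr mon|]; lia.
- move=> i /andP[ri iN]; rewrite mod_dl -(mulgA _ _ (mon _ _ _ _)) !monM // mod_side; last by lia.
  by congr mon; lia.
Qed.

End Model.

Section Analysis.
Variables (G : groupType) (n m : nat) (al be : int) (x : nat -> G) (y z : G).
Hypothesis n_gt0 : (0 < n)%N.
Hypothesis bezout : (al * m%:Z + be * n%:Z = 1)%R.
Hypothesis sat : braid_sat x n m y z.
Local Notation q := (m %/ n).
Local Notation r := (m %% n).
Local Notation P i := (xprod x 1 i).

(* Conjugation by [bA] (resp. [y]) shifts by [m] (resp. [- n]) the sequence [bX]
   that extends [x] to all integers. Hence [bT] shifts it by [-1], and [bD] is
   central. *)
Definition bE : G := z * (P n * y) ^+ q * P r.
Definition bA : G := bE * y ^- q.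
Definition bT : G := mon bA y (- al)%R be.
Definition bD : G := mon bA y n m.
Definition brho : G := x 1 * bT.

Let rn : (r < n)%N. Proof. by rewrite ltn_mod. Qed.

Let satE := (braid_satP x m y z n_gt0).1 sat.

(** This is the third family of [braid_satP] at [i = n], because [(P n)^-1 * (P n * y) = y]. *)
Lemma yE_comm : y * bE = bE * y.
Proof.
have [cz e2 e3] := satE.
have := e3 n; rewrite leqnn andbT leq_subr => /(_ isT).
rewrite (_ : n + r - n = r)%N; last by lia.
rewrite -/bE => <-; rewrite /bE.
have [D DE] : exists D, D = P n * y by eexists.
rewrite -DE in cz *; have -> : y = (P n)^-1 * D by rewrite DE mulKg.
rewrite -!mulgA; congr (_ * _); rewrite !mulgA; congr (_ * _).
by rewrite -cz -!mulgA; congr (_ * _); rewrite -expgS expgSr.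
Qed.

(** Obtained by dividing two consecutive relations of the second family; [xE_high] does the same
    with the third, where an index beyond [n] wraps around at the cost of a conjugation by
    [y^-1]. *)
Lemma xE_low l : (0 < l <= n - r)%N -> x l ^ bE = x (l + r).
Proof.
have [cz e2 e3] := satE; case: l => // l /andP[_ lr].
have := e2 l.+1 lr; rewrite -/bE addSn !xprodS => h1.
have := e2 l (ltnW lr); rewrite -/bE => h0.
rewrite conjgE; apply: (@mulgI _ bE); rewrite mulVKg.
rewrite -{1}h1 -h0 invgM !mulgA mulgV mul1g.
by rewrite -!mulgA.
Qed.

Lemma xE_high l : (n - r < l <= n)%N -> x l ^ bE = x (l + r - n) ^ y^-1.
Proof.
have [cz e2 e3] := satE; case: l => [|l] /andP[lr ln]; first by lia.
have := e3 l.+1; rewrite ln andbT -/bE => /(_ (ltnW lr)).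
have -> : (l.+1 + r - n = (l + r - n).+1)%N by lia.
rewrite !xprodS => h1.
have := e3 l; rewrite -/bE => h0; have {}h0 := h0 _.
have {}h0 : (P l)^-1 * (z * (P n * y) ^+ q) * (P n * y) * P (l + r - n) = bE * y.
  by apply: h0; lia.
apply: (@conjg_inj _ y); rewrite -!conjgM mulVg conjg1.
rewrite conjgE; apply: (@mulgI _ (bE * y)); rewrite mulVKg.
rewrite -{1}h1 -h0 invgM !mulgA mulgV mul1g.
by rewrite -!mulgA.
Qed.

Definition bX (j : int) : G :=
  x `|(j %% n)%Z|.+1 ^ expgz y (- (j %/ n)%Z)%R.

Definition shifts g (k : int) := forall j, bX j ^ g = bX (j + k)%R.

Lemma shiftsM g h k l : shifts g k -> shifts h l -> shifts (g * h) (k + l)%R.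
Proof. by move=> sg sh j; rewrite conjgM sg sh GRing.addrA. Qed.

Lemma shiftsV g k : shifts g k -> shifts g^-1 (- k)%R.
Proof.
move=> sg j; apply: (@conjg_inj _ g); rewrite -conjgM mulVg conjg1 sg.
by rewrite GRing.subrK.
Qed.

Lemma shifts1 : shifts 1 0%R.
Proof. by move=> j; rewrite conjg1 GRing.addr0. Qed.

Lemma shiftsX g k (i : int) : shifts g k -> shifts (expgz g i) (k * i)%R.
Proof.
move=> sg; have sn (a : nat) : shifts (g ^+ a) (k * a%:Z)%R.
  elim: a => [|a IH]; first by rewrite GRing.mulr0; apply: shifts1.
  have -> : (k * a.+1%:Z = k + k * a%:Z)%R by lia.
  by rewrite expgS; apply: shiftsM.
case: i => a; first exact: sn.
by rewrite NegzE GRing.mulrN; apply: shiftsV.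
Qed.

Lemma shifts_mon a d i j k l : shifts a k -> shifts d l ->
  shifts (mon a d i j) (k * i + l * j)%R.
Proof. by move=> sa sd; apply: shiftsM; apply: shiftsX. Qed.

Let nz : (n%:Z != 0)%R. Proof. by rewrite eqz_nat -lt0n. Qed.

Lemma bXE (a : int) (l : nat) : (l < n)%N ->
  bX (a * n%:Z + l%:Z)%R = x l.+1 ^ expgz y (- a)%R.
Proof.
move=> ln; have l0 : (l%:Z %/ n%:Z)%Z = 0%R.
  by apply: divz_small; rewrite /= ltz_nat ln.
rewrite /bX divzMDl // modzMDl l0 GRing.addr0; congr (x _.+1 ^ _).
by rewrite modz_small //= ltz_nat.
Qed.

Lemma bX_split (j : int) : exists a l, (l < n)%N /\ j = (a * n%:Z + l%:Z)%R.
Proof.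
exists (j %/ n)%Z, `|(j %% n)%Z|%N; split.
  by rewrite -ltz_nat gez0_abs ?modz_ge0 ?ltz_pmod.
by rewrite gez0_abs ?modz_ge0 // -divz_eq.
Qed.

Lemma shifts_y : shifts y (- n%:Z)%R.
Proof.
move=> j; have [a [l [ln ->]]] := bX_split j.
have -> : (a * n%:Z + l%:Z - n%:Z = (a - 1) * n%:Z + l%:Z)%R by ring.
rewrite !bXE // -conjgM; congr (_ ^ _); rewrite -{2}(expgz1 y) -expgzD.
by congr expgz; ring.
Qed.

Lemma shifts_E : shifts bE r.
Proof.
move=> j; have [a [l [ln ->]]] := bX_split j.
have c : expgz y (- a)%R * bE = bE * expgz y (- a)%R.
  exact/commute_sym/commute_expgz/commute_sym/yE_comm.
rewrite bXE // -conjgM c conjgM; have [lr|lr] := leqP l.+1 (n - r).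
  have -> : (a * n%:Z + l%:Z + r%:Z = a * n%:Z + (l + r)%N%:Z)%R by lia.
  by rewrite xE_low ?addSn ?bXE //; lia.
have -> : (a * n%:Z + l%:Z + r%:Z = (a + 1) * n%:Z + (l + r - n)%N%:Z)%R by lia.
rewrite xE_high ?lr // bXE; last by lia.
rewrite -conjgM -{1}(expgz1 y) -expgzN -expgzD; congr (x _ ^ expgz y _); lia.
Qed.

Lemma yA_comm : commute bA y.
Proof.
apply: commute_sym; apply: commuteM; first exact: yE_comm.
exact/commuteV/commuteX/commute_refl.
Qed.

Lemma bA_E : bE = mon bA y 1 q.
Proof. by rewrite /mon /bA mulgVK. Qed.

Lemma shifts_A : shifts bA m.
Proof.
have -> : (m%:Z = r%:Z + (- (- n%:Z * q%:Z)))%R by rewrite {1}(divn_eq m n); lia.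
apply: shiftsM; first exact: shifts_E.
by apply: shiftsV; apply: (shiftsX q); apply: shifts_y.
Qed.

Lemma shifts_T : shifts bT (- 1%:Z)%R.
Proof.
have -> : (- 1%:Z = m%:Z * - al + - n%:Z * be)%R by rewrite -[Posz 1]/(GRing.one int) -bezout; ring.
exact: shifts_mon shifts_A shifts_y.
Qed.

Lemma shifts_D : shifts bD 0%R.
Proof.
have -> : (0 = m%:Z * n%:Z + - n%:Z * m%:Z)%R by ring.
exact: shifts_mon shifts_A shifts_y.
Qed.

Lemma bX_x l : (0 < l <= n)%N -> bX (Posz l.-1) = x l.
Proof.
case: l => // l /= ln; have := bXE 0 ln.
by rewrite GRing.mul0r GRing.add0r GRing.oppr0 => ->; rewrite conjg1.
Qed.

Lemma x_brho l : (0 < l <= n)%N -> x l = mod_x bT brho l.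
Proof.
move=> /andP[l0 ln]; rewrite /mod_x /brho mulgK -(bX_x (l := l)) ?l0 //.
rewrite -(bX_x (l := 1)) //=.
have := shiftsX (- l.-1%:Z)%R shifts_T 0%R.
rewrite GRing.add0r GRing.mulrNN GRing.mul1r => <-.
by rewrite expgzN expgz_nat conjgE invgK mulgA.
Qed.

Lemma bP i : (i <= n)%N -> P i = brho ^+ i * bT ^- i.
Proof.
move=> i_n; rewrite -(mod_P bT brho i); apply: xprod_ext => l /andP[l0 li].
by apply: x_brho; rewrite l0 (leq_trans li).
Qed.

Lemma D_commute_x l : (0 < l <= n)%N -> commute bD (x l).
Proof.
move=> ln; have := shifts_D (Posz l.-1); rewrite GRing.addr0 bX_x // => h.
by rewrite /commute -{1}h conjgE mulVKg.
Qed.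

Lemma D_commute_y : commute bD y.
Proof. exact/commute_sym/mon_comm/commute_refl/commute_sym/yA_comm. Qed.

Lemma D_commute_A : commute bD bA.
Proof. exact/commute_sym/mon_comm/yA_comm/commute_refl. Qed.

Lemma D_commute_T : commute bD bT.
Proof. exact: mon_comm D_commute_A D_commute_y. Qed.

Lemma D_commute_rho : commute bD brho.
Proof. by apply: commuteM D_commute_T; apply: D_commute_x. Qed.

Let TD : commute bT bD := commute_sym D_commute_T.
Let RD : commute brho bD := commute_sym D_commute_rho.

(** The exponents of [bT] and [bD] in terms of [bA] and [y] form a matrix of determinant -1 by the
    Bezout relation, so [y] and [bE] are in turn monomials in [bT] and [bD]. *)
Lemma monTD i j : mon bT bD i j = mon bA y (- al * i + n%:Z * j)%R (be * i + m%:Z * j)%R.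
Proof.
rewrite /mon; move: (yA_comm) => c; rewrite -/(mon _ _ _ _) -/(mon bA y n m).
have -> : mon bT bD i j = expgz bT i * expgz bD j by [].
by rewrite /bT /bD !monX // monM //.
Qed.

Lemma y_model : y = mod_y n al bT bD.
Proof.
rewrite /mod_y monTD (_ : (- al * n%:Z + n%:Z * al = 0)%R); last by ring.
rewrite (_ : (be * n%:Z + m%:Z * al = 1)%R); last by rewrite -bezout; ring.
by rewrite /mon mul1g.
Qed.

Lemma dl_model : P n * y = mon brho bD n al.
Proof. by rewrite bP // [X in _ * X = _]y_model /mod_y /mon mulgA mulgVK. Qed.

Lemma E_model : bE = mon bT bD (- r%:Z)%R (be + al * q%:Z)%R.
Proof.
have mE : (m%:Z = q%:Z * n%:Z + r%:Z)%R by rewrite {1}(divn_eq m n) PoszD PoszM.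
have e1 (M Q Rr : int) : (M = Q * n%:Z + Rr -> al * M + be * n%:Z = 1 ->
    1 = - al * - Rr + n%:Z * (be + al * Q))%R by move=> -> <-; ring.
have e2 (M Q Rr : int) : (M = Q * n%:Z + Rr -> al * M + be * n%:Z = 1 ->
    Q = be * - Rr + M * (be + al * Q))%R.
  move=> ME b; transitivity (Q * (al * M + be * n%:Z))%R.
    by rewrite b GRing.mulr1.
  by rewrite ME; ring.
by rewrite bA_E monTD; congr mon; [apply: e1 mE bezout|apply: e2 mE bezout].
Qed.

Lemma z_model : z = mod_z m be brho bD.
Proof.
apply: (@mulIg _ ((P n * y) ^+ q * P r)); rewrite mulgA -/bE E_model.
have -> : P n * y = xprod (mod_x bT brho) 1 n * mod_y n al bT bD.
  by rewrite -y_model mod_P bP.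
have -> : P r = xprod (mod_x bT brho) 1 r by rewrite mod_P bP // ltnW.
rewrite mulgA mod_Z //; symmetry.
have := @mod_side _ bT brho bD TD RD (- r%:Z)%R (be + al * q%:Z)%R 0 r.
rewrite xprod0 invg1 mul1g => ->; last by lia.
by congr mon; lia.
Qed.

Lemma rho_pow_m : z = 1 -> brho ^+ m = expgz bD be.
Proof.
move=> z1; have := z_model; rewrite z1 /mod_z /mon expgzN expgz_nat => h.
by rewrite -[LHS]mulg1 h mulVKg.
Qed.

Lemma dl_pow_m : z = 1 -> (P n * y) ^+ m = bD.
Proof.
move=> z1; rewrite dl_model -expgz_nat monX // /mon.
rewrite -[RHS]expgz1 -bezout GRing.addrC expgzD; congr (_ * _).
by rewrite [RHS]expgzM -rho_pow_m // GRing.mulrC expgzM.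
Qed.

Lemma rho_dl : z = 1 -> expgz (P n * y) be = brho.
Proof.
move=> z1; rewrite dl_model monX //.
have -> : (n%:Z * be = 1 + m%:Z * - al)%R by rewrite -bezout; ring.
rewrite /mon expgzD expgz1 (expgzM _ m) expgz_nat rho_pow_m // -expgzM -mulgA -expgzD.
by rewrite (_ : (be * - al + al * be = 0)%R) ?mulg1 //; ring.
Qed.

Lemma A_pow_n : y = 1 -> bA ^+ n = bD.
Proof. by move=> y1; rewrite /bD /mon y1 expgz1n mulg1. Qed.

Lemma T_A : y = 1 -> bT = expgz bA (- al)%R.
Proof. by move=> y1; rewrite /bT /mon y1 expgz1n mulg1. Qed.

End Analysis.

(** * Torus knot groups *)

(* [p = 0] or [q = 0] stands for the absence of the corresponding relation. *)
Variant torus_rel (G : groupType) (p q : nat) (x : 'I_3 -> G) : G -> G -> Prop :=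
| torus_dv : torus_rel p q x (x i2 * x i0) (x i0 * x i2)
| torus_dw : torus_rel p q x (x i2 * x i1) (x i1 * x i2)
| torus_vp : p <> 0%N -> torus_rel p q x (x i0 ^+ p) (x i2)
| torus_wq : q <> 0%N -> torus_rel p q x (x i1 ^+ q) (x i2).

Section Torus.
Variables p q : nat.

Definition torus : groupType := presented 'I_3 (torus_rel p q (fun i => gen i)).
Definition tor (i : 'I_3) : torus := pgen _ i.

Lemma tor_dv : commute (tor i2) (tor i0).
Proof. by have := presented_rel (torus_dv p q (fun i => gen i)); rewrite !quot_projM. Qed.
Lemma tor_dw : commute (tor i2) (tor i1).
Proof. by have := presented_rel (torus_dw p q (fun i => gen i)); rewrite !quot_projM. Qed.
Lemma tor_vp : p <> 0%N -> tor i0 ^+ p = tor i2.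
Proof.
move=> p0; have := presented_rel (torus_vp q (fun i => gen i) p0).
by rewrite multiplicativeX.
Qed.
Lemma tor_wq : q <> 0%N -> tor i1 ^+ q = tor i2.
Proof.
move=> q0; have := presented_rel (torus_wq p (fun i => gen i) q0).
by rewrite multiplicativeX.
Qed.

Lemma torus_lift (H : groupType) (v w d : H) :
  commute d v -> commute d w -> (p <> 0%N -> v ^+ p = d) -> (q <> 0%N -> w ^+ q = d) ->
  exists F : {multiplicative torus -> H}, [/\ F (tor i0) = v, F (tor i1) = w & F (tor i2) = d].
Proof.
move=> dv dw vp wq; pose f (i : 'I_3) := if i == i0 then v else if i == i1 then w else d.
have [|F FE] := @presented_lift _ (torus_rel p q (fun i => gen i)) H f.
  by move=> a b []; rewrite ?gmulfM ?multiplicativeX !free_lift_gen.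
by exists F; split; rewrite FE.
Qed.

Lemma torus_ind (Q : torus -> Prop) : subgroup_pred Q ->
  Q (tor i0) -> Q (tor i1) -> Q (tor i2) -> forall g, Q g.
Proof. by move=> sQ Q0 Q1 Q2; apply: presented_ind => //; apply: I3_ind. Qed.

Lemma torus_homE (H : groupType) (f g : {multiplicative torus -> H}) :
  f (tor i0) = g (tor i0) -> f (tor i1) = g (tor i1) -> f (tor i2) = g (tor i2) -> f =1 g.
Proof. by move=> e0 e1 e2; apply: presented_homE; apply: I3_ind. Qed.

Lemma tor_d_center : center torus (tor i2).
Proof.
apply: torus_ind; [exact: commute_subgroup|exact: tor_dv|exact: tor_dw|exact: commute_refl].
Qed.

(** Killing the central [tor i2] leaves the free product of [Z/p] and [Z/q], with [Z] for an
    exponent 0. This is the von Dyck group of the triple [(0, p, q)], where the unconstrained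
    generator is determined by the other two. *)
Lemma torus_center_sub : p != 1%N -> q != 1%N -> ~~ ((p == 2) && (q == 2)) ->
  (forall N, (forall i, N i != 1%N) -> (forall i j, i != j -> N i = 2%N -> N j <> 2%N) ->
    forall g, center (vonDyck N) g -> g = 1) ->
  forall g, center torus g -> exists k : int, g = expgz (tor i2) k.
Proof.
move=> p1 q1 pq vdc g cg.
pose N (i : 'I_3) := if i == i0 then 0%N else if i == i1 then p else q.
have [||||F [F0 F1 F2]] := @torus_lift (vonDyck N) (vx N i1) (vx N i2)^-1 1.
- exact/commute_sym/commute1.
- exact/commute_sym/commute1.
- by move=> _; exact: (vx_pow N i1).
- by move=> _; rewrite expVgn (vx_pow N i2) invg1.
pose Q := quot [set tor i2]%classic.
pose pr : {multiplicative torus -> Q} := @quot_proj _ [set tor i2]%classic.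
have pd : pr (tor i2) = 1 by apply: quot_proj_eq1.
pose f (i : 'I_3) : Q := if i == i0 then (pr (tor i0) * (pr (tor i1))^-1)^-1
  else if i == i1 then pr (tor i0) else (pr (tor i1))^-1.
have e0 (a : Q) k : k = 0%N -> a ^+ k = 1 by move=> ->.
have [||K KE] := @vonDyck_lift N Q f.
- apply: I3_ind => //; rewrite /f /N /=.
    have [/(e0 _ _) //|/eqP p0] := eqVneq p 0%N.
    by rewrite -multiplicativeX tor_vp.
  have [/(e0 _ _) //|/eqP q0] := eqVneq q 0%N.
  by rewrite expVgn -multiplicativeX tor_wq // pd invg1.
- by rewrite /f /= -mulgA mulVg.
have KF : pr =1 K \o F.
  by apply: (@torus_homE _ pr (K \o F : {multiplicative _ -> _})) => /=;
    rewrite ?F0 ?F1 ?F2 ?multiplicativeV ?KE ?multiplicative1 // /f /= invgK.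
have Fs : forall t, exists h, t = F h.
  apply: vx_ind; first exact: subgroup_image.
  apply: I3_ind.
  - exists (tor i0 * (tor i1)^-1)^-1; rewrite !(multiplicativeV, gmulfM) F0 F1 invgK.
    apply: (@mulIg _ (vx N i1 * vx N i2)); rewrite mulVg mulgA; exact: vx_prod012.
  - by exists (tor i0).
  - by exists (tor i1)^-1; rewrite multiplicativeV F1 invgK.
have Fg : F g = 1.
  apply: (vdc N) => [i|i j|t].
  - by rewrite /N; case: ifP => // _; case: ifP.
  - move: pq; rewrite /N; elim/I3_ind: i; elim/I3_ind: j => //= pq _ E2.
      by move=> E3; rewrite E2 E3 in pq.
    by move=> E3; rewrite E2 E3 in pq.
  - by have [h ->] := Fs t; rewrite /commute -!gmulfM cg.
apply: (central_normal_closure tor_d_center).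
apply: quot_proj_eq1P; have := KF g; rewrite /= Fg multiplicative1; exact.
Qed.

End Torus.

Lemma torus_swap p q : isomorphic (torus p q) (torus q p).
Proof.
have sw a b : exists F : {multiplicative torus a b -> torus b a},
    [/\ F (tor a b i0) = tor b a i1, F (tor a b i1) = tor b a i0 & F (tor a b i2) = tor b a i2].
  by apply: torus_lift; [apply: tor_dw|apply: tor_dv|apply: tor_wq|apply: tor_vp].
have [F [F0 F1 F2]] := sw p q; have [K [K0 K1 K2]] := sw q p.
exists F; exists K => g.
  apply: (@torus_homE _ _ _ (K \o F : {multiplicative _ -> _}) (idfun : {multiplicative _ -> _})) => /=;
  by rewrite ?F0 ?F1 ?F2.
apply: (@torus_homE _ _ _ (F \o K : {multiplicative _ -> _}) (idfun : {multiplicative _ -> _})) => /=;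
by rewrite ?K0 ?K1 ?K2.
Qed.

(** * Braid groups as torus knot groups *)

Lemma braid_sat_image (G H : groupType) (f : {multiplicative G -> H}) n m x y z :
  (forall a b, braid_rel n m x y z a b -> f a = f b) ->
  braid_sat (fun l => f (x l)) n m (f y) (f z).
Proof.
move=> fR a b; case=> [|i qq rr d hi|i qq rr d hi].
- by have := fR _ _ (braid_rel1 _ _ _ _ _); rewrite !gmulfM !multiplicative_xprod.
- have := fR _ _ (braid_rel2 _ _ _ hi).
  by rewrite !gmulfM multiplicative_expgz !gmulfM !multiplicative_xprod.
- have := fR _ _ (braid_rel3 _ _ _ hi).
  by rewrite !gmulfM multiplicativeX !gmulfM !multiplicative_xprod.
Qed.

Section BraidPresentation.
Variables (n m : nat) (yp zp : bool).
Hypothesis n_gt0 : (0 < n)%N.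
Local Notation B := (braid n m yp zp).

Definition bx (l : nat) : B := braid_proj n m yp zp (braid_x_elt n m l).
Definition by_ : B := braid_proj n m yp zp (braid_y_elt n m).
Definition bz : B := braid_proj n m yp zp (braid_z_elt n m).

Lemma braid_sat_gens : braid_sat bx n m by_ bz.
Proof.
apply: (@braid_sat_image _ _ (braid_proj n m yp zp)) => a b ab; congr (braid_proj n m yp zp _).
pose pr : {multiplicative Defs.free (braid_gen n) -> braid_yz n m} :=
  @quot_proj _ (relators (braid_rel n m (@free_x n) (gen By) (gen Bz))).
by apply: (@braid_sat_image _ _ pr) ab => u v; exact: presented_rel.
Qed.

Lemma by_eq1 : ~~ yp -> by_ = 1.
Proof.
rewrite /by_; case: yp zp => -[] //= _; apply: quot_proj_eq1 => //.
by left.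
Qed.

Lemma bz_eq1 : ~~ zp -> bz = 1.
Proof.
rewrite /bz; case: yp zp => -[] //= _; apply: quot_proj_eq1 => //.
by right.
Qed.

Lemma braid_proj_surj (g : B) : exists h, g = braid_proj n m yp zp h.
Proof.
move: g; case: yp zp => -[] /= g; [by exists g|exact: quot_proj_surj..].
Qed.

Lemma braid_ind (Q : B -> Prop) : subgroup_pred Q ->
  (forall l, (0 < l <= n)%N -> Q (bx l)) -> Q by_ -> Q bz -> forall g, Q g.
Proof.
move=> sQ Qx Qy Qz g; have [h ->] := braid_proj_surj g.
elim/presented_ind: h; first exact: (subgroup_preim _ sQ).
case=> [i||] //; have := Qx i.+1; rewrite ltn_ord => /(_ isT).
by rewrite /bx /braid_x_elt /free_x /= valK.
Qed.

Lemma braid_homE (H : groupType) (f g : {multiplicative B -> H}) :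
  (forall l, (0 < l <= n)%N -> f (bx l) = g (bx l)) -> f by_ = g by_ -> f bz = g bz -> f =1 g.
Proof. by move=> ex ey ez; apply: braid_ind => //; apply: subgroup_eq. Qed.

Lemma braid_lift (H : groupType) (x : nat -> H) (y z : H) :
  braid_sat x n m y z -> (~~ yp -> y = 1) -> (~~ zp -> z = 1) ->
  exists F : {multiplicative B -> H},
    [/\ forall l, (0 < l <= n)%N -> F (bx l) = x l, F by_ = y & F bz = z].
Proof.
move=> sat y1 z1.
pose f (g : braid_gen n) : H := match g with Bx i => x i.+1 | By => y | Bz => z end.
have fx l : (1 <= l <= n)%N -> free_lift f (free_x n l) = x l.
  case: l => // l /andP[_ ln]; rewrite /free_x /=; case: insubP => [i _ iE|].
    by rewrite free_lift_gen /= iE.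
  by rewrite ln.
have [|F0 F0E] := @presented_lift _ (braid_rel n m (@free_x n) (gen By) (gen Bz)) H f.
  move=> a b /(braid_rel_morph (free_lift f)) /(braid_rel_ext n_gt0 fx).
  by rewrite !free_lift_gen => /sat.
have F0x l : (0 < l <= n)%N -> F0 (braid_x_elt n m l) = x l.
  case: l => // l /andP[_ ln]; rewrite /braid_x_elt /free_x /=; case: insubP => [i _ iE|].
    by have /= := F0E (Bx i); rewrite iE.
  by rewrite ln.
have F0y : F0 (braid_y_elt n m) = y := F0E By.
have F0z : F0 (braid_z_elt n m) = z := F0E Bz.
suff [F FE] : exists F : {multiplicative B -> H},
    forall g, F (braid_proj n m yp zp g) = F0 g.
  by exists F; split=> [l ln||]; rewrite FE ?F0x.
case: yp zp y1 z1 => -[] /= y1 z1; first by exists F0.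
- have h g : [set braid_z_elt n m]%classic g -> F0 g = 1 by move=> ->; rewrite F0z z1.
  by exists (quot_lift h) => g; apply: (quot_lift_proj h).
- have h g : [set braid_y_elt n m]%classic g -> F0 g = 1 by move=> ->; rewrite F0y y1.
  by exists (quot_lift h) => g; apply: (quot_lift_proj h).
- have h g : [set braid_y_elt n m; braid_z_elt n m]%classic g -> F0 g = 1.
    by case=> ->; rewrite ?F0y ?F0z ?y1 ?z1.
  by exists (quot_lift h) => g; apply: (quot_lift_proj h).
Qed.

End BraidPresentation.

Lemma bezout_coprime n m : coprime n m ->
  exists al be : int, (al * m%:Z + be * n%:Z = 1)%R.
Proof.
move=> cnm; have [u [v uv]] := Bezoutz m n.
by exists u, v; rewrite uv /gcdz /= gcdnC (eqP cnm).
Qed.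

Section Transport.
Variables (G H : groupType) (f : {multiplicative G -> H}).
Lemma mult_mon a d i j : f (mon a d i j) = mon (f a) (f d) i j.
Proof. by rewrite /mon gmulfM !multiplicative_expgz. Qed.

Lemma mult_bD n m x y z : f (bD n m x y z) = bD n m (fun l => f (x l)) (f y) (f z).
Proof.
by rewrite /bD mult_mon /bA /bE !gmulfM multiplicativeV !multiplicativeX gmulfM !multiplicative_xprod.
Qed.

Lemma mult_bA n m x y z : f (bA n m x y z) = bA n m (fun l => f (x l)) (f y) (f z).
Proof.
by rewrite /bA /bE !gmulfM multiplicativeV !multiplicativeX gmulfM !multiplicative_xprod.
Qed.
End Transport.

Section Ext.
Variables (G : groupType) (n m : nat) (x x' : nat -> G) (y z : G).
Hypothesis n_gt0 : (0 < n)%N.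
Hypothesis xx : forall l, (0 < l <= n)%N -> x l = x' l.
Lemma bA_ext : bA n m x y z = bA n m x' y z.
Proof.
have P i : (i <= n)%N -> xprod x 1 i = xprod x' 1 i.
  by move=> i_n; apply: xprod_ext => l /andP[l0 li]; rewrite xx // l0 (leq_trans li).
by rewrite /bA /bE !P // ltnW // ltn_mod.
Qed.
Lemma bD_ext : bD n m x y z = bD n m x' y z.
Proof. by rewrite /bD bA_ext. Qed.
End Ext.

Section ModelValues.
Variables (G : groupType) (n m : nat) (al be : int) (t a d : G).
Hypothesis n_gt0 : (0 < n)%N.
Hypothesis bezout : (al * m%:Z + be * n%:Z = 1)%R.
Hypotheses (td : commute t d) (ad : commute a d).
Local Notation mx := (mod_x t a).
Local Notation my := (mod_y n al t d).
Local Notation mz := (mod_z m be a d).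

Lemma mod_bA : bA n m mx my mz = mon t d (- m%:Z)%R be.
Proof.
rewrite /bA /bE mod_Z // (_ : my ^- (m %/ n) = expgz my (- (m %/ n)%:Z)%R); last first.
  by rewrite expgzN.
have := @mod_side _ t a d td ad (- (m %% n)%:Z)%R (be + al * (m %/ n)%:Z)%R 0 (m %% n).
rewrite xprod0 invg1 mul1g => ->; last by lia.
rewrite /mod_y monX // monM //.
have mE : (m%:Z = (m %/ n)%:Z * n%:Z + (m %% n)%:Z)%R by rewrite {1}(divn_eq m n) PoszD PoszM.
congr mon; last by ring.
by rewrite [in RHS]mE; ring.
Qed.

Lemma mod_bD : bD n m mx my mz = d.
Proof.
rewrite /bD mod_bA {1}/mon !monX // monM //.
rewrite (_ : (- m%:Z * n%:Z + n%:Z * m%:Z = 0)%R); last by ring.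
rewrite (_ : (be * n%:Z + al * m%:Z = 1)%R); last by rewrite -bezout; ring.
by rewrite /mon mul1g.
Qed.

Lemma mod_bT : bT n m al be mx my mz = t.
Proof.
rewrite /bT mod_bA {1}/mon !monX // monM //.
rewrite (_ : (- m%:Z * - al + n%:Z * be = 1)%R); last by rewrite -bezout; ring.
rewrite (_ : (be * - al + al * be = 0)%R); last by ring.
by rewrite /mon mulg1.
Qed.

End ModelValues.

(** Splits one conditional without destructing [yp] or [zp], on which the types of the groups below
    depend. *)
Lemma if_ind (A : Type) (Q : A -> Prop) (b : bool) (u u' : A) :
  (b -> Q u) -> (~~ b -> Q u') -> Q (if b then u else u').
Proof. by case: b => [h _|_ h]; apply: h. Qed.

Section Iso.
Variables (n m : nat) (yp zp : bool).
Hypotheses (n_gt0 : (0 < n)%N) (m_gt0 : (0 < m)%N) (cnm : coprime n m).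
Variables p q : nat.
Hypotheses (pE : p = if yp then 0%N else n) (qE : q = if zp then 0%N else m).
Local Notation B := (braid n m yp zp).
Local Notation C := (torus p q).
Local Notation X := (bx n m yp zp).
Local Notation Y := (by_ n m yp zp).
Local Notation Z := (bz n m yp zp).

(* [tor i0] corresponds to [bT] if [y] is a generator and to [bA] otherwise,
   [tor i1] to [x_1 bT] if [z] is a generator and to [x_1 ... x_n y] otherwise. *)
Theorem braid_torus : exists (F : {multiplicative B -> C}),
  bijective F /\ F (bD n m X Y Z) = tor p q i2.
Proof.
have [al [be bez]] := bezout_coprime cnm.
pose v := tor p q i0; pose w := tor p q i1; pose d := tor p q i2.
have pn : ~~ yp -> p = n by rewrite pE; case: ifP.
have qm : ~~ zp -> q = m by rewrite qE; case: ifP.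
have dv : commute d v := tor_dv p q.
have dw : commute d w := tor_dw p q.
have vn : ~~ yp -> v ^+ n = d.
  by move=> y0; rewrite -(pn y0); apply: tor_vp; rewrite (pn y0); lia.
have wm : ~~ zp -> w ^+ m = d.
  by move=> z0; rewrite -(qm z0); apply: tor_wq; rewrite (qm z0); lia.
(* When [y] is absent, [bT] is the power [- al] of [bA]; when [z] is absent, [brho] is the power
   [be] of [x_1 ... x_n y]. This dictates the two exponents. *)
pose t := if yp then v else expgz v (- al)%R.
pose a := if zp then w else expgz w be.
have td : commute t d.
  by rewrite /t; case: ifP => _; apply: commute_sym; rewrite ?(commute_expgz) //; apply: commute_expgz.
have ad : commute a d.
  by rewrite /a; case: ifP => _; apply: commute_sym; rewrite ?(commute_expgz) //; apply: commute_expgz.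
have [||F [Fx Fy Fz]] := @braid_lift n m yp zp n_gt0 _ _ _ _ (mod_sat n_gt0 bez td ad).
- move=> y0; rewrite /mod_y /mon /t (ifN _ _ y0) -expgzM.
  rewrite (_ : (- al * n%:Z = n%:Z * - al)%R); last by ring.
  by rewrite expgzM expgz_nat vn // -expgzD GRing.addNr.
- move=> z0; rewrite /mod_z /mon /a (ifN _ _ z0) -expgzM.
  rewrite (_ : (be * - m%:Z = m%:Z * - be)%R); last by ring.
  by rewrite expgzM expgz_nat wm // -expgzD GRing.addNr.
have sat := @braid_sat_gens n m yp zp.
pose A := bA n m X Y Z; pose D := bD n m X Y Z.
pose T := bT n m al be X Y Z; pose rh := brho n m al be X Y Z.
pose dl := xprod X 1 n * Y.
have DT : commute D T := D_commute_T n_gt0 bez sat.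
have DR : commute D rh := D_commute_rho n_gt0 bez sat.
have DA : commute D A := D_commute_A n_gt0 bez sat.
have Y1 : ~~ yp -> Y = 1 := @by_eq1 n m yp zp.
have Z1 : ~~ zp -> Z = 1 := @bz_eq1 n m yp zp.
have Ddl : commute D dl.
  by rewrite /dl (dl_model n_gt0 bez sat); apply: mon_comm (commute_refl _).
have [||||K [K0 K1 K2]] := @torus_lift p q B (if yp then T else A) (if zp then rh else dl) D.
- exact: if_ind.
- exact: if_ind.
- move=> p0; have /orP[y1|/[dup] y0 /Y1 y1] := orbN yp; first by case: p0; rewrite pE y1.
  by rewrite (pn y0) (ifN _ _ y0); apply: A_pow_n.
- move=> q0; have /orP[z1|/[dup] z0 /Z1 z1] := orbN zp; first by case: q0; rewrite qE z1.
  by rewrite (qm z0) (ifN _ _ z0); apply: (dl_pow_m n_gt0 bez sat).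
have FbA : F A = mon t d (- m%:Z)%R be.
  rewrite /A mult_bA (bA_ext _ _ _ n_gt0 Fx) Fy Fz; exact: mod_bA.
have FD : F D = d.
  by rewrite /D mult_bD (bD_ext _ _ _ n_gt0 Fx) Fy Fz; apply: mod_bD.
have FT : F T = t.
  rewrite /T /bT mult_mon FbA Fy -(mod_bA n_gt0 bez td ad).
  exact: (mod_bT n_gt0 bez td ad).
have Frh : F rh = a.
  by rewrite /rh /brho gmulfM FT Fx ?n_gt0 // /mod_x /= mul1g invg1 mulg1 mulgVK.
have Fdl : F dl = mon a d n al.
  rewrite /dl gmulfM Fy multiplicative_xprod -(mod_dl n al t a d); congr (_ * _).
  by apply: xprod_ext => l; apply: Fx.
have Kt : K t = T.
  rewrite /t; apply: (@if_ind _ (fun u => K u = T)) => E; first by rewrite K0 (ifT _ _ E).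
  by rewrite multiplicative_expgz K0 (ifN _ _ E) /T T_A // Y1.
have Ka : K a = rh.
  rewrite /a; apply: (@if_ind _ (fun u => K u = rh)) => E; first by rewrite K1 (ifT _ _ E).
  by rewrite multiplicative_expgz K1 (ifN _ _ E) (rho_dl n_gt0 bez sat) // Z1.
exists F; split; last exact: FD.
exists K => g.
  apply: (@braid_homE n m yp zp _ (K \o F : {multiplicative _ -> _}) (idfun : {multiplicative _ -> _})) => /= [l ln||].
  - rewrite Fx // /mod_x !gmulfM !multiplicativeV !multiplicativeX Kt Ka.
    exact/esym/(x_brho n_gt0 bez sat ln).
  - rewrite Fy mult_mon Kt K2; exact/esym/(y_model n_gt0 bez sat).
  - rewrite Fz mult_mon Ka K2; exact/esym/(z_model n_gt0 bez sat).
apply: (@torus_homE p q _ (F \o K : {multiplicative _ -> _}) (idfun : {multiplicative _ -> _})) => /=.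
- rewrite K0; have /orP[E|E] := orbN yp; first by rewrite (ifT _ _ E) FT /t (ifT _ _ E).
  rewrite (ifN _ _ E) FbA /mon /t (ifN _ _ E) -/v -expgzM -(vn _) ?E // -expgz_nat -expgzM -expgzD.
  rewrite (_ : (- al * - m%:Z + n%:Z * be = 1)%R) //; rewrite -bez; ring.
- rewrite K1; have /orP[E|E] := orbN zp; first by rewrite (ifT _ _ E) Frh /a (ifT _ _ E).
  rewrite (ifN _ _ E) Fdl /mon /a (ifN _ _ E) -/w -expgzM -(wm _) ?E // -expgz_nat -expgzM -expgzD.
  rewrite (_ : (be * n%:Z + m%:Z * al = 1)%R) //; rewrite -bez; ring.
- by rewrite K2 FD.
Qed.

End Iso.

(** * The center of J(k,n,m) *)

Section JGroup.
Variables k n m : nat.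
Local Notation J := (J_group k n m).
Local Notation s := (J_s k n m).
Local Notation t := (J_t k n m).
Local Notation u := (J_u k n m).

Definition Jd : J := s * t * u.

Lemma J_sk : s ^+ k = 1.
Proof.
have := presented_rel (J_rel_s k n m (gen Js) (gen Jt) (gen Ju)).
by rewrite multiplicativeX multiplicative1.
Qed.
Lemma J_tn : t ^+ n = 1.
Proof.
have := presented_rel (J_rel_t k n m (gen Js) (gen Jt) (gen Ju)).
by rewrite multiplicativeX multiplicative1.
Qed.
Lemma J_um : u ^+ m = 1.
Proof.
have := presented_rel (J_rel_u k n m (gen Js) (gen Jt) (gen Ju)).
by rewrite multiplicativeX multiplicative1.
Qed.
Lemma J_stu : s * t * u = t * u * s.
Proof.
have := presented_rel (J_rel_stu k n m (gen Js) (gen Jt) (gen Ju)).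
by rewrite !quot_projM.
Qed.
Lemma J_tus : t * u * s = u * s * t.
Proof.
have := presented_rel (J_rel_tus k n m (gen Js) (gen Jt) (gen Ju)).
by rewrite !quot_projM.
Qed.

Lemma J_ind (Q : J -> Prop) : subgroup_pred Q -> Q s -> Q t -> Q u -> forall g, Q g.
Proof. by move=> sQ Qs Qt Qu; apply: presented_ind => //; case. Qed.

Lemma J_lift (H : groupType) (a b c : H) :
  a ^+ k = 1 -> b ^+ n = 1 -> c ^+ m = 1 -> a * b * c = b * c * a -> b * c * a = c * a * b ->
  exists F : {multiplicative J -> H}, [/\ F s = a, F t = b & F u = c].
Proof.
move=> ak bn cm e1 e2.
pose f (g : J_gen) := match g with Js => a | Jt => b | Ju => c end.
have [|F FE] := @presented_lift _ (J_rel k n m (gen Js) (gen Jt) (gen Ju)) H f.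
  by move=> g h []; rewrite ?gmulfM ?multiplicativeX ?multiplicative1 !free_lift_gen.
by exists F; split; [apply: (FE Js)|apply: (FE Jt)|apply: (FE Ju)].
Qed.

Lemma J_homE (H : groupType) (f g : {multiplicative J -> H}) :
  f s = g s -> f t = g t -> f u = g u -> f =1 g.
Proof. by move=> es et eu; apply: presented_homE; case. Qed.

Lemma Jd_center : center J Jd.
Proof.
apply: J_ind; first exact: commute_subgroup.
- by rewrite /commute [in RHS]/Jd J_stu /Jd !mulgA.
- by rewrite /commute [in RHS]/Jd J_stu J_tus /Jd J_stu !mulgA.
- by rewrite /commute /Jd {1}J_stu J_tus !mulgA.
Qed.

Definition vdN (i : 'I_3) : nat := if i == i0 then k else if i == i1 then n else m.

Lemma J_vd_ex : exists F : {multiplicative J -> vonDyck vdN},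
  [/\ F s = vx vdN i0, F t = vx vdN i1 & F u = vx vdN i2].
Proof.
have h0 := vx_prod vdN i0; have h1 := vx_prod vdN i1; have h2 := vx_prod vdN i2.
rewrite !ordS3 in h0 h1 h2.
apply: J_lift.
- exact: (vx_pow vdN i0).
- exact: (vx_pow vdN i1).
- exact: (vx_pow vdN i2).
- by rewrite h0 h1.
- by rewrite h1 h2.
Qed.

Definition J_vd : {multiplicative J -> vonDyck vdN} := sval (cid J_vd_ex).
Lemma J_vdE : [/\ J_vd s = vx vdN i0, J_vd t = vx vdN i1 & J_vd u = vx vdN i2].
Proof. exact: (svalP (cid J_vd_ex)). Qed.

Lemma J_vd_Jd : J_vd Jd = 1.
Proof. by have [Fs Ft Fu] := J_vdE; rewrite /Jd !gmulfM Fs Ft Fu vx_prod012. Qed.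

Lemma J_vd_surj x : exists g, x = J_vd g.
Proof.
have [Fs Ft Fu] := J_vdE; elim/vx_ind: x => [|i]; first exact: subgroup_image.
by elim/I3_ind: i; [exists s|exists t|exists u].
Qed.

Lemma J_vd_ker g : J_vd g = 1 -> exists j : int, g = expgz Jd j.
Proof.
have [Fs Ft Fu] := J_vdE.
pose Q := quot [set Jd]%classic.
pose pr : {multiplicative J -> Q} := @quot_proj _ [set Jd]%classic.
pose f (i : 'I_3) : Q := if i == i0 then pr s else if i == i1 then pr t else pr u.
have [||K KE] := @vonDyck_lift vdN Q f.
- by apply: I3_ind; rewrite /f /= -multiplicativeX ?J_sk ?J_tn ?J_um multiplicative1.
- by have : pr Jd = 1; [exact: quot_proj_eq1|rewrite /Jd !gmulfM].
have KF : pr =1 K \o J_vd.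
  by apply: (@J_homE _ pr (K \o J_vd : {multiplicative _ -> _})) => /=; rewrite ?Fs ?Ft ?Fu KE.
move=> g1; apply: (central_normal_closure Jd_center).
by apply: quot_proj_eq1P; have := KF g; rewrite /= g1 multiplicative1; exact.
Qed.

Definition center_Jd := forall g, center J g -> exists j : int, g = expgz Jd j.

Lemma vd_center_Jd : (2 <= k)%N -> (2 <= n)%N -> (2 <= m)%N ->
  (forall i j, i != j -> vdN i = 2%N -> vdN j <> 2%N) -> center_Jd.
Proof.
move=> k2 n2 m2 h2 g cg; apply: J_vd_ker.
apply: (@vonDyck_center Rdefinitions.R vdN _ h2).
  by apply: I3_ind; rewrite /vdN /=; lia.
by move=> x; have [h ->] := J_vd_surj x; rewrite /commute -!gmulfM cg.
Qed.

End JGroup.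

Lemma J_rotate k n m : exists (F : {multiplicative J_group k n m -> J_group n m k})
    (K : {multiplicative J_group n m k -> J_group k n m}),
  [/\ cancel F K, cancel K F & K (Jd n m k) = Jd k n m].
Proof.
have [F [Fs Ft Fu]] : exists F : {multiplicative J_group k n m -> J_group n m k},
    [/\ F (J_s k n m) = J_u n m k, F (J_t k n m) = J_s n m k & F (J_u k n m) = J_t n m k].
  by apply: J_lift; rewrite ?J_sk ?J_tn ?J_um -?J_tus -?J_stu.
have [K [Ks Kt Ku]] : exists K : {multiplicative J_group n m k -> J_group k n m},
    [/\ K (J_s n m k) = J_t k n m, K (J_t n m k) = J_u k n m & K (J_u n m k) = J_s k n m].
  by apply: J_lift; rewrite ?J_sk ?J_tn ?J_um -?J_tus -?J_stu.
exists F, K; split=> [g|g|].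
- apply: (@J_homE _ _ _ _ (K \o F : {multiplicative _ -> _}) (idfun : {multiplicative _ -> _})) => /=;
  by rewrite ?Fs ?Ft ?Fu.
- apply: (@J_homE _ _ _ _ (F \o K : {multiplicative _ -> _}) (idfun : {multiplicative _ -> _})) => /=;
  by rewrite ?Ks ?Kt ?Ku.
- by rewrite /Jd !gmulfM Ks Kt Ku -J_stu.
Qed.

Lemma center_Jd_rotate k n m : center_Jd n m k -> center_Jd k n m.
Proof.
move=> c g cg; have [F [K [FK KF Kd]]] := J_rotate k n m.
have [|j jE] := c (F g).
  by move=> x; rewrite -[x]KF /commute -!gmulfM cg.
by exists j; rewrite -[g]FK jE multiplicative_expgz Kd.
Qed.

(** * The case of two labels equal to 2 *)

Section DihedralForm.
Variables (G : groupType) (s t u d : G).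
Hypotheses (ss : s * s = 1) (tt : t * t = 1) (dE : d = s * t * u).
Hypothesis dc : forall g, commute d g.

Let cd (j : int) (x : G) : expgz d j * x = x * expgz d j.
Proof. exact/commute_sym/commute_expgz/commute_sym/dc. Qed.

Let su_conj : s * (u * s) = u^-1 * expgz d 2.
Proof.
have tE : t = s * d * u^-1 by rewrite dE !mulgA ss mul1g mulgK.
have uE : u = t * s * d by rewrite dE !mulgA -(mulgA t s s) ss mulg1 tt mul1g.
have -> : u * s = t * d by rewrite {1}uE -!mulgA (dc s) !mulgA -(mulgA t s s) ss mulg1.
rewrite -[X in _ = _ * X]/(d * d) {1}tE !mulgA ss mul1g; congr (_ * _).
exact: (commuteV (dc u)).
Qed.

Let us (i : int) : expgz u i * s = s * expgz u (- i)%R * expgz d (2 * i)%R.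
Proof.
have -> : expgz u i * s = s * expgz (u ^ s) i.
  by rewrite expgz_conj conjgE mulgA mulgA mulgV mul1g.
have sV : s^-1 = s by apply: mulg1_eq.
rewrite conjgE sV su_conj expgzMc; last by apply/commute_expgz/commute_sym/dc.
rewrite -expgzM -mulgA; congr (_ * (_ * _)).
by rewrite -[u^-1]/(expgz u (-1)%R) -expgzM GRing.mulN1r.
Qed.

(** Since [s * u * s = u^-1 * d ^+ 2] with [d] central, all powers of [s] can be moved to the left.
    It is applied to [J(2,2,p)] and, with [d = 1], to dihedral von Dyck groups. *)
Lemma dihedral_form_subgroup : subgroup_pred (fun g => exists (i j : int) (e : bool),
    g = expgz d j * ((if e then s else 1) * expgz u i)).
Proof.
have usd i : expgz u i * s = expgz d (2 * i)%R * (s * expgz u (- i)%R).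
  by rewrite us cd.
have dd i j x : expgz d i * (expgz d j * x) = expgz d (i + j)%R * x.
  by rewrite expgzD mulgA.
split; first by exists 0%R, 0%R, false; rewrite !mulg1.
- move=> _ _ [i [j [e ->]]] [k [l [f ->]]].
  have -> : expgz d j * ((if e then s else 1) * expgz u i) * (expgz d l * ((if f then s else 1) * expgz u k)) =
      expgz d (j + l)%R * ((if e then s else 1) * (expgz u i * (if f then s else 1) * expgz u k)).
    rewrite -dd -!mulgA; congr (_ * _); rewrite [RHS]cd -!mulgA; congr (_ * (_ * _)).
    by rewrite cd -!mulgA.
  case: f; last by exists (i + k)%R, (j + l)%R, e; rewrite mulg1 -expgzD.
  exists (- i + k)%R, (j + l + 2 * i)%R, (~~ e).
  rewrite usd -[in RHS]dd; congr (_ * _).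
  rewrite -(mulgA (expgz d _)) (mulgA _ (expgz d _)) -cd -mulgA; congr (_ * _).
  rewrite expgzD !mulgA; congr (_ * _ * _).
  by case: e; rewrite /= ?mul1g.
- move=> _ [i [j [[] ->]]]; last first.
    by exists (- i)%R, (- j)%R, false; rewrite !mul1g invgM -!expgzN cd.
  exists i, (- j + 2 * - i)%R, true; rewrite !invgM -!expgzN.
  have sV : s^-1 = s by apply: mulg1_eq.
  by rewrite sV usd GRing.opprK -cd dd.
Qed.

End DihedralForm.

Section Dihedral.
Variable p : nat.
Hypothesis p2 : (2 <= p)%N.
Local Notation J := (J_group 2 2 p).
Local Notation s := (J_s 2 2 p).
Local Notation t := (J_t 2 2 p).
Local Notation u := (J_u 2 2 p).
Local Notation d := (Jd 2 2 p).

Lemma J22_ss : s * s = 1. Proof. by have := J_sk 2 2 p; rewrite expg2. Qed.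
Lemma J22_tt : t * t = 1. Proof. by have := J_tn 2 2 p; rewrite expg2. Qed.

Lemma dihedral_form g : exists (i j : int) (e : bool), g = expgz d j * ((if e then s else 1) * expgz u i).
Proof.
have sub := @dihedral_form_subgroup J s t u d J22_ss J22_tt erefl (@Jd_center _ _ _).
apply: (J_ind sub).
- by exists 0%R, 0%R, true; rewrite mul1g mulg1.
- exists (-1)%R, 1%R, true; rewrite -[expgz d 1]/d -[expgz u _]/(u^-1).
  by rewrite mulgA (Jd_center s) /Jd !mulgA J22_ss mul1g mulgK.
- by exists 1%R, 0%R, false; rewrite !mul1g.
Qed.

(* The monomial matrices [[0,1],[1,0]], [[0,z],[z^-1,0]] and diag(1,z^2), z a
   primitive 2p-th root of unity, acting on Z/2p x bool (powers of z times
   basis vectors). *)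
Lemma dihedral_comm (i : int) : commute s (expgz u i) -> expgz u i = 1.
Proof.
pose Z := 'Z_(p.*2); pose X : finType := (Z * bool)%type.
have sf_inj : injective (fun a : X => (a.1, ~~ a.2) : X).
  by move=> [a e] [b f] [-> /negb_inj ->].
have tf_inj : injective (fun a : X => (if a.2 then a.1 + 1 else a.1 - 1, ~~ a.2)%R : X).
  move=> [a e] [b f] [] + /negb_inj ef; rewrite {e}ef /=.
  by case: f => [/GRing.addIr|/GRing.addIr] ->.
have uf_inj : injective (fun a : X => (if a.2 then a.1 + 2%:R else a.1, a.2)%R : X).
  by move=> [a e] [b f] [] + ef; rewrite {e}ef /=; case: f => [/GRing.addIr|] ->.
pose S : {perm X} := perm sf_inj; pose T : {perm X} := perm tf_inj.
pose U : {perm X} := perm uf_inj.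
have UX (l : nat) a b : (U ^+ l)%g (a, b) = ((if b then a + (2 * l)%:R else a)%R, b).
  elim: l a => [|l IH] a; first by rewrite expg0 perm1 muln0 GRing.addr0 if_same.
  rewrite expgSr permM IH permE /=; case: b {IH} => //.
  by rewrite mulnSr GRing.natrD [in RHS]GRing.addrA.
have Z1 : (1 < p.*2)%N by lia.
have [F [Fs Ft Fu]] : exists F : {multiplicative J -> {perm X}},
    [/\ F s = S, F t = T & F u = U].
  apply: J_lift.
  - by apply/permP => -[a e]; rewrite expg2 permM !permE /= negbK.
  - apply/permP => -[a e]; rewrite expg2 permM !permE /= negbK.
    by case: e; rewrite /= ?GRing.subrK ?GRing.addrK.
  - apply/permP => -[a e]; rewrite UX perm1 mul2n pchar_Zp //.
    by rewrite GRing.addr0 if_same.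
  - apply/permP => -[a e]; rewrite !permM !permE /=.
    by case: e; rewrite /=; congr (_, _); ring.
  - apply/permP => -[a e]; rewrite !permM !permE /=.
    by case: e; rewrite /=; congr (_, _); ring.
have nat_case (l : nat) : commute s (u ^+ l) -> u ^+ l = 1.
  move=> /(congr1 F); rewrite !gmulfM multiplicativeX Fs Fu => /permP/(_ (0%R, false)).
  rewrite !permM UX permE /= UX => /(congr1 fst) h; move: h; rewrite [LHS]GRing.add0r => /(congr1 (@nat_of_ord _)) h; move: h.
  rewrite [LHS]val_Zp_nat // => h.
  have /dvdnP[c ->] : (p %| l)%N.
    have : (p.*2 %| 2 * l)%N by rewrite /dvdn h.
    by rewrite -mul2n dvdn_pmul2l.
  by rewrite mulnC expgnA J_um expg1n.
case: i => l /=; first exact: nat_case.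
move=> /commuteV; rewrite invgK => /nat_case ->; exact: invg1.
Qed.

(** For even [p] the quotient by [Jd] is a dihedral group with a nontrivial center, so triviality of
    centers cannot be used and [dihedral_comm] decides inside [J]. A central element that involves
    [s] would make [s] and [u] commute, hence [u = 1], against the order of its image. *)
Lemma J22_center : center_Jd 2 2 p.
Proof.
move=> g cg; have [i [j [e gE]]] := dihedral_form g.
have c x : commute x ((if e then s else 1) * expgz u i).
  have -> : (if e then s else 1) * expgz u i = expgz d (- j)%R * g.
    by rewrite gE mulgA -expgzD GRing.addNr mul1g.
  apply: commuteM; first exact/commute_expgz/commute_sym/Jd_center.
  exact/commute_sym/cg.
exists j; rewrite gE; case: e c {gE} => c; last first.
  by rewrite mul1g in c *; rewrite (dihedral_comm (c s)) mulg1.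
have us : commute s u.
  have := c u; rewrite /commute mulgA => h.
  apply: (@mulIg _ (expgz u i)); rewrite -mulgA.
  have -> : u * expgz u i = expgz u i * u.
    exact/commute_expgz/commute_refl.
  by rewrite mulgA -h.
have := @dihedral_comm 1 us; rewrite expgz1 => u1.
have N1 o : vdN 2 2 p o != 1%N by rewrite /vdN; do 2 case: ifP => // _; lia.
have := @vx_pow_eq1 Rdefinitions.R _ N1 i2 1 isT (or_intror p2).
have [_ _ Fu] := J_vdE 2 2 p.
by rewrite expg1 -Fu u1 multiplicative1 eqxx.
Qed.

End Dihedral.

Theorem J_center k n m : (2 <= k)%N -> (2 <= n)%N -> (2 <= m)%N -> center_Jd k n m.
Proof.
move=> k2 n2 m2.
have [/andP[/eqP-> /eqP->]|h1] := boolP ((k == 2) && (n == 2)%N); first exact: J22_center.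
have [/andP[/eqP-> /eqP->]|h2] := boolP ((n == 2) && (m == 2)%N).
  exact/center_Jd_rotate/J22_center.
have [/andP[/eqP-> /eqP->]|h3] := boolP ((m == 2) && (k == 2)%N).
  exact/center_Jd_rotate/center_Jd_rotate/J22_center.
apply: vd_center_Jd => // i j; rewrite /vdN.
by elim/I3_ind: i; elim/I3_ind: j => //= _; lia.
Qed.

Section CyclicQuotients.
Variables k n m : nat.

Definition Jx (g : J_gen) : J_group k n m :=
  match g with Js => J_s k n m | Jt => J_t k n m | Ju => J_u k n m end.
Definition Jord (g : J_gen) : nat := match g with Js => k | Jt => n | Ju => m end.

(** The target is commutative, so sending one generator to a generator of [Z/a] and the others to 1
    respects the relations. These maps detect powers of [dJ] outside [W] and, later, which generator
    a reflection comes from. *)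
Lemma J_to_cyclic g a : (0 < a)%N -> (a %| Jord g)%N ->
  exists (H : groupType) (z : H) (F : {multiplicative J_group k n m -> H}),
  has_order z a /\ forall h, F (Jx h) = if h == g then z else 1.
Proof.
case: a => // a _ an; pose z : 'I_a.+1 := inZp 1.
have zo : has_order z a.+1.
  apply: expg_has_order => [|i]; rewrite Zp_expg.
    by apply: val_inj; rewrite /= modnMl.
  move=> /(congr1 (@nat_of_ord _)) /=.
  rewrite modnMml mul1n => h; rewrite /dvdn h; exact.
have zn : z ^+ Jord g = 1 by apply/(has_order_expg (Jord g) zo).
pose f h : 'I_a.+1 := if h == g then z else 1.
have fn h : f h ^+ Jord h = 1.
  by rewrite /f; case: eqP => [->//|_]; rewrite expg1n.
have cf h h' : commute (f h) (f h').
  rewrite /f; case: ifP => _; case: ifP => _; try exact: commute_refl.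
    exact: commute1.
  exact/commute_sym/commute1.
have [F [Fs Ft Fu]] : exists F : {multiplicative J_group k n m -> 'I_a.+1},
    [/\ F (J_s k n m) = f Js, F (J_t k n m) = f Jt & F (J_u k n m) = f Ju].
  apply: J_lift; rewrite ?(fn Js) ?(fn Jt) ?(fn Ju) //.
    by rewrite -mulgA (commuteM (cf Js Jt) (cf Js Ju)).
  by rewrite -mulgA (commuteM (cf Jt Ju) (cf Jt Js)).
by exists 'I_a.+1, z, F; split=> //; case.
Qed.

End CyclicQuotients.

(** * The center of the braid groups *)

Section PartOne.
Variable D : J_reflection.
Local Notation n := (Jn D).
Local Notation m := (Jm D).
Local Notation J := (ambient D).
Local Notation s := (amb_s D).
Local Notation t := (amb_t D).
Local Notation u := (amb_u D).
Local Notation Bd := (bD n m (braid_x D) (braid_Y D) (braid_Z D)).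
Local Notation nat_quot := (natural_quotient D).

Definition dJ : J := Jd (Jk D) (Jb D * n) (Jc D * m).

Lemma dJ_center : center J dJ. Proof. exact: Jd_center. Qed.

Lemma torus_bijection : exists (F : {multiplicative braid_group D ->
    torus (if (2 <= Jb D)%N then 0%N else n) (if (2 <= Jc D)%N then 0%N else m)}),
  bijective F /\ F Bd = tor _ _ i2.
Proof.
exact: (@braid_torus n m (2 <= Jb D)%N (2 <= Jc D)%N (Jn_gt0 D) (Jm_gt0 D)
  (Jnm_coprime D) _ _ erefl erefl).
Qed.

Lemma n_ge2 : ~~ (2 <= Jb D)%N -> (2 <= n)%N.
Proof. by have := Jbn_ge2 D; have := Jb_gt0 D; case: (Jb D) => [|[|]] //; rewrite mul1n. Qed.
Lemma m_ge2 : ~~ (2 <= Jc D)%N -> (2 <= m)%N.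
Proof. by have := Jcm_ge2 D; have := Jc_gt0 D; case: (Jc D) => [|[|]] //; rewrite mul1n. Qed.

Lemma braid_center g : center (braid_group D) g <-> exists k : int, g = expgz Bd k.
Proof.
have [F [[K FK KF] Fd]] := torus_bijection.
set p := (if _ then _ else n) in F K FK KF Fd; set q := (if _ then _ else m) in F K FK KF Fd.
have Finj : injective F := can_inj FK.
split=> [cg|[k ->]].
  have cF : center (torus p q) (F g) by move=> x; rewrite -(KF x) /commute -!gmulfM cg.
  have [||||k kE] := @torus_center_sub p q _ _ _ _ (F g) cF.
  - by rewrite /p; case: ifP => // /negbT/n_ge2; case: n => [|[|]].
  - by rewrite /q; case: ifP => // /negbT/m_ge2; case: m => [|[|]].
  - apply/negP => /andP[]; rewrite /p /q; case: ifP => // _ /eqP n2; case: ifP => // _ /eqP m2.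
    by have := Jnm_coprime D; rewrite n2 m2.
  - by move=> N N1 N2 x; apply: (@vonDyck_center Rdefinitions.R N N1 N2).
  exists k; apply: Finj; rewrite kE; apply/esym/(etrans (multiplicative_expgz F _ _)).
  by congr expgz; exact: Fd.
move=> x; apply: commute_sym; apply: commute_expgz; apply: Finj.
have FM (a b : braid_group D) : F (a * b) = F a * F b by exact: gmulfM.
by rewrite (FM x) (FM Bd) Fd; apply/commute_sym/tor_d_center.
Qed.

Section Images.
Variables al be : int.
Hypothesis bez : (al * m%:Z + be * n%:Z = 1)%R.

(** The image of [bT]. The exponent is forced by [t ^+ n = tJ ^+ n * deltaJ ^ al], the formula of
    [mod_y]. *)
Definition tJ : J := t * expgz dJ (- al * m%:Z)%R.
Definition deltaJ : J := dJ ^+ (n * m).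

Lemma dJ_comm (j : int) x : commute (expgz dJ j) x.
Proof. exact/commute_sym/commute_expgz/commute_sym/dJ_center. Qed.

Local Notation vn := (val \o nat_quot : {multiplicative braid_group D -> J}).

Lemma natural_values :
  [/\ forall l, (0 < l <= n)%N -> vn (braid_x D l) = mod_x tJ (s * tJ) l,
      vn (braid_Y D) = mod_y n al tJ deltaJ &
      vn (braid_Z D) = mod_z m be (s * tJ) deltaJ].
Proof.
have dE j : expgz deltaJ j = expgz dJ ((n * m)%:Z * j)%R by rewrite expgzM.
split.
- move=> l ln; rewrite /= natural_quotient_x // /mod_x [LHS]/= mulgK.
  have tl : tJ ^+ l.-1 = t ^+ l.-1 * expgz dJ (- al * m%:Z * l.-1%:Z)%R.
    rewrite -!expgz_nat /tJ expgzMc; last exact/commute_sym/dJ_comm.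
    by rewrite [in RHS]expgzM.
  rewrite tl invgM -!mulgA; congr (_ * _).
  by rewrite mulgA (dJ_comm _ s) -!mulgA mulVKg.
- rewrite /= natural_quotient_y [LHS]/= /mod_y /mon dE /tJ expgzMc; last exact/commute_sym/dJ_comm.
  rewrite -expgzM -mulgA -expgzD -[LHS]mulg1; congr (_ * _).
  by rewrite (_ : (_ + _ = 0)%R) // PoszM; ring.
- rewrite /= natural_quotient_z [LHS]/= /mod_z /mon dE /tJ mulgA.
  rewrite expgzMc; last exact/commute_sym/dJ_comm.
  rewrite -expgzM -mulgA -expgzD.
  have uE : u = (s * t)^-1 * dJ by rewrite /dJ /Jd mulKg.
  have -> : expgz (s * t) (- m%:Z)%R = (s * t)^-1 ^+ m by rewrite expgzN expVgn.
  rewrite {1}uE expgMn; last exact/commute_sym/dJ_center.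
  rewrite -[dJ ^+ m]/(expgz dJ m); congr (_ * expgz dJ _).
  rewrite PoszM -{1}[Posz m]GRing.mulr1 -bez; ring.
Qed.

Lemma tJ_delta : commute tJ deltaJ.
Proof. exact/commute_sym/(dJ_comm (n * m)). Qed.
Lemma sJ_delta : commute (s * tJ) deltaJ.
Proof. exact/commute_sym/(dJ_comm (n * m)). Qed.

Lemma natural_bD : val (nat_quot Bd) = deltaJ.
Proof.
have [vx_ vy vz] := natural_values.
apply: (etrans (mult_bD vn n m (braid_x D) (braid_Y D) (braid_Z D))).
rewrite vy vz (bD_ext _ _ _ (Jn_gt0 D) vx_).
exact: (mod_bD (Jn_gt0 D) bez tJ_delta sJ_delta).
Qed.

Lemma tJ_in_W : exists w : W D, val w = tJ.
Proof.
have [vx_ vy vz] := natural_values.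
exists (nat_quot (bT n m al be (braid_x D) (braid_Y D) (braid_Z D))).
have E : vn (bT n m al be (braid_x D) (braid_Y D) (braid_Z D)) =
   bT n m al be (fun l => vn (braid_x D l)) (vn (braid_Y D)) (vn (braid_Z D)).
  by rewrite /bT mult_mon mult_bA.
apply: (etrans E); rewrite vy vz /bT (bA_ext _ _ _ (Jn_gt0 D) vx_).
exact: (mod_bT (Jn_gt0 D) bez tJ_delta sJ_delta).
Qed.

End Images.

(** [W] contains [s] and [tJ], which is [t] up to a power of [dJ], and [u] is [(s * t)^-1 * dJ].
    Consequently an element central in [W] is central in [J], and conjugation by [J] restricts to
    inner automorphisms of [W]. *)
Lemma J_W_dJ (x : J) : exists (w : W D) (j : int), x = val w * expgz dJ j.
Proof.
have [al [be bez]] := bezout_coprime (Jnm_coprime D).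
have [w wE] := tJ_in_W bez.
have sub : subgroup_pred (fun x : J => exists (w : W D) (j : int), x = val w * expgz dJ j).
  split; first by exists 1, 0%R; rewrite mulg1.
    move=> _ _ [v [i ->]] [v' [j ->]]; exists (v * v'), (i + j)%R.
    by rewrite gmulfM expgzD -!mulgA; congr (_ * _); rewrite !mulgA dJ_comm.
  move=> _ [v [i ->]]; exists v^-1, (- i)%R.
  by rewrite invgM -expgzN multiplicativeV dJ_comm.
have st : (exists (w : W D) (j : int), s = val w * expgz dJ j) /\
          (exists (w : W D) (j : int), t = val w * expgz dJ j).
  split.
    by exists (W_x D 1), 0%R; rewrite mulg1 /= mul1g invg1 mulg1.
  exists w, (al * m%:Z)%R; rewrite wE /tJ -mulgA -expgzD.
  by rewrite (_ : (_ + _ = 0)%R) ?mulg1 //; ring.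
have [sP tP] := st; have [S1 SM SV] := sub.
apply: (J_ind sub) => //.
have -> : J_u _ _ _ = (s * t)^-1 * dJ by rewrite /dJ /Jd mulKg.
apply: (SM); first by apply: SV; apply: SM.
by exists 1, 1%R; rewrite multiplicative1 mul1g.
Qed.

(** The maps of [J] to [Z/n] by [t] and to [Z/m] by [u] kill [s], [t ^+ n] and [u ^+ m], hence [W],
    but send [dJ] to a generator. Coprimality combines the two divisibilities. *)
Lemma dJ_in_W (j : int) (w : W D) : val w = expgz dJ j -> ((n * m)%:Z %| j)%Z.
Proof.
move=> wE.
have cyc g a : (0 < a)%N -> (a %| Jord (Jk D) (Jb D * n) (Jc D * m) g)%N ->
    (g = Jt /\ a = n \/ g = Ju /\ a = m) -> (a%:Z %| j)%Z.
  move=> a0 ag ga; have [H [z [F [zo Fx]]]] := J_to_cyclic a0 ag.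
  have Fs : F s = 1 by rewrite (Fx Js); case: ga => -[-> _].
  have zn : z ^+ a = 1 by apply/(has_order_expg a zo).
  have Ft : F t ^+ n = 1.
    by rewrite (Fx Jt); case: ga => -[ge ae]; rewrite ge /= -?ae ?expg1n.
  have Fu : F u ^+ m = 1.
    by rewrite (Fx Ju); case: ga => -[ge ae]; rewrite ge /= -?ae ?expg1n.
  have Fd : F dJ = z.
    by rewrite /dJ /Jd !gmulfM (Fx Js) (Fx Jt) (Fx Ju); case: ga => -[-> _]; rewrite /= ?mul1g ?mulg1.
  have : F (val w) = 1.
    have := set_mem (valP w); move=> /(_ [set x | F x = 1]%classic); apply.
    split; last by move=> x [] ->; rewrite /= ?multiplicativeX.
    split=> /=; first exact: multiplicative1.
    - by move=> x y fx fy; rewrite gmulfM fx fy mulg1.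
    - by move=> x fx; rewrite multiplicativeV fx invg1.
    - by move=> x y fx; rewrite conjgE !gmulfM fx mul1g -gmulfM mulVg multiplicative1.
  by rewrite wE multiplicative_expgz Fd => /zo; rewrite dvdzE.
rewrite PoszM Gauss_dvdz; last by rewrite /coprimez /gcdz /= (eqP (Jnm_coprime D)).
apply/andP; split.
  by apply: (cyc Jt); [exact: Jn_gt0|exact: dvdn_mull|left].
by apply: (cyc Ju); [exact: Jm_gt0|exact: dvdn_mull|right].
Qed.

Lemma center_W_dJ (g : W D) : center (W D) g <-> exists k : int, val g = expgz dJ ((n * m)%:Z * k)%R.
Proof.
split=> [cg|[k gE] x]; last first.
  have E : val g * val x = val x * val g by rewrite gE; exact: dJ_comm.
  by apply: val_inj; exact: E.
have [j jE] : exists j : int, val g = expgz dJ j.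
  apply: J_center; [exact: Jk_ge2|exact: Jbn_ge2|exact: Jcm_ge2|].
  move=> x; have [w [i ->]] := J_W_dJ x.
  apply: commuteM; first by rewrite /commute -!gmulfM cg.
  exact/commute_sym/dJ_comm.
have /dvdzP[k kE] := dJ_in_W jE.
by exists k; rewrite jE kE GRing.mulrC.
Qed.

Lemma part1_cyclic : cyclic_subgroup (center (braid_group D)).
Proof.
exists Bd; apply/seteqP; split=> g /=.
  by move=> /braid_center[k ->]; exists k.
by move=> [k _ <-]; apply/braid_center; exists k.
Qed.

Lemma part1_image : (nat_quot @` center (braid_group D))%classic = center (W D).
Proof.
have [al [be bez]] := bezout_coprime (Jnm_coprime D).
have vk (k : int) : val (nat_quot (expgz Bd k)) = expgz dJ ((n * m)%:Z * k)%R.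
  rewrite (multiplicative_expgz nat_quot).
  apply: (etrans (multiplicative_expgz (val : {multiplicative W D -> J}) _ _)).
  by rewrite expgzM; congr expgz; exact: (natural_bD bez).
apply/seteqP; split=> g /=.
  by move=> [x /braid_center[k ->] <-]; apply/center_W_dJ; exists k.
move=> /center_W_dJ[k kE]; exists (expgz Bd k); first by apply/braid_center; exists k.
by apply: val_inj; rewrite kE vk.
Qed.

End PartOne.

(** * Reflections modulo the center *)

Lemma iso_inverse (G H : groupType) (f : {multiplicative G -> H}) : bijective f ->
  exists g : {multiplicative H -> G}, [/\ cancel f g, cancel g f & bijective g].
Proof.
move=> [g fK gK]; have gM : {morph g : x y / x * y}.
  by move=> x y; apply: (can_inj fK); rewrite gmulfM !gK.
pose F : {multiplicative H -> G} := HB.pack g (isMultiplicative.Build _ _ g gM).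
by exists F; split=> //; exists f.
Qed.

Lemma image_inverse (S T : Type) (f : S -> T) (g : T -> S) (A : set S) (B : set T) :
  cancel f g -> (f @` A)%classic = B -> (g @` B)%classic = A.
Proof.
move=> fK <-; apply/seteqP; split=> x /=; first by move=> [_ [y Ay <-] <-]; rewrite fK.
by move=> Ax; exists (f x); [exists x|exact: fK].
Qed.

Section CenterQuotient.
Variables (G1 G2 H1 H2 : groupType).
Variables (p1 : {multiplicative G1 -> H1}) (p2 : {multiplicative G2 -> H2}).
Hypotheses (p1s : forall x, exists w, x = p1 w) (p2s : forall x, exists w, x = p2 w).
Hypotheses (p1k : forall w, p1 w = 1 <-> center G1 w) (p2k : forall w, p2 w = 1 <-> center G2 w).
Variable f : {multiplicative G1 -> G2}.
Hypothesis fb : bijective f.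

Lemma center_quotient_iso :
  exists phi : {multiplicative H1 -> H2}, bijective phi /\ forall w, phi (p1 w) = p2 (f w).
Proof.
have [g fK gK] := fb.
have fc w : center G1 w <-> center G2 (f w).
  split=> [cw x|cw x]; first by rewrite -(gK x) /commute -!gmulfM cw.
  by apply: (can_inj fK); have := cw (f x); rewrite /commute -!gmulfM.
have eqP (G H : groupType) (p : {multiplicative G -> H}) (w v : G) : p w = p v <-> p (w^-1 * v) = 1.
  rewrite gmulfM multiplicativeV; split=> [->|/eqP]; first by rewrite mulVg.
  by rewrite mulg_eq1 => /eqP/invg_inj.
have ff w v : p1 w = p1 v <-> p2 (f w) = p2 (f v).
  rewrite eqP [X in _ <-> X]eqP p1k fc -p2k.
  by rewrite [f (w^-1 * v)]gmulfM multiplicativeV.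
pose phi x := p2 (f (sval (cid (p1s x)))).
have phiE w : phi (p1 w) = p2 (f w).
  by apply/ff; rewrite /phi; case: (cid _) => v /= ->.
have phiM : {morph phi : x y / x * y}.
  move=> x y; have [v ->] := p1s x; have [w ->] := p1s y.
  by rewrite -gmulfM !phiE !gmulfM.
pose psi y := p1 (g (sval (cid (p2s y)))).
pose F : {multiplicative H1 -> H2} := HB.pack phi (isMultiplicative.Build H1 H2 phi phiM).
exists F; split=> //.
exists psi => [x|y].
  have [v ->] := p1s x; rewrite /= phiE /psi; case: (cid _) => w /= wE.
  by apply/ff; rewrite gK.
have [v ->] := p2s y; rewrite /psi; case: (cid _) => w /= ->.
by rewrite phiE gK.
Qed.

End CenterQuotient.

Section Reflections.
Variable D : J_reflection.
Local Notation n := (Jn D).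
Local Notation m := (Jm D).
Local Notation J := (ambient D).

Definition Nd : 'I_3 -> nat := vdN (Jk D) (Jb D * n) (Jc D * m).
(** The reflections attached to the generator [i] of [J] are conjugates of powers of its power
    [step i], an element of order [mark i]; there are none when [mark i = 1]. *)
Definition step (i : 'I_3) : nat := if i == i0 then 1%N else if i == i1 then n else m.
Definition mark (i : 'I_3) : nat := if i == i0 then Jk D else if i == i1 then Jb D else Jc D.

Lemma mark_step i : (mark i * step i = Nd i)%N.
Proof. by elim/I3_ind: i => //=; rewrite /mark /step /Nd /vdN /= ?muln1. Qed.

Lemma mark_gt0 i : (0 < mark i)%N.
Proof. by elim/I3_ind: i; [exact: leq_trans (Jk_ge2 D)|exact: Jb_gt0|exact: Jc_gt0]. Qed.

Lemma step_gt0 i : (0 < step i)%N.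
Proof. by elim/I3_ind: i; [|exact: Jn_gt0|exact: Jm_gt0]. Qed.

Lemma Nd_ge2 i : (2 <= Nd i)%N.
Proof. by elim/I3_ind: i; [exact: Jk_ge2|exact: Jbn_ge2|exact: Jcm_ge2]. Qed.

Lemma Nd_neq1 i : Nd i != 1%N.
Proof. by have := Nd_ge2 i; case: (Nd i) => [|[|]]. Qed.

Local Notation T := (vonDyck Nd).

Definition ambx (i : 'I_3) : J := if i == i0 then amb_s D else if i == i1 then amb_t D else amb_u D.

Definition vdq : {multiplicative J -> T} := J_vd _ _ _.

Lemma vdq_x i : vdq (ambx i) = vx Nd i.
Proof. by have [Fs Ft Fu] := J_vdE (Jk D) (Jb D * n) (Jc D * m); elim/I3_ind: i. Qed.

Lemma ambx_pow i : ambx i ^+ Nd i = 1.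
Proof. by elim/I3_ind: i; [exact: J_sk|exact: J_tn|exact: J_um]. Qed.

Lemma Tx_order i : has_order (vx Nd i) (Nd i).
Proof. exact: (vx_order Rdefinitions.R Nd_neq1). Qed.

Lemma ambx_order i : has_order (ambx i) (Nd i).
Proof.
apply: expg_has_order (ambx_pow i) _ => l xl.
by apply/(has_order_expg l (Tx_order i)); rewrite -vdq_x -multiplicativeX xl multiplicative1.
Qed.

Lemma vdq_expgz i (e : int) : vdq (expgz (ambx i) e) = expgz (vx Nd i) e.
Proof. by rewrite (multiplicative_expgz vdq) vdq_x. Qed.

Lemma vdq_expgz1 i (e : int) : expgz (ambx i) e = 1 <-> expgz (vx Nd i) e = 1.
Proof. by rewrite ambx_order Tx_order. Qed.

Lemma W_gensP g : W_gens g <-> exists i, g = expgz (ambx i) (Posz (step i)).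
Proof.
split; last first.
  by move=> [i ->]; elim/I3_ind: i; [constructor 1|constructor 2|constructor 3].
by move=> [] ->; [exists i0|exists i1|exists i2].
Qed.

Lemma reflectionsP (w : W D) : reflections D w <->
  exists i (e : int) h, val w = expgz (ambx i) (Posz (step i) * e)%R ^ h /\ val w <> 1.
Proof.
split.
  move=> [g [e [h [/W_gensP[i ->]]]]]; rewrite -expgzM => ne wE.
  exists i, e, h; split=> //; rewrite wE => /eqP; rewrite conjg_eq1 => /eqP; exact: ne.
move=> [i [e [h [wE w1]]]]; exists (expgz (ambx i) (Posz (step i))), e, h; split.
- by apply/W_gensP; exists i.
- by rewrite -expgzM => E; apply: w1; rewrite wE E conj1g.
- by rewrite wE expgzM.
Qed.

Definition tq : {multiplicative W D -> T} := vdq \o (val : {multiplicative W D -> J}).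

Lemma tqE w : tq w = vdq (val w). Proof. by []. Qed.

Lemma tq_surj x : exists w, x = tq w.
Proof.
have [y ->] := J_vd_surj x; have [w [j ->]] := J_W_dJ y; exists w.
rewrite gmulfM -[RHS]mulg1; congr (_ * _).
by rewrite (multiplicative_expgz (J_vd _ _ _)) J_vd_Jd expgz1n.
Qed.

Lemma tq_center w : tq w = 1 <-> center (W D) w.
Proof.
split=> [/J_vd_ker[j jE]|/center_W_dJ[j jE]].
  move=> x; apply: val_inj.
  have E : val w * val x = val x * val w by rewrite jE; exact: dJ_comm.
  exact: E.
by rewrite tqE jE (multiplicative_expgz vdq) [vdq _]J_vd_Jd expgz1n.
Qed.

Lemma gen_in_W i (e : int) h :
  exists w : W D, val w = expgz (ambx i) (Posz (step i) * e)%R ^ h.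
Proof.
have [N1 NM NV NJ] := normal_closureP (@W_gens D).
have : normal_closure (@W_gens D) (expgz (ambx i) (Posz (step i) * e)%R ^ h).
  apply: NJ; rewrite expgzM.
  have g0 : normal_closure (@W_gens D) (expgz (ambx i) (Posz (step i))).
    by apply: sub_normal_closure; apply/W_gensP; exists i.
  have gX l : normal_closure (@W_gens D) (expgz (ambx i) (Posz (step i)) ^+ l).
    by elim: l => [|l IH]; [exact: N1|rewrite expgS; exact: NM].
  by case: e => l; [exact: gX|apply: NV; exact: gX].
by move=> /mem_set p; exists (exist (fun g : J => g \in normal_closure (@W_gens D)) _ p).
Qed.

(* The reflections of [W], seen in [W / Z(W)]. *)
Definition Rb : set T :=
  [set x | exists i (e : int) a, x = expgz (vx Nd i) (Posz (step i) * e)%R ^ a /\ x <> 1]%classic.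

Lemma Rb_image : (tq @` reflections D)%classic = Rb.
Proof.
apply/seteqP; split=> x /=.
  move=> [w /reflectionsP[i [e [h [wE w1]]]] <-]; exists i, e, (vdq h).
  have E : tq w = expgz (vx Nd i) (Posz (step i) * e)%R ^ vdq h.
    by rewrite tqE wE conjgE !gmulfM multiplicativeV vdq_expgz -conjgE.
  split=> // tw; apply: w1; rewrite wE; have /eqP := etrans (esym E) tw.
  by rewrite conjg_eq1 => /eqP/vdq_expgz1 ->; exact: conj1g.
move=> [i [e [a [xE x1]]]]; have [h hE] := J_vd_surj a.
have [w wE] := gen_in_W i e h; exists w.
  apply/reflectionsP; exists i, e, h; split=> //.
  move=> w1; apply: x1; move: wE; rewrite w1 => /esym/eqP; rewrite conjg_eq1 => /eqP/vdq_expgz1 E.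
  by rewrite xE E conj1g.
have E : tq w = expgz (vx Nd i) (Posz (step i) * e)%R ^ vdq h.
  by rewrite tqE wE conjgE !gmulfM multiplicativeV vdq_expgz -conjgE.
by rewrite xE hE; exact: E.
Qed.

End Reflections.

Lemma Rb_iso D1 D2 (f : {multiplicative W D1 -> W D2}) :
  bijective f -> (f @` reflections D1)%classic = reflections D2 ->
  exists phi : {multiplicative vonDyck (Nd D1) -> vonDyck (Nd D2)},
    bijective phi /\ (phi @` @Rb D1)%classic = @Rb D2.
Proof.
move=> fb fR; have [phi [phib phiE]] := center_quotient_iso (@tq_surj D1) (@tq_surj D2)
  (@tq_center D1) (@tq_center D2) fb.
exists phi; split=> //; rewrite -!Rb_image -fR; apply/seteqP; split=> x /=.
  by move=> [_ [w wR <-] <-]; exists (f w); [exists w|rewrite phiE].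
by move=> [_ [w wR <-] <-]; exists (tq D1 w); [exists w|rewrite phiE].
Qed.

(** * The infinite case *)

Lemma has_order_iso (G H : groupType) (f : {multiplicative G -> H}) (x : G) d :
  injective f -> has_order x d <-> has_order (f x) d.
Proof.
move=> fi; have E (i : int) : expgz (f x) i = 1 <-> expgz x i = 1.
  rewrite -multiplicative_expgz; split=> [fx|->]; last exact: multiplicative1.
  by apply: fi; rewrite fx multiplicative1.
by split=> h i; rewrite -h E.
Qed.

Lemma has_order_expgz (G : groupType) (x : G) q d :
  (0 < q)%N -> has_order x (d * q) -> has_order (expgz x (Posz q)) d.
Proof.
move=> q0 xo i; rewrite -expgzM xo abszM /= mulnC dvdn_pmul2l //.
Qed.

Lemma fin_bij (A B : Type) (f : A -> B) : bijective f -> fin A -> fin B.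
Proof.
move=> [g fK gK] [s sP]; exists (map f s) => y; rewrite -[y]gK.
exact/List.in_map/sP.
Qed.

Section FreeTorsion.
Variable D : J_reflection.
Local Notation T := (vonDyck (Nd D)).

Definition reflection_free_order d := exists h : T, has_order h d /\ forall r, @Rb D r -> ~ commute h r.

(** A torsion element is conjugate into some [<x_i>], and commutes with a conjugate of the
    reflection [x_i ^ step i] as soon as [mark i] is at least 2. If [mark i = 1], no nontrivial
    power of [x_i] is a reflection, while every element commuting with a nontrivial power of [x_i]
    lies in [<x_i>]. *)
Lemma infinite_free_order d : ~ fin T -> (2 <= d)%N ->
  reflection_free_order d <-> exists i, mark D i = 1%N /\ (d %| step D i)%N.
Proof.
move=> Tinf d2; have d0 : (0 < d)%N by apply: leq_trans d2.
split=> [[h [ho hR]]|[i [mi /dvdnP[q qE]]]].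
  have hd : h ^+ d = 1 by apply/(has_order_expg d ho).
  have [i [e [a hE]]] := torsion_conj Rdefinitions.R (@Nd_ge2 D) Tinf d0 hd.
  exists i; have mi : mark D i = 1%N.
    apply/eqP; rewrite eqn_leq mark_gt0 andbT leqNgt; apply/negP => m2.
    apply: (hR (expgz (vx (Nd D) i) (Posz (step D i)) ^ a)).
      exists i, 1%R, a; rewrite GRing.mulr1; split=> // /eqP.
      rewrite conjg_eq1 => /eqP/(Tx_order D i) /=; rewrite -mark_step => /dvdn_leq.
      by rewrite step_gt0 => /(_ isT); have := step_gt0 D i; nia.
    rewrite hE /commute -!conjMg; congr (_ ^ _).
    by rewrite -!expgzD GRing.addrC.
  split=> //; have -> : step D i = Nd D i by rewrite -mark_step mi mul1n.
  apply/(has_order_expg _ ho); rewrite hE -conjXg.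
  rewrite -expgz_nat -expgzM GRing.mulrC expgzM expgz_nat.
  by rewrite vx_pow expgz1n conj1g.
have NE : Nd D i = (d * q)%N by rewrite -mark_step mi mul1n qE mulnC.
have q0 : (0 < q)%N by have := step_gt0 D i; rewrite qE; case: (q).
have ho : has_order (expgz (vx (Nd D) i) (Posz q)) d.
  by apply: has_order_expgz => //; rewrite -NE; exact: Tx_order.
exists (expgz (vx (Nd D) i) (Posz q)); split=> // r [i' [e [a [rE r1]]]] c.
have h1 : expgz (vx (Nd D) i) (Posz q) <> 1.
  by move=> /(ho 1%R) /dvdn_leq => /(_ isT); rewrite leqNgt d2.
have hr : expgz (vx (Nd D) i) (Posz q) = expgz (vx (Nd D) i) (Posz q) ^ r.
  exact/esym/conj_commute.
have [_ [l lE]] := conj_vx Rdefinitions.R (@Nd_ge2 D) Tinf h1 hr.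
have [||ii _] := @conj_vx Rdefinitions.R _ (@Nd_ge2 D) Tinf i i' l (Posz (step D i') * e)%R a.
- by rewrite -lE.
- by rewrite -lE.
apply: r1; rewrite rE -ii expgzM.
have -> : step D i = Nd D i by rewrite -mark_step mi mul1n.
by rewrite expgz_nat vx_pow expgz1n conj1g.
Qed.

End FreeTorsion.

Lemma reflection_free_order_iso D1 D2 (phi : {multiplicative vonDyck (Nd D1) -> vonDyck (Nd D2)}) d :
  bijective phi -> (phi @` @Rb D1)%classic = @Rb D2 ->
  reflection_free_order D1 d -> reflection_free_order D2 d.
Proof.
move=> phib phiR [h [ho hR]]; have phii := bij_inj phib.
exists (phi h); split; first by apply/(has_order_iso _ _ phii).
move=> r; rewrite -phiR => -[s sR <-] c; apply: (hR s sR).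
by apply: phii; rewrite !gmulfM.
Qed.

(** Positivity is tested because 0 marks an absent exponent, although every number divides it. *)
Definition divides_one (p q d : nat) := ((0 < p) && (d %| p) || (0 < q) && (d %| q))%N.

Lemma divides_oneC p q d : divides_one p q d = divides_one q p d.
Proof. exact: orbC. Qed.

(** [p] divides some nonzero [r] among [p'], [q'], and this [r] in turn divides [p] or a nonzero
    [q]. The second would make [p] divide [q], against coprimality, so [p = r]. *)
Lemma coprime_pair_mem (p q p' q' : nat) :
  (2 <= p)%N -> p' != 1%N -> q' != 1%N -> (q == 0%N) || coprime p q ->
  (forall d, (2 <= d)%N -> divides_one p q d = divides_one p' q' d) ->
  p = p' \/ p = q'.
Proof.
move=> p2 p1' q1' cpq S.
have mem r : (2 <= r)%N -> divides_one p' q' r -> (p %| r)%N -> p = r.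
  move=> r2; rewrite -S // /divides_one => /orP[] /andP[x0 rx] pr.
    by apply/eqP; rewrite eqn_dvd pr rx.
  move: cpq; rewrite -leqn0 leqNgt x0 /= => /(coprime_dvdr (dvdn_trans pr rx)).
  by rewrite /coprime gcdnn; case: (p) p2 => [|[|]].
have : divides_one p' q' p by rewrite -S // /divides_one dvdnn (ltnW p2).
have ge2 r : (0 < r)%N -> r != 1%N -> (2 <= r)%N by case: r => [|[|]].
move=> /orP[] /andP[x0 px]; [left|right]; apply: mem => //; rewrite ?ge2 //.
  by rewrite /divides_one x0 dvdnn.
by rewrite /divides_one x0 dvdnn orbT.
Qed.

(* The value 0 stands for an absent entry. *)
Lemma coprime_pair_divisors (p q p' q' : nat) :
  p != 1%N -> q != 1%N -> p' != 1%N -> q' != 1%N ->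
  [|| p == 0%N, q == 0%N | coprime p q] -> [|| p' == 0%N, q' == 0%N | coprime p' q'] ->
  (forall d, (2 <= d)%N -> divides_one p q d = divides_one p' q' d) ->
  (p = p' /\ q = q') \/ (p = q' /\ q = p').
Proof.
move=> p1 q1 p1' q1' c c' S.
have neq r s : r != 1%N -> [|| r == 0%N, s == 0%N | coprime r s] -> r = s -> r = 0%N.
  by move=> r1 cr rs; move: cr; rewrite -rs /coprime gcdnn (negbTE r1) orbF => /orP[]/eqP.
have h r s r' s' : r != 1%N -> r' != 1%N -> s' != 1%N -> [|| r == 0%N, s == 0%N | coprime r s] ->
    (forall d, (2 <= d)%N -> divides_one r s d = divides_one r' s' d) -> [\/ r = 0%N, r = r' | r = s'].
  case: (posnP r) => [->|r0] r1 r1' s1' cr Sr; first by constructor 1.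
  have [|||] := @coprime_pair_mem r s r' s' _ r1' s1' _ Sr.
  - by case: (r) r0 r1 => [|[|]].
  - exact: cr.
  - by move=> ->; constructor 2.
  - by move=> ->; constructor 3.
have cC r s : [|| r == 0%N, s == 0%N | coprime r s] -> [|| s == 0%N, r == 0%N | coprime s r].
  by rewrite orbCA coprime_sym.
have := h p q p' q' p1 p1' q1' c S.
have := h q p p' q' q1 p1' q1' (cC _ _ c) (fun d d2 => etrans (divides_oneC q p d) (S d d2)).
have := h p' q' p q p1' p1 q1 c' (fun d d2 => esym (S d d2)).
have := h q' p' p q q1' p1 q1 (cC _ _ c') (fun d d2 => etrans (divides_oneC q' p' d) (esym (S d d2))).
have := neq p q p1 c; have := neq p' q' p1' c'.
move=> n1 n2 [] ? [] ? [] ? [] ?; lia.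
Qed.

Section TorusExponents.
Variable D : J_reflection.

Definition torus_n := if (2 <= Jb D)%N then 0%N else Jn D.
Definition torus_m := if (2 <= Jc D)%N then 0%N else Jm D.

Lemma torus_n_neq1 : torus_n != 1%N.
Proof. by rewrite /torus_n; case: ifP => // /negbT/n_ge2; case: (Jn D) => [|[|]]. Qed.

Lemma torus_m_neq1 : torus_m != 1%N.
Proof. by rewrite /torus_m; case: ifP => // /negbT/m_ge2; case: (Jm D) => [|[|]]. Qed.

Lemma torus_coprime : [|| torus_n == 0%N, torus_m == 0%N | coprime torus_n torus_m].
Proof.
by rewrite /torus_n /torus_m; case: ifP => // _; case: ifP; rewrite ?orbT // Jnm_coprime !orbT.
Qed.

Lemma divides_mark d : (2 <= d)%N ->
  (exists i, mark D i = 1%N /\ (d %| step D i)%N) <-> divides_one torus_n torus_m d.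
Proof.
move=> d2; have mark1 i : (mark D i == 1%N) = ~~ (2 <= mark D i)%N.
  by have := mark_gt0 D i; case: (mark D i) => [|[|]].
split=> [[i []]|].
  elim/I3_ind: i => /eqP; rewrite mark1.
  - by rewrite /mark /= Jk_ge2.
  - by rewrite /mark /= => b1 dn; rewrite /divides_one /torus_n (negbTE b1) Jn_gt0 [X in X || _]dn.
  - by rewrite /mark /= => b1 dn; rewrite /divides_one /torus_m (negbTE b1) Jm_gt0 [X in _ || X]dn orbT.
rewrite /divides_one /torus_n /torus_m => /orP[]; case: ifP => // b1 /andP[_ dn].
  by exists i1; split=> //; apply/eqP; rewrite mark1 /mark /= b1.
by exists i2; split=> //; apply/eqP; rewrite mark1 /mark /= b1.
Qed.

End TorusExponents.

Lemma infinite_case D1 D2 (phi : {multiplicative vonDyck (Nd D1) -> vonDyck (Nd D2)}) :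
  bijective phi -> (phi @` @Rb D1)%classic = @Rb D2 -> ~ fin (vonDyck (Nd D1)) ->
  (torus_n D1 = torus_n D2 /\ torus_m D1 = torus_m D2) \/
  (torus_n D1 = torus_m D2 /\ torus_m D1 = torus_n D2).
Proof.
move=> phib phiR inf1; have [F [phiK psiK Fb]] := iso_inverse phib.
have FR := image_inverse phiK phiR.
have inf2 : ~ fin (vonDyck (Nd D2)) by move=> /(fin_bij Fb).
apply: coprime_pair_divisors; rewrite ?torus_n_neq1 ?torus_m_neq1 ?torus_coprime //.
move=> d d2; apply/idP/idP.
  move=> /(divides_mark _ d2)/(infinite_free_order inf1 d2).
  by move=> /(reflection_free_order_iso phib phiR)/(infinite_free_order inf2 d2)/(divides_mark _ d2).
move=> /(divides_mark _ d2)/(infinite_free_order inf2 d2).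
by move=> /(reflection_free_order_iso Fb FR)/(infinite_free_order inf1 d2)/(divides_mark _ d2).
Qed.

(** * Marks *)

Section Axes.
Variable D : J_reflection.
Local Notation J := (ambient D).
Local Notation R := (reflections D).

(** The image is cyclic, whence the invariance under conjugation; the generator [i] keeps its full
    order and the two others die. *)
Lemma axis_hom i : exists (H : groupType) (F : {multiplicative J -> H}),
  (forall x h, F (x ^ h) = F x) /\
  forall j (e : int), F (expgz (ambx D j) e) = 1 <-> j <> i \/ (Nd D i %| `|e|)%N.
Proof.
pose g (l : 'I_3) := if l == i0 then Js else if l == i1 then Jt else Ju.
have gi : injective g by move=> a b; elim/I3_ind: a; elim/I3_ind: b.
have [||H [z [F [zo Fx]]]] := @J_to_cyclic (Jk D) (Jb D * Jn D) (Jc D * Jm D) (g i) (Nd D i).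
- exact: leq_trans (Nd_ge2 D i).
- by elim/I3_ind: i; rewrite /g /=.
have Fa j : F (ambx D j) = if j == i then z else 1.
  rewrite -(inj_eq gi); apply: etrans (Fx (g j)); congr (F _).
  by elim/I3_ind: j.
have Fz x : exists l : int, F x = expgz z l.
  move: x; apply: J_ind; first exact: (subgroup_preim F (expgz_subgroup z)).
  - by rewrite (Fx Js); case: ifP => _; [exists 1%R|exists 0%R].
  - by rewrite (Fx Jt); case: ifP => _; [exists 1%R|exists 0%R].
  - by rewrite (Fx Ju); case: ifP => _; [exists 1%R|exists 0%R].
exists H, F; split=> [x h|j e].
  have [l lE] := Fz x; have [l' lE'] := Fz h.
  rewrite conjgE !gmulfM multiplicativeV -conjgE lE lE' conj_commute //.
  exact: expgz_mulC.
rewrite (multiplicative_expgz F) Fa; case: eqP => [->|ji]; first by rewrite zo; split; [right|case].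
by rewrite expgz1n; split=> // _; left.
Qed.

Definition on_axis i (w : W D) := exists (e : int) h,
  val w = expgz (ambx D i) (Posz (step D i) * e)%R ^ h /\ val w <> 1.

Lemma reflections_axis w : R w <-> exists i, on_axis i w.
Proof. exact: reflectionsP. Qed.

(** Phrased with reflections only, so that it is preserved by isomorphisms in reflection. *)
Definition same_axis (w v : W D) := exists x, w^-1 * v ^ x = 1 \/ R (w^-1 * v ^ x).

(** If [i] and [j] differ, [w^-1 * v ^ x] is nontrivial under the maps of both axes, whereas a
    reflection survives only under the map of its own. If they agree, some [x] in [W] aligns the
    conjugators, since [J] is [W] times central elements, and the quotient is again a power of the
    same generator. *)
Lemma same_axisP i j w v : on_axis i w -> on_axis j v -> same_axis w v <-> i = j.
Proof.
move=> [e [h [wE w1]]] [e' [h' [vE v1]]]; split.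
  have [H [F [FJ Fx]]] := axis_hom i; have [H' [F' [FJ' Fx']]] := axis_hom j.
  move=> [x rR]; have [//|ij] := pselect (i = j); exfalso.
  have rE : val (w^-1 * v ^ x) = (val w)^-1 * (val v) ^ (val x) by [].
  have Fw : F (val w) <> 1.
    rewrite wE FJ => /Fx[//|E]; apply: w1; rewrite wE.
    by have /ambx_order -> := E; rewrite conj1g.
  have Fv : F' (val v) <> 1.
    rewrite vE FJ' => /Fx'[//|E]; apply: v1; rewrite vE.
    by have /ambx_order -> := E; rewrite conj1g.
  have Fr : F (val (w^-1 * v ^ x)) <> 1.
    rewrite rE gmulfM FJ multiplicativeV.
    have -> : F (val v) = 1 by rewrite vE FJ; apply/Fx; left; apply/nesym.
    by rewrite mulg1 => /eqP; rewrite invg_eq1 => /eqP.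
  have Fr' : F' (val (w^-1 * v ^ x)) <> 1.
    rewrite rE gmulfM FJ' multiplicativeV.
    have -> : F' (val w) = 1 by rewrite wE FJ'; apply/Fx'; left.
    by rewrite invg1 mul1g.
  case: rR => [r1|/reflections_axis[l [d [a [lE _]]]]].
    by apply: Fr; rewrite r1 multiplicative1.
  have li : l = i.
    by have [//|li] := pselect (l = i); case: Fr; rewrite lE FJ; apply/Fx; left.
  have lj : l = j.
    by have [//|li'] := pselect (l = j); case: Fr'; rewrite lE FJ'; apply/Fx'; left.
  by apply: ij; rewrite -li.
move=> ij; rewrite -ij in vE.
have [x [l xE]] := J_W_dJ (h'^-1 * h).
have vx : (val v) ^ (val x) = expgz (ambx D i) (Posz (step D i) * e')%R ^ h.
  have -> : val x = h'^-1 * h * expgz (dJ D) (- l)%R by rewrite xE -mulgA -expgzD GRing.addrN mulg1.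
  rewrite vE -conjgM mulgA mulgA mulgV mul1g conjgM.
  exact/conj_commute/commute_sym/dJ_comm.
exists x; have [r1|r1] := pselect (w^-1 * v ^ x = 1); [by left|right].
have E : val (w^-1 * v ^ x) = expgz (ambx D i) (Posz (step D i) * (- e + e'))%R ^ h.
  have -> : val (w^-1 * v ^ x) = (val w)^-1 * (val v) ^ (val x) by [].
  by rewrite vx wE -conjVg -expgzN -conjMg -expgzD GRing.mulrDr GRing.mulrN.
apply/reflectionsP; exists i, (- e + e')%R, h; split=> // r1'; apply: r1; exact: val_inj.
Qed.

Lemma axis_gen i : (2 <= mark D i)%N -> exists w : W D, on_axis i w /\ has_order w (mark D i).
Proof.
move=> m2; have [w wE] := gen_in_W i 1%R (1 : J); rewrite GRing.mulr1 conjg1 in wE.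
have vo : has_order (val w) (mark D i).
  by rewrite wE; apply: has_order_expgz; rewrite ?step_gt0 // mark_step; exact: ambx_order.
have wo : has_order w (mark D i).
  exact: (proj2 (@has_order_iso _ _ (val : {multiplicative W D -> J}) w _ val_inj) vo).
exists w; split=> //; exists 1%R, 1; rewrite GRing.mulr1 conjg1; split=> // /(vo 1%R)/dvdn_leq.
by move=> /(_ isT); rewrite leqNgt m2.
Qed.

Lemma axis_exponent i w : on_axis i w -> w ^+ mark D i = 1.
Proof.
move=> [e [h [wE _]]]; apply: val_inj.
apply: (etrans (multiplicativeX (val : {multiplicative W D -> J}) _ _)).
have -> : val w ^+ mark D i = 1; last by [].
rewrite wE -conjXg -expgz_nat -expgzM.
have /ambx_order -> : (Nd D i %| absz (Posz (step D i) * e * Posz (mark D i))%R)%N.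
  by rewrite -mark_step !abszM /= mulnAC [X in (X %| _)%N]mulnC dvdn_mulr.
exact: conj1g.
Qed.

End Axes.

Lemma same_axis_iso D1 D2 (f : {multiplicative W D1 -> W D2}) w v :
  (f @` reflections D1)%classic = reflections D2 -> same_axis w v -> same_axis (f w) (f v).
Proof.
move=> fR [x [r1|rR]]; exists (f x).
  left; rewrite conjgE -!multiplicativeV -!gmulfM -conjgE r1; exact: multiplicative1.
by right; rewrite conjgE -!multiplicativeV -!gmulfM -conjgE -fR; exists (w^-1 * v ^ x).
Qed.

(** Axes with a mark of at least 2 are those carrying reflections, and they are the classes of
    [same_axis]. The mark is an exponent for the reflections of its axis and is attained as an
    order, so it divides its counterpart in both directions. *)
Lemma axis_map D1 D2 (f : {multiplicative W D1 -> W D2}) :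
  bijective f -> (f @` reflections D1)%classic = reflections D2 ->
  exists sg : 'I_3 -> 'I_3,
  (forall i, (2 <= mark D1 i)%N -> mark D2 (sg i) = mark D1 i) /\
  (forall i j, (2 <= mark D1 i)%N -> (2 <= mark D1 j)%N -> sg i = sg j -> i = j).
Proof.
move=> fb fR; have [G [fK gK _]] := iso_inverse fb.
have GR := image_inverse fK fR.
have F1 i w : on_axis i w -> exists j, on_axis j (f w).
  move=> iw; apply/reflections_axis; rewrite -fR; exists w => //.
  by apply/reflections_axis; exists i.
have G1 j w : on_axis j w -> exists i, on_axis i (G w).
  move=> jw; apply/reflections_axis; rewrite -GR; exists w => //.
  by apply/reflections_axis; exists j.
have ex i : exists j, (2 <= mark D1 i)%N -> exists w, [/\ on_axis i w, has_order w (mark D1 i) & on_axis j (f w)].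
  have [m2|m1] := boolP (2 <= mark D1 i)%N; last by exists i0.
  by have [w [iw wo]] := axis_gen m2; have [j jw] := F1 _ _ iw; exists j; exists w.
have [sg sgP] : exists sg : 'I_3 -> 'I_3, forall i, (2 <= mark D1 i)%N ->
    exists w, [/\ on_axis i w, has_order w (mark D1 i) & on_axis (sg i) (f w)].
  by exists (fun i => sval (cid (ex i))) => i; case: (cid _).
exists sg; split=> [i m2|i j mi mj ij].
  have [w [iw wo jw]] := sgP i m2.
  have d1 : (mark D1 i %| mark D2 (sg i))%N.
    apply/(has_order_expg _ wo); apply: (can_inj fK); rewrite multiplicativeX (axis_exponent jw).
    by rewrite multiplicative1.
  have m2' : (2 <= mark D2 (sg i))%N by apply: leq_trans m2 (dvdn_leq (mark_gt0 _ _) d1).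
  have [v [jv vo]] := axis_gen m2'; have [l lv] := G1 _ _ jv.
  have il : i = l.
    apply/(same_axisP iw lv); rewrite -[w]fK.
    by apply: (same_axis_iso GR); apply/(same_axisP jw jv).
  apply/eqP; rewrite eqn_dvd d1 andbT; apply/(has_order_expg _ vo).
  by apply: (can_inj gK); rewrite multiplicativeX multiplicative1 il (axis_exponent lv).
have [w [iw _ iw']] := sgP i mi; have [v [jv _ jv']] := sgP j mj.
apply/(same_axisP iw jv); rewrite -[w]fK -[v]fK.
by apply: (same_axis_iso GR); apply/(same_axisP iw' jv').
Qed.

Definition marks D := [:: Jk D; Jb D; Jc D].

Lemma count_marks (P : pred nat) D : count P (marks D) = #|[pred i | P (mark D i)]|.
Proof.
have -> : marks D = [seq mark D i | i <- enum 'I_3].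
  by rewrite !enum_ordSl; case: (enum 'I_0) (size_enum_ord 0) => // _.
by rewrite count_map cardE -size_filter enumT.
Qed.

Lemma count_marks_le D1 D2 (f : {multiplicative W D1 -> W D2}) (P : pred nat) :
  bijective f -> (f @` reflections D1)%classic = reflections D2 ->
  (forall v, P v -> (2 <= v)%N) -> (count P (marks D1) <= count P (marks D2))%N.
Proof.
move=> fb fR P2; rewrite !count_marks; have [sg [sgE sgi]] := axis_map fb fR.
rewrite -(card_in_imset (f := sg) (D := [pred i | P (mark D1 i)])).
  by apply/subset_leq_card/fintype.subsetP => _ /imsetP[i Pi ->]; rewrite inE sgE ?P2.
by move=> i j Pi Pj; apply: sgi; apply: P2.
Qed.

Lemma marks_iso D1 D2 (f : {multiplicative W D1 -> W D2}) :
  bijective f -> (f @` reflections D1)%classic = reflections D2 ->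
  perm_eq (marks D1) (marks D2).
Proof.
move=> fb fR; have [G [fK _ Gb]] := iso_inverse fb.
have GR := image_inverse fK fR.
have E (P : pred nat) : (forall v, P v -> (2 <= v)%N) -> count P (marks D1) = count P (marks D2).
  by move=> P2; apply/eqP; rewrite eqn_leq (count_marks_le fb fR) // (count_marks_le Gb GR).
have c0 D : count_mem 0%N (marks D) = 0%N.
  by rewrite /=; have := Jk_ge2 D; have := Jb_gt0 D; have := Jc_gt0 D; lia.
(* An axis of mark 1 carries no reflection and is seen only as the complement of the others among
   three. *)
have c1 D : count_mem 1%N (marks D) = (3 - count [pred v | 2 <= v] (marks D))%N.
  by rewrite /=; have := Jk_ge2 D; have := Jb_gt0 D; have := Jc_gt0 D; lia.
apply/allP => v _; apply/eqP; case: v => [|[|v]].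
- by rewrite !c0.
- by rewrite !c1 E.
- by apply: E => _ /eqP ->.
Qed.

(** * The finite case *)

Section Triple.
Variable N : 'I_3 -> nat.
Hypothesis Nge2 : forall i, (2 <= N i)%N.
Local Notation T := (vonDyck N).
Local Notation x := (vx N).

Lemma vx_ord i : has_order (x i) (N i).
Proof. by apply: (vx_order Rdefinitions.R); apply: Nneq1. Qed.

Lemma vx_ind2 (i j : 'I_3) (P : T -> Prop) : i != j -> subgroup_pred P ->
  P (x i) -> P (x j) -> forall g, P g.
Proof.
have main k : subgroup_pred P -> P (x k) -> P (x (ordS k)) -> forall g, P g.
  move=> sP Pk Pk'; have [P1 PM PV] := sP.
  have Pk'' : P (x (ordS (ordS k))).
    have /eqP := vx_prod N k; rewrite mulg_eq1 => /eqP E.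
    by rewrite -[x _]invgK -E; apply/PV/PM.
  apply: vx_ind => // l; move: k Pk Pk' Pk''.
  by elim/I3_ind: l; elim/I3_ind; rewrite ?ordS3.
move=> /ordSP[->|->] sP Pi Pj; [exact: (main i)|exact: (main j)].
Qed.

(** An isomorphism invariant that separates the dihedral groups, whose squares are rotations, from
    the other finite von Dyck groups. *)
Definition squares_commute := forall g h : T, commute (g * g) (h * h).

(** An element of order 3 is the inverse of its own square, so the square of [x j] would commute
    with both [x i] and [x j], which generate. It would be central, hence trivial, against the order
    of [x j]. *)
Lemma squares_not_commute i j : i != j -> N i = 3%N -> (3 <= N j)%N ->
  (forall k l, k != l -> N k = 2%N -> N l <> 2%N) -> ~ squares_commute.
Proof.
move=> ij Ni Nj N2 c.
have cy : center T (x j * x j).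
  move=> g; move: g; apply: (vx_ind2 ij); first exact: commute_subgroup.
    have -> : x i = (x i * x i)^-1.
      by apply/eqP; rewrite -mulg_eq1 mulgA -expg2 -expgSr -Ni vx_pow.
    exact/commuteV/commute_sym/c.
  by rewrite /commute !mulgA.
have := vonDyck_center Rdefinitions.R (fun i => Nneq1 Nge2 i) N2 cy.
by rewrite -expg2 => /(has_order_expg 2 (vx_ord j))/dvdn_leq; lia.
Qed.

Section DihedralTriple.
Variable a : 'I_3.
Hypotheses (Na : N a = 2%N) (Nb : N (ordS a) = 2%N).
Local Notation s := (x a).
Local Notation t := (x (ordS a)).
Local Notation u := (x (ordS (ordS a))).

Lemma dih_ss : s * s = 1. Proof. by rewrite -expg2 -Na vx_pow. Qed.
Lemma dih_tt : t * t = 1. Proof. by have := vx_pow N (ordS a); rewrite Nb expg2. Qed.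

Lemma dih_form (g : T) : exists (i : int) (e : bool), g = (if e then s else 1) * expgz u i.
Proof.
have stu1 : 1 = s * t * u by rewrite vx_prod.
have c1 h : commute (1 : T) h by exact/commute_sym/commute1.
have sub := @dihedral_form_subgroup T s t u 1 dih_ss dih_tt stu1 c1.
have tu : (ordS a) != ordS (ordS a) by move: a => b; elim/I3_ind: b.
have [i [j [e gE]]] : exists (i j : int) (e : bool), g = expgz 1 j * ((if e then s else 1) * expgz u i).
  move: g; apply: (vx_ind2 tu) => //; last by exists 1%R, 0%R, false; rewrite !mul1g.
  exists (-1)%R, 0%R, true; rewrite /= mul1g.
  have h : s * t * u = 1 := esym stu1.
  have tE : t = s^-1 * u^-1.
    by apply: (@mulgI _ s); rewrite mulVKg; apply: (@mulIg _ u); rewrite mulVg.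
  have -> : s = s^-1 by apply/eqP; rewrite -mulg_eq1 dih_ss.
  by rewrite tE expg1.
by exists i, e; rewrite gE expgz1n mul1g.
Qed.

Lemma dih_inv : u ^ s = u^-1.
Proof.
have uE : u^-1 = s * t by apply/esym/eqP; rewrite -mulg_eq1 vx_prod.
have sV : s^-1 = s by apply/eqP; rewrite eq_sym -mulg_eq1 dih_ss.
have -> : u = t * s.
  rewrite -[LHS]invgK uE invgM sV; congr (_ * _).
  by apply/eqP; rewrite eq_sym -mulg_eq1 dih_tt.
rewrite conjgE sV -!mulgA dih_ss mulg1 invgM sV; congr (_ * _).
by apply/eqP; rewrite -mulg_eq1 dih_tt.
Qed.

Lemma dih_square (g : T) : g * g = 1 \/ exists i : int, g = expgz u i.
Proof.
have [i [[] ->]] := dih_form g; last by right; exists i; rewrite mul1g.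
left; have E : expgz u i * s = s * expgz u (- i)%R.
  have -> : expgz u (- i)%R = expgz u i ^ s.
    by rewrite -expgz_conj dih_inv -[u^-1]/(expgz u (-1)%R) -expgzM GRing.mulN1r.
  by rewrite conjgE mulVKg.
by rewrite -mulgA (mulgA (expgz u i)) E mulgA mulgA dih_ss mul1g -expgzD GRing.addNr.
Qed.

Lemma dih_squares_commute : squares_commute.
Proof.
have sq g : exists i : int, g * g = expgz u i.
  have [->|[i ->]] := dih_square g; first by exists 0%R.
  by exists (i + i)%R; rewrite expgzD.
by move=> g h; have [i ->] := sq g; have [j ->] := sq h; exact: expgz_mulC.
Qed.

Lemma dih_exponent (g : T) : g * g = 1 \/ g ^+ N (ordS (ordS a)) = 1.
Proof.
have [|[i ->]] := dih_square g; [by left|right].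
by rewrite -expgz_nat -expgzM GRing.mulrC expgzM expgz_nat vx_pow expgz1n.
Qed.

End DihedralTriple.

Definition tri := [:: N i0; N i1; N i2].

(** A map to [Z/d] kills each generator whose label is prime to [d], and two dead generators kill
    the third. Conversely two generators with labels divisible by [d] can be sent to opposite
    elements. This separates the triples [(2, 3, e)] for [e] equal to 3, 4, 5. *)
Lemma cyclic_quotientP d : prime d ->
  (exists (F : {multiplicative T -> 'I_d.-1.+1}) g, F g <> 1) <->
  (2 <= count (fun v => d %| v)%N tri)%N.
Proof.
move=> pd; have d1 : (1 < d)%N := prime_gt1 pd.
have dE : d.-1.+1 = d by rewrite prednK // ltnW.
have zo : has_order (inZp 1 : 'I_d.-1.+1) d.
  apply: expg_has_order => [|i]; rewrite Zp_expg.
    by apply: val_inj; rewrite /= dE modnMml mul1n modnn.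
  move=> /(congr1 (@nat_of_ord _)) /=.
  by rewrite dE modnMml mul1n => h; rewrite /dvdn h.
split=> [[F [g Fg]]|].
  have tr i : ~~ (d %| N i)%N -> F (x i) = 1.
    move=> dN; have cp : coprime (N i) d by rewrite coprime_sym prime_coprime.
    have h1 : F (x i) ^+ N i = 1 by rewrite -multiplicativeX vx_pow multiplicative1.
    have h2 : F (x i) ^+ d = 1.
      rewrite Zp_expg; apply: val_inj => /=; move: (nat_of_ord (F (x i))) => y.
    by rewrite dE modnMl.
    have [al [be bez]] := bezout_coprime cp.
    rewrite -[LHS]expgz1 -bez expgzD 2![(_ * Posz _)%R]GRing.mulrC !expgzM.
    by rewrite !expgz_nat h1 h2 !expgz1n mulg1.
  rewrite leqNgt; apply/negP => c; apply: Fg; move: g.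
  have tr2 i j : i != j -> ~~ (d %| N i)%N -> ~~ (d %| N j)%N -> forall g, F g = 1.
    move=> ij di dj; have sF := subgroup_preim F (expgz_subgroup (1 : 'I_d.-1.+1)).
    move=> g; suff [l ->] : exists l, F g = expgz 1 l by exact: expgz1n.
    by move: g; apply: (vx_ind2 ij) => //; rewrite tr //; exists 0%R.
  move: c; rewrite /tri /= addn0; have [d0|d0] := boolP (d %| N i0)%N.
    by have [//|d1'] := boolP (d %| N i1)%N; have [//|d2'] := boolP (d %| N i2)%N => _; apply: (tr2 i1 i2).
  have [d1'|d1'] := boolP (d %| N i1)%N; last by move=> _; apply: (tr2 i0 i1).
  by have [//|d2'] := boolP (d %| N i2)%N => _; apply: (tr2 i0 i2).
pose z : 'I_d.-1.+1 := inZp 1.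
have zX k : (d %| k)%N -> z ^+ k = 1 by move=> dk; apply/(has_order_expg k zo).
have z1 : z <> 1 by move=> h; have /(zo 1%R) : z = 1 := h; rewrite dvdn1 => /eqP E; rewrite E in d1.
rewrite /tri /= => c; have [a [da db]] : exists a, (d %| N a)%N /\ (d %| N (ordS a))%N.
  have [d0|d0] := boolP (d %| N i0)%N; last first.
    by exists i1; rewrite ordS3; move: c; rewrite (negbTE d0); do 2!case: (d %| _)%N.
  have [d1'|d1'] := boolP (d %| N i1)%N; first by exists i0; rewrite ordS3.
  by exists i2; rewrite ordS3; move: c; rewrite (negbTE d1'); do 2!case: (d %| _)%N.
pose f i := if i == a then z else if i == ordS a then z^-1 else 1.
have f1 : f i0 * f i1 * f i2 = 1.
  by rewrite /f; elim/I3_ind: (a); rewrite ordS3 /= ?mulg1 ?mul1g ?mulgV ?mulVg.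
have [|F FE] := @vonDyck_lift N 'I_d.-1.+1 f _ f1.
  move=> i; rewrite /f; case: eqP => [->|_]; first exact: zX.
  by case: eqP => [->|_]; rewrite ?expVgn ?zX ?invg1 ?expg1n.
by exists F, (x a); rewrite FE /f eqxx.
Qed.

End Triple.

Local Close Scope group_scope.
Local Open Scope nat_scope.

(** * Arithmetic of spherical triples *)

Lemma perm_eq3P (a b c a' b' c' : nat) : perm_eq [:: a; b; c] [:: a'; b'; c'] ->
  (a = a' /\ b = b' /\ c = c') \/ (a = a' /\ b = c' /\ c = b') \/
  (a = b' /\ b = a' /\ c = c') \/ (a = b' /\ b = c' /\ c = a') \/
  (a = c' /\ b = a' /\ c = b') \/ (a = c' /\ b = b' /\ c = a').
Proof.
have one (x y : nat) : perm_eq [:: x] [:: y] -> x = y.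
  by move=> /perm_mem/(_ x); rewrite !inE eqxx => /esym/eqP.
have two (x y x' y' : nat) : perm_eq [:: x; y] [:: x'; y'] -> (x = x' /\ y = y') \/ (x = y' /\ y = x').
  move=> p; have : x \in [:: x'; y'] by rewrite -(perm_mem p) inE eqxx.
  rewrite !inE => /orP[]/eqP E; move: p; rewrite E.
    by rewrite perm_cons => /one ->; left.
  by rewrite (permPr (permEl (perm_catC [:: x'] [:: y']))) perm_cons => /one ->; right.
move=> p; have : a \in [:: a'; b'; c'] by rewrite -(perm_mem p) inE eqxx.
rewrite !inE => /or3P[]/eqP E; move: p; rewrite E.
- by rewrite perm_cons => /two; lia.
- rewrite (permPr (permEl (perm_catCA [:: a'] [:: b'] [:: c']))) perm_cons => /two; lia.
- rewrite (permPr (permEl (perm_catC [:: a'; b'] [:: c']))) perm_cons => /two; lia.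
Qed.

Definition spherical (a b c : nat) := (a * b * c < b * c + a * c + a * b)%N.

Lemma spherical_large a b c : (2 <= a)%N -> (2 <= c)%N -> spherical a b c -> (6 <= b)%N -> a = 2%N /\ c = 2%N.
Proof. rewrite /spherical; nia. Qed.

Lemma coprime_prod_ge6 b n : (2 <= b)%N -> (2 <= n)%N -> coprime n b -> (6 <= b * n)%N.
Proof.
move=> b2 n2 c; have : ~ (b = 2 /\ n = 2) by case=> b2' n2'; move: c; rewrite b2' n2'.
nia.
Qed.

Lemma spherical_triple a b c : (2 <= a)%N -> (2 <= b)%N -> (2 <= c)%N -> spherical a b c ->
  ~ (a = 2 /\ b = 2) -> ~ (b = 2 /\ c = 2) -> ~ (c = 2 /\ a = 2) ->
  exists e, (e \in [:: 3; 4; 5]) /\ perm_eq [:: a; b; c] [:: 2; 3; e].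
Proof.
rewrite /spherical => a2 b2 c2 S h1 h2 h3.
have a5 : (a <= 5)%N by nia.
have b5 : (b <= 5)%N by nia.
have c5 : (c <= 5)%N by nia.
(* The sum of the three entries has to be [2 + 3 + e]. *)
exists (a + b + c - 5)%N.
move: a2 b2 c2 S h1 h2 h3 a5 b5 c5.
case: a => [|[|[|[|[|[|a]]]]]] //; case: b => [|[|[|[|[|[|b]]]]]] //; case: c => [|[|[|[|[|[|c]]]]]] // _ _ _ S h1 h2 h3 _ _ _ //;
by [case: h1|case: h2|case: h3].
Qed.

Lemma large_triple k b n m : (2 <= k)%N -> (2 <= b)%N -> (2 <= m)%N -> (2 <= n)%N ->
  coprime n b -> spherical k (b * n) m -> [/\ k = 2, m = 2 & (b = 2 -> 3 <= n)]%N.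
Proof.
move=> k2 b2 m2 n2 c S; have [-> ->] := spherical_large k2 m2 S (coprime_prod_ge6 b2 n2 c).
split=> // bE; rewrite ltn_neqAle n2 andbT; apply/eqP => nE.
by move: c; rewrite bE -nE.
Qed.

(* [(k, n, m) = (2, 2 n, 2)] with marks [(2, 2, 1)] and [(2, 2, 2 n)] with marks
   [(2, 2, 1)] are not told apart by the numerical invariants. *)
Definition ambiguous (k b n m k' b' n' m' : nat) :=
  [/\ k = 2, b = 2, m = 2 & 3 <= n] /\ [/\ k' = 2, b' = 2, n' = 1 & m' = 2 * n].

(** The ways of matching marks and triples are enumerated. If [n] is at least 2 and prime to [b],
    then [b * n] is at least 6 and sphericity forces [k = m = 2], which leaves only the ambiguous
    pair. *)
Lemma two_marks_arith k b n m k' b' n' m' :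
  (2 <= k)%N -> (2 <= b)%N -> (2 <= m)%N -> (0 < n)%N ->
  (2 <= k')%N -> (2 <= b')%N -> (2 <= m')%N -> (0 < n')%N ->
  coprime n m -> coprime n' m' -> spherical k (b * n) m -> spherical k' (b' * n') m' ->
  perm_eq [:: k; b; 1%N] [:: k'; b'; 1%N] ->
  perm_eq [:: k; b * n; m] [:: k'; b' * n'; m'] ->
  ~ ambiguous k b n m k' b' n' m' -> ~ ambiguous k' b' n' m' k b n m -> m = m'.
Proof.
move=> k2 b2 m2 n0 k2' b2' m2' n0' c c' S S' /perm_eq3P P1 /perm_eq3P P2 C C'.
have ge2 (x : nat) : (0 < x)%N -> x = 1%N \/ (2 <= x)%N by lia.
have L : coprime n b -> n = 1%N \/ [/\ k = 2, m = 2 & (b = 2 -> 3 <= n)]%N.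
  by move=> nb; have [|n2] := ge2 n n0; [left|right; apply: large_triple S].
have L' : coprime n' b' -> n' = 1%N \/ [/\ k' = 2, m' = 2 & (b' = 2 -> 3 <= n')]%N.
  by move=> nb; have [|n2] := ge2 n' n0'; [left|right; apply: large_triple S'].
have dv (x y z : nat) : coprime x (y * z) -> coprime x y by rewrite coprimeMr => /andP[].
have [//|mm] := eqVneq m m'; exfalso; move/eqP: mm => mm.
(* The crossed matching: it makes [n] and [n'] prime to [b], so either both are 1 and [m = m'], or
   one of the two orders is ambiguous. *)
have swap : k = k' -> b = b' -> m = (b * n')%N -> m' = (b * n)%N -> False.
  move=> kk bb mE mE'; have nb : coprime n b by apply: (dv n b n'); rewrite -mE.
  have nb' : coprime n' b' by apply: (dv n' b' n); rewrite -bb -mE'.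
  have [n1|[kE m2E bE]] := L nb.
    have [n1'|[kE' mE2 bE']] := L' nb'; first by apply: mm; rewrite mE mE' n1 n1'.
    apply: C'; split; split; nia.
  apply: C; split; split; nia.
have {P1} [[kk bb]|[kb bk]] : (k = k' /\ b = b') \/ (k = b' /\ b = k') by lia.
  have [mE mE'] : m = (b * n')%N /\ m' = (b * n)%N by rewrite bb in P2 *; lia.
  exact: swap.
have [mb|[mE|//]] : m = b \/ (m = (k * n')%N \/ m = m') by lia.
  have nb : coprime n b by rewrite -mb.
  have [n1|[kE m2E bE]] := L nb.
    have {P2} [[kE mE']|[kE bE]] : (k = (b' * n')%N /\ m' = (b * n)%N) \/ (k = m' /\ (b * n = b' * n')%N) by lia.
      by apply: mm; rewrite mE' n1 muln1.
    have nb' : coprime n' b' by rewrite -kb kE.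
    have [n1'|[kE' mE2 bE']] := L' nb'; first by apply: mm; move: bE; rewrite n1 n1' !muln1 -kb; lia.
    by move: bE; rewrite n1; nia.
  apply: C; split; split; nia.
have [kb'|kb'] := eqVneq k b.
  apply: swap; [by rewrite kb'|by rewrite -kb'|by rewrite -kb'|].
  by rewrite -kb in P2; rewrite -bk -kb' in P2; rewrite -kb'; lia.
have [kE bE] : k = m' /\ (b * n = b)%N by rewrite -kb in P2; move/eqP: kb'; lia.
have nb' : coprime n' b' by rewrite -kb kE.
have [n1'|[kE' mE2 bE']] := L' nb'; first by apply: mm; rewrite mE n1' muln1.
by move/eqP: kb'; lia.
Qed.

Local Open Scope group_scope.

Lemma ordS_cycle (i : 'I_3) : ordS (ordS (ordS i)) = i.
Proof. by elim/I3_ind: i; rewrite !ordS3. Qed.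

Lemma ordS_cases (i j : 'I_3) : [\/ i = j, i = ordS j | i = ordS (ordS j)].
Proof.
by elim/I3_ind: i; elim/I3_ind: j; rewrite !ordS3; by [constructor 1|constructor 2|constructor 3].
Qed.

Section SphericalTriple.
Variable N : 'I_3 -> nat.
Hypothesis Nge2 : forall i, (2 <= N i)%N.
Hypothesis sph : spherical (N i0) (N i1) (N i2).

Definition dih := exists a, N a = 2%N /\ N (ordS a) = 2%N.

Lemma not_dih_tri : ~ dih -> exists e, (e \in [:: 3; 4; 5]%N) /\ perm_eq (tri N) [:: 2; 3; e]%N.
Proof.
move=> nd; apply: spherical_triple => // -[h h']; apply: nd.
- by exists i0; rewrite ordS3.
- by exists i1; rewrite ordS3.
- by exists i2; rewrite ordS3.
Qed.

Lemma squares_commuteP : squares_commute N <-> dih.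
Proof.
split=> [c|[a [Na Nb]]]; last exact: (dih_squares_commute Na Nb).
have [//|nd] := pselect dih; have [e [e3 p]] := not_dih_tri nd.
have N2 k l : k != l -> N k = 2%N -> N l <> 2%N.
  move=> /ordSP[->|->] h h'; apply: nd; first by exists k.
  by exists l.
have {}e3 : (3 <= e)%N by move: e3; rewrite !inE => /or3P[]/eqP->.
have {}p := perm_eq3P p; exfalso.
have [i [j [ij [Ni Nj]]]] : exists i j, i != j /\ N i = 3%N /\ (3 <= N j)%N.
  have : (N i0 = 3 /\ 3 <= N i1 \/ N i1 = 3 /\ 3 <= N i0 \/ N i0 = 3 /\ 3 <= N i2 \/
          N i2 = 3 /\ 3 <= N i0 \/ N i1 = 3 /\ 3 <= N i2 \/ N i2 = 3 /\ 3 <= N i1)%N by lia.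
  by move=> [h|[h|[h|[h|[h|h]]]]];
    [exists i0, i1|exists i1, i0|exists i0, i2|exists i2, i0|exists i1, i2|exists i2, i1].
exact: (squares_not_commute Nge2 ij Ni Nj N2 c).
Qed.

End SphericalTriple.

Section TripleIso.
Variables N N' : 'I_3 -> nat.
Hypotheses (Nge2 : forall i, (2 <= N i)%N) (Nge2' : forall i, (2 <= N' i)%N).
Variables (phi : {multiplicative vonDyck N -> vonDyck N'}) (phib : bijective phi).

Lemma squares_commute_iso : squares_commute N -> squares_commute N'.
Proof.
have [psi [_ K _]] := iso_inverse phib.
by move=> c g h; have := congr1 phi (c (psi g) (psi h)); rewrite !gmulfM !K.
Qed.

Lemma dih_iso_dvd a : N' a = 2%N -> N' (ordS a) = 2%N ->
  forall i, (N i %| 2)%N \/ (N i %| N' (ordS (ordS a)))%N.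
Proof.
move=> Na Nb i; have phii := bij_inj phib; have [h|h] := dih_exponent Na Nb (phi (vx N i)).
  left; apply/(has_order_expg 2 (vx_ord Nge2 i)); apply: phii.
  by rewrite multiplicativeX multiplicative1 expg2.
right; apply/(has_order_expg _ (vx_ord Nge2 i)); apply: phii.
by rewrite multiplicativeX multiplicative1.
Qed.

Lemma cyclic_quotient_iso d : prime d -> (2 <= count (fun v => d %| v)%N (tri N))%N ->
  (2 <= count (fun v => d %| v)%N (tri N'))%N.
Proof.
move=> pd /(cyclic_quotientP _ pd)[F [g Fg]]; apply/(cyclic_quotientP _ pd).
have [psi [K _ _]] := iso_inverse phib.
by exists (F \o psi : {multiplicative _ -> _}), (phi g); rewrite /= K.
Qed.

End TripleIso.

(** In the dihedral case the third label is recovered because each generator has order dividing 2 or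
    the third label of the other group. Otherwise the triple is [(2, 3, e)], and the existence of
    quotients of order 2 and 3 determines [e]. *)
Lemma triple_iso N N' (phi : {multiplicative vonDyck N -> vonDyck N'}) :
  (forall i, (2 <= N i)%N) -> (forall i, (2 <= N' i)%N) ->
  spherical (N i0) (N i1) (N i2) -> spherical (N' i0) (N' i1) (N' i2) ->
  bijective phi -> perm_eq (tri N) (tri N').
Proof.
move=> Nge2 Nge2' S S' phib; have [psi [_ _ psib]] := iso_inverse phib.
have [[a [Na Nb]]|nd] := pselect (dih N).
  have [a' [Na' Nb']] : dih N'.
    apply/(squares_commuteP Nge2' S'); apply: (squares_commute_iso phib).
    by apply/(squares_commuteP Nge2 S); exists a.
  have E : N (ordS (ordS a)) = N' (ordS (ordS a')).
    have d1 := dih_iso_dvd Nge2 phib Na' Nb' (ordS (ordS a)).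
    have d2 := dih_iso_dvd Nge2' psib Na Nb (ordS (ordS a')).
    have := Nge2 (ordS (ordS a)); have := Nge2' (ordS (ordS a')) => h' h.
    have D2 (x : nat) : (2 <= x)%N -> (x %| 2)%N -> x = 2%N.
      by move=> x2 /dvdn_leq => /(_ isT); lia.
    apply/eqP; rewrite eqn_dvd.
    case: d1 d2 => [/(D2 _ h) E|d1] [/(D2 _ h') E'|d2].
    - by rewrite E E'.
    - by rewrite d2 andbT; move: d2; rewrite E => /(D2 _ h') ->.
    - by rewrite d1 /=; move: d1; rewrite E' => /(D2 _ h) ->.
    - by rewrite d1 d2.
  have T3 M b : M b = 2%N -> M (ordS b) = 2%N -> perm_eq (tri M) [:: 2; 2; M (ordS (ordS b))]%N.
    move=> h1 h2; rewrite /tri; elim/I3_ind: b h1 h2; rewrite !ordS3 => -> -> //; apply/allP => v _ /=; apply/eqP; lia.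
  by apply: perm_trans (T3 _ _ Na Nb) _; rewrite E perm_sym T3.
have nd' : ~ dih N'.
  move=> /(squares_commuteP Nge2' S')/(squares_commute_iso psib) h; apply: nd.
  exact/(squares_commuteP Nge2 S).
have [e [eE p]] := not_dih_tri Nge2 S nd; have [e' [eE' p']] := not_dih_tri Nge2' S' nd'.
suff ee : e = e' by apply: perm_trans p _; rewrite ee perm_sym.
have c d : prime d -> (2 <= count (fun v => d %| v)%N [:: 2; 3; e]%N)%N = (2 <= count (fun v => d %| v)%N [:: 2; 3; e']%N)%N.
  move=> pd; rewrite -(seq.permP p) -(seq.permP p').
  by apply/idP/idP; [exact: (cyclic_quotient_iso phib)|exact: (cyclic_quotient_iso psib)].
move: eE eE' (c 2%N isT) (c 3%N isT); rewrite !inE.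
by move=> /or3P[]/eqP-> /or3P[]/eqP->.
Qed.

(** * Central reflections and the ambiguous pair *)

Section CentralReflection.
Variable D : J_reflection.
Local Notation N := (Nd D).
Local Notation T := (vonDyck N).

Definition central_reflection := exists r, @Rb D r /\ center T r.

Variable j : 'I_3.
Hypotheses (Na : N (ordS j) = 2%N) (Nb : N (ordS (ordS j)) = 2%N).
Local Notation u := (vx N j).
Local Notation s := (vx N (ordS j)).
Local Notation t := (vx N (ordS (ordS j))).

Let u_inv : u ^ s = u^-1.
Proof. by have := dih_inv Na Nb; rewrite ordS_cycle. Qed.

(** The rotation of order 2 in a dihedral group is central, and mark 2 makes it a reflection. *)
Lemma central_reflection_ex : mark D j = 2%N -> central_reflection.
Proof.
move=> m2; have NE : N j = (2 * step D j)%N by rewrite -mark_step m2.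
exists (u ^+ step D j); split.
  exists j, 1%R, 1; rewrite GRing.mulr1 conjg1; split=> //.
  move=> /(has_order_expg _ (Tx_order D j))/dvdn_leq; rewrite NE step_gt0.
  by have := step_gt0 D j; lia.
have uV : (u ^+ step D j)^-1 = u ^+ step D j.
  by apply/eqP; rewrite eq_sym -mulg_eq1 -expgnDr addnn -mul2n -NE vx_pow.
have js : j != ordS j by exact: ordS_neq.
move=> g; move: g; apply: (vx_ind2 js); first exact: commute_subgroup.
  exact/commute_sym/commuteX/commute_refl.
have E : (u ^+ step D j) ^ s = u ^+ step D j by rewrite conjXg u_inv expVgn.
by rewrite /commute -[in RHS]E conjgE mulVKg.
Qed.

(** With mark 1 no rotation about the axis [j] is a reflection, so a central one would be [s] or
    [t]. Then [s] would commute with [u], which it inverts, although [u] has order at least 3. *)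
Lemma no_central_reflection : mark D j = 1%N -> (3 <= N j)%N -> ~ central_reflection.
Proof.
move=> m1 N3 [r [[i [e [a [rE r1]]]] rc]].
have {}rE : r = expgz (vx N i) (Posz (step D i) * e)%R.
  by rewrite -[RHS](conjgK a) -rE conj_commute.
have uu : u * u <> 1.
  by rewrite -expg2 => /(has_order_expg 2 (Tx_order D j))/dvdn_leq; lia.
have stu : s * t * u = 1 by have := vx_prod N (ordS j); rewrite ordS_cycle.
have ss : s * s = 1 by exact: (dih_ss Na).
have tt : t * t = 1 by exact: (dih_ss Nb).
have us : ~ commute s u.
  move=> /commute_sym/conj_commute; rewrite u_inv => E; apply: uu.
  by rewrite -{1}E mulVg.
have inv (l : int) (x : T) : x * x = 1 -> expgz x l = 1 \/ expgz x l = x.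
  move=> xx; have nat_inv (q : nat) : x ^+ q = 1 \/ x ^+ q = x.
    elim: q => [|q [E|E]]; [by left|right|left]; first by rewrite expgS E mulg1.
    by rewrite expgS E.
  have xV : x^-1 = x by apply/eqP; rewrite eq_sym -mulg_eq1 xx.
  case: l => q; first exact: nat_inv.
  by rewrite /=; case: (nat_inv q.+1) => ->; [left; rewrite invg1|right].
have [ij|ij|ij] := ordS_cases i j.
- apply: r1; rewrite rE ij; have -> : step D j = N j by rewrite -mark_step m1 mul1n.
  by rewrite expgzM expgz_nat vx_pow expgz1n.
- have [E|E] := inv (Posz (step D i) * e)%R s ss; rewrite -ij -rE in E.
    by apply: r1.
  by apply: us; rewrite -ij -E; apply: rc.
- have [E|E] := inv (Posz (step D i) * e)%R t tt; rewrite -ij -rE in E.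
    by apply: r1.
  have tc : center T t by rewrite -ij -E.
  apply: us; have -> : s = (t * u)^-1 by apply/eqP; rewrite -mulg_eq1 mulgA stu.
  apply/commute_sym/commuteV/commuteM; [exact/commute_sym/tc|exact: commute_refl].
Qed.

End CentralReflection.

Lemma central_reflection_iso D1 D2 (phi : {multiplicative vonDyck (Nd D1) -> vonDyck (Nd D2)}) :
  bijective phi -> (phi @` @Rb D1)%classic = @Rb D2 ->
  central_reflection D1 -> central_reflection D2.
Proof.
move=> phib phiR [r [rR rc]]; have [psi [_ K _]] := iso_inverse phib.
exists (phi r); split; first by rewrite -phiR; exists r.
by move=> g; have := congr1 phi (rc (psi g)); rewrite !gmulfM !K.
Qed.

(** Lets one argument serve whichever of [b] and [c] is the mark different from 1. *)
Definition oriented (j j' : 'I_3) := (j = i1 /\ j' = i2) \/ (j = i2 /\ j' = i1).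

Lemma oriented_perm j j' (f : 'I_3 -> nat) : oriented j j' ->
  perm_eq [:: f i0; f i1; f i2] [:: f i0; f j; f j'].
Proof.
by move=> [[-> ->]|[-> ->]] //; rewrite perm_cons; apply: (permEl (perm_catC [:: f i1] [:: f i2])).
Qed.

Lemma oriented_other j j' (f : 'I_3 -> nat) v : oriented j j' -> f i0 = v -> f j' = v ->
  f (ordS j) = v /\ f (ordS (ordS j)) = v.
Proof. by move=> [[-> ->]|[-> ->]]; rewrite !ordS3. Qed.

Section TwoMarks.
Variables (D1 D2 : J_reflection).
Hypotheses (S1 : spherical (Nd D1 i0) (Nd D1 i1) (Nd D1 i2))
           (S2 : spherical (Nd D2 i0) (Nd D2 i1) (Nd D2 i2)).
Hypotheses (pm : perm_eq (marks D1) (marks D2)) (pt : perm_eq (tri (Nd D1)) (tri (Nd D2))).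
Hypothesis cr : central_reflection D1 <-> central_reflection D2.

Lemma oriented_coprime D j j' : oriented j j' -> coprime (step D j) (step D j').
Proof.
by move=> [[-> ->]|[-> ->]]; [|rewrite coprime_sym]; exact: Jnm_coprime.
Qed.

Lemma oriented_spherical D j j' : oriented j j' -> mark D j' = 1%N ->
  spherical (Nd D i0) (Nd D i1) (Nd D i2) -> spherical (Jk D) (mark D j * step D j) (step D j').
Proof.
have Nk : Nd D i0 = Jk D by [].
move=> o m1; rewrite mark_step -[step D j']mul1n -m1 mark_step -Nk /spherical.
by move: o => [[-> ->]|[-> ->]] //; lia.
Qed.

(** Both groups of the ambiguous pair are dihedral modulo the center with the same rotation order.
    In the first the rotation axis has mark 2 and yields a central reflection; in the second it has
    mark 1 and there is none. *)
Lemma not_ambiguous E1 E2 j1 j1' j2 j2' : oriented j1 j1' -> oriented j2 j2' ->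
  mark E1 j1' = 1%N -> mark E2 j2' = 1%N -> (central_reflection E1 -> central_reflection E2) ->
  ~ ambiguous (Jk E1) (mark E1 j1) (step E1 j1) (step E1 j1')
              (Jk E2) (mark E2 j2) (step E2 j2) (step E2 j2').
Proof.
move=> o1 o2 m1 m2 c [[k1 b1 s1 n1] [k2 b2 n2 s2]].
have o2' : oriented j2' j2 by case: o2 => -[-> ->]; [right|left].
have [||h1 h2] := @oriented_other j1 j1' (Nd E1) 2 o1.
- exact: k1.
- by rewrite -mark_step m1 s1.
have [||h1' h2'] := @oriented_other j2' j2 (Nd E2) 2 o2'.
- exact: k2.
- by rewrite -mark_step b2 n2.
apply: (no_central_reflection h1' h2' m2); last exact/c/(central_reflection_ex h1 h2 b1).
by rewrite -mark_step m2 s2; lia.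
Qed.

Lemma two_marks j1 j1' j2 j2' : oriented j1 j1' -> oriented j2 j2' ->
  (2 <= mark D1 j1)%N -> mark D1 j1' = 1%N -> (2 <= mark D2 j2)%N -> mark D2 j2' = 1%N ->
  step D1 j1' = step D2 j2'.
Proof.
move=> o1 o2 b1 m1 b2 m2.
have s2 D j j' : oriented j j' -> mark D j' = 1%N -> (2 <= step D j')%N.
  by move=> o m; have := Nd_ge2 D j'; rewrite -mark_step m mul1n.
apply: (@two_marks_arith (Jk D1) (mark D1 j1) (step D1 j1) (step D1 j1')
                         (Jk D2) (mark D2 j2) (step D2 j2) (step D2 j2')) => //.
- exact: Jk_ge2.
- exact: s2 o1 m1.
- exact: step_gt0.
- exact: Jk_ge2.
- exact: s2 o2 m2.
- exact: step_gt0.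
- exact: oriented_coprime.
- exact: oriented_coprime.
- exact: oriented_spherical.
- exact: oriented_spherical.
- have p1 := oriented_perm (mark D1) o1; have p2 := oriented_perm (mark D2) o2.
  rewrite m1 in p1; rewrite m2 in p2; rewrite perm_sym in p1.
  exact: perm_trans p1 (perm_trans pm p2).
- have p1 := oriented_perm (Nd D1) o1; have p2 := oriented_perm (Nd D2) o2.
  rewrite !mark_step -[step D1 j1']mul1n -m1 -[step D2 j2']mul1n -m2 !mark_step.
  by rewrite perm_sym in p1; exact: perm_trans p1 (perm_trans pt p2).
- exact: (not_ambiguous o1 o2 m1 m2 (proj1 cr)).
- exact: (not_ambiguous o2 o1 m2 m1 (proj2 cr)).
Qed.

Lemma finite_case :
  (torus_n D1 = torus_n D2 /\ torus_m D1 = torus_m D2) \/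
  (torus_n D1 = torus_m D2 /\ torus_m D1 = torus_n D2).
Proof.
have o12 : oriented i1 i2 by left.
have o21 : oriented i2 i1 by right.
have M := perm_eq3P pm; have P := perm_eq3P pt.
have one v : (0 < v)%N -> (2 <= v)%N = false -> v = 1%N by lia.
have {P} P : Jk D1 = Jk D2 -> Jb D1 = 1%N -> Jc D1 = 1%N -> Jb D2 = 1%N -> Jc D2 = 1%N ->
    (Jn D1 = Jn D2 /\ Jm D1 = Jm D2) \/ (Jn D1 = Jm D2 /\ Jm D1 = Jn D2).
  move: P; rewrite /Nd /vdN /= => P kk b1 c1 b2 c2; move: P.
  by rewrite kk b1 c1 b2 c2 !mul1n; lia.
have := Jk_ge2 D1; have := Jk_ge2 D2; have := Jb_gt0 D1; have := Jb_gt0 D2.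
have := Jc_gt0 D1; have := Jc_gt0 D2 => g1 g2 g3 g4 k2 k1.
have T := two_marks.
rewrite /torus_n /torus_m.
(* The permutation of marks forces the same number of marks different from 1 on both sides, leaving
   six of the sixteen cases. *)
case b1: (2 <= Jb D1)%N; case c1: (2 <= Jc D1)%N; case b2: (2 <= Jb D2)%N; case c2: (2 <= Jc D2)%N;
  try by exfalso; lia.
- by left.
- have E : Jm D1 = Jm D2 by apply: (T i1 i2 i1 i2) => //; exact: one.
  by left.
- have E : Jm D1 = Jn D2 by apply: (T i1 i2 i2 i1) => //; exact: one.
  by right.
- have E : Jn D1 = Jm D2 by apply: (T i2 i1 i1 i2) => //; exact: one.
  by right.
- have E : Jn D1 = Jn D2 by apply: (T i2 i1 i2 i1) => //; exact: one.
  by left.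
- by apply: P; lia.
Qed.

End TwoMarks.

Lemma isomorphic_sym G H : isomorphic G H -> isomorphic H G.
Proof. by move=> [f /iso_inverse[g [_ _ gb]]]; exists g. Qed.

Lemma isomorphic_trans G H K : isomorphic G H -> isomorphic H K -> isomorphic G K.
Proof. by move=> [f fb] [g gb]; exists (g \o f : {multiplicative _ -> _}); exact: bij_comp. Qed.

Lemma braid_group_torus D : isomorphic (braid_group D) (torus (torus_n D) (torus_m D)).
Proof. by have [F [Fb _]] := torus_bijection D; exists F. Qed.

Lemma part2 D1 D2 : isomorphic_in_reflection D1 D2 -> isomorphic (braid_group D1) (braid_group D2).
Proof.
move=> [f [fb fR]]; have [phi [phib phiR]] := Rb_iso fb fR.
apply: isomorphic_trans (braid_group_torus D1) _.
apply: isomorphic_trans _ (isomorphic_sym (braid_group_torus D2)).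
suff [[-> ->]|[-> ->]] : (torus_n D1 = torus_n D2 /\ torus_m D1 = torus_m D2) \/
    (torus_n D1 = torus_m D2 /\ torus_m D1 = torus_n D2).
- by exists (idfun : {multiplicative _ -> _}); exists id.
- exact: torus_swap.
have [fin1|] := pselect (fin (vonDyck (Nd D1))); last exact: infinite_case phib phiR.
have S1 := spherical_of_fin Rdefinitions.R (@Nd_ge2 D1) fin1.
have S2 := spherical_of_fin Rdefinitions.R (@Nd_ge2 D2) (fin_bij phib fin1).
have [psi [K _ psib]] := iso_inverse phib.
apply: (@finite_case D1 D2) => //.
- exact: marks_iso fb fR.
- exact: (triple_iso (@Nd_ge2 D1) (@Nd_ge2 D2) S1 S2 phib).
split; first exact: central_reflection_iso phib phiR.
exact: central_reflection_iso psib (image_inverse K phiR).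
Qed.

Local Close Scope group_scope.
Local Open Scope classical_set_scope.

Theorem theorem1p9 (W1 W2 : J_reflection) :
  (cyclic_subgroup (center (braid_group W1)) /\
   natural_quotient W1 @` center (braid_group W1) = center (W W1)) /\
  (isomorphic_in_reflection W1 W2 ->
   isomorphic (braid_group W1) (braid_group W2)).
Proof. by split; [split; [exact: part1_cyclic|exact: part1_image]|exact: part2]. Qed.
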